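(* Let $a,u,v\in\mathbb C$ with $0<|a|<1$ and $|u|<\frac12$, put $\varphi(z)=az$, $\psi(z)=\exp(uz^2+vz)$, $b=\frac{v}{1-a}$, $c=\frac{u}{1-a^2}$, and suppose that $c$ is real with $c\in[0,\frac12)$ and that the weighted composition operator $W_{\psi,\varphi}$ is bounded on $\mathcal F^2$. Then $W_{\psi,\varphi}$ is complex symmetric if and only if either $$c=0,$$ or $$0<c<\tfrac12\quad\text{and}\quad \frac{(\operatorname{Re}b)^2}{1-2c}=\frac{(\operatorname{Im}b)^2}{1+2c}.$$ In either case, $W_{\psi,\varphi}$ is complex symmetric with respect to the conjugation $J$ on $\mathcal F^2$ defined by $$(Jf)(z)=\frac{q(z)}{\pi\|q\|}\int_{\mathbb C}q(w)e^{\rho zw}\,\overline{f(w)}\,e^{-|w|^2}\,dA(w),\qquad f\in\mathcal F^2,$$ where $q(z)=\exp(cz^2+bz)$ and, with $D=1-4c^2$ and $L=\frac{\overline b+2cb}{D}$, $$\rho=\begin{cases}-\dfrac{b}{L}, & b\neq0,\\ 1, & b=0,\ c=0,\\ i\sqrt D, & b=0,\ c>0.\end{cases}$$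
   Context: $\mathcal F^2$ is the Fock space of all entire functions $f$ on $\mathbb C$ with $\|f\|^2=\frac1\pi\int_{\mathbb C}|f(z)|^2e^{-|z|^2}\,dA(z)<\infty$ ($dA$ = area measure), with inner product $\langle f,g\rangle=\frac1\pi\int_{\mathbb C}f(z)\overline{g(z)}e^{-|z|^2}\,dA(z)$. For entire $\psi,\varphi$, $W_{\psi,\varphi}f=\psi\cdot(f\circ\varphi)$. A conjugation on a complex Hilbert space $\mathbb H$ is an anti-linear map $C$ with $C^2=I$ and $\langle Cx,Cy\rangle=\langle y,x\rangle$ for all $x,y\in\mathbb H$. A bounded linear operator $T$ is complex symmetric with respect to $C$ if $T=CT^*C$, and complex symmetric if such a conjugation $C$ exists. *)

(* Defs.v *)
From HB Require Import structures.
From mathcomp Require Import all_boot all_order all_algebra.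
From mathcomp Require Import all_classical all_reals all_analysis.
From mathcomp Require Import measurable_realfun complex lra.

Set Implicit Arguments.
Unset Strict Implicit.
Unset Printing Implicit Defensive.

Import Order.TTheory GRing.Theory Num.Theory numFieldNormedType.Exports.
Import ComplexField.Normc.

Local Open Scope classical_set_scope.
Local Open Scope ring_scope.
Local Open Scope complex_scope.

Section ComplexAnalysis.
Variable R : realType.
Implicit Types (z : R[i]) (f : R[i] -> R[i]).

Definition cexp z : R[i] :=
  (expR (complex.Re z))%:C * (cos (complex.Im z) +i* sin (complex.Im z)).

(* [derivable] is taken over the base field [R[i]]: this is complex
   differentiability at every point *)
Definition entire f := forall z, derivable (f : R[i]^o -> R[i]^o) z 1.

Definition area := (@lebesgue_measure R \x @lebesgue_measure R)%E.

Definition cintegral f : R[i] :=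
  (\int[area]_p complex.Re (f (p.1 +i* p.2))) +i*
  (\int[area]_p complex.Im (f (p.1 +i* p.2))).

(* extended-real-valued, so that finiteness can be required in [in_fock] *)
Definition fock_sqnorm f : \bar R :=
  ((pi^-1)%:E * \int[area]_p
     (normc (f (p.1 +i* p.2)) ^+ 2 * expR (- normc (p.1 +i* p.2) ^+ 2))%:E)%E.

Definition fock_norm f : R := Num.sqrt (fine (fock_sqnorm f)).

Definition in_fock f := entire f /\ (fock_sqnorm f < +oo)%E.

Definition fock_pred : {pred (R[i] -> R[i])} := [pred f | `[< in_fock f >]].

End ComplexAnalysis.

Section FockClosed.
Variable R : realType.
Implicit Types (z : R[i]) (f g : R[i] -> R[i]).

Lemma normcE z : `|z| = (normc z)%:C. Proof. by []. Qed.

Lemma normc_ge0 z : 0 <= normc z.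
Proof. by rewrite -ler0c -normcE. Qed.

Lemma ler_normcD z1 z2 : normc (z1 + z2) <= normc z1 + normc z2.
Proof. by rewrite -lecR rmorphD -!normcE ler_normD. Qed.

Lemma normc_le_ReIm (x y : R) : normc (x +i* y) <= `|x| + `|y|.
Proof.
have -> : x +i* y = x%:C + y *i by simpc.
apply: (le_trans (ler_normcD _ _)).
by rewrite /= expr0n addr0 add0r !sqrtr_sqr.
Qed.

Lemma measurable_open_complex (U : set R[i]^o) : open U ->
  measurable [set p : measurableTypeR R * measurableTypeR R | U (p.1 +i* p.2)].
Proof.
move=> oU.
pose box (n : nat) (q1 q2 : rat) : set (measurableTypeR R * measurableTypeR R) :=
  ball (ratr q1 : R) n.+1%:R^-1 `*` ball (ratr q2 : R) n.+1%:R^-1.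
pose E := [set p : measurableTypeR R * measurableTypeR R | U (p.1 +i* p.2)].
rewrite -/E; have -> : E = \bigcup_n \bigcup_q1 \bigcup_q2
    (if `[< box n q1 q2 `<=` E >] then box n q1 q2 else set0).
  apply/seteqP; split=> p; last first.
    by move=> [n _ [q1 _ [q2 _]]]; case: ifPn => // /asboolP h /h.
  move=> /= Up; have := open_nbhs_nbhs (conj oU Up).
  move=> /nbhs_ballP[/= e e0 be].
  have {}e0 : 0 < complex.Re e /\ e = (complex.Re e)%:C.
    by move: e0 {be}; case: e => e1 e2; rewrite ltcE /= => /andP[/eqP -> ->].
  case: e0 => e0 eE.
  pose d := complex.Re e / 4.
  have d0 : 0 < d by rewrite divr_gt0.
  have [n nd] : exists n, n.+1%:R^-1 < d.
    exists (Num.truncn d^-1); rewrite invf_plt ?posrE//.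
    by rewrite truncnS_gt.
  have rd (x : R) : exists q : rat, `|ratr q - x| < n.+1%:R^-1.
    have [|q +] := @rat_in_itvoo R (x - n.+1%:R^-1) (x + n.+1%:R^-1).
      by rewrite ltrD2l gtrN.
    by rewrite in_itv/= -ltr_distl => ?; exists q.
  have [q1 h1] := rd p.1; have [q2 h2] := rd p.2.
  exists n => //; exists q1 => //; exists q2 => //.
  have pb : box n q1 q2 p by split; rewrite /ball/=.
  case: asboolP => // -[] p' [p1 p2]; apply: be.
  rewrite -ball_normE /= eE normcE ltcR.
  have -> : p.1 +i* p.2 - (p'.1 +i* p'.2) = (p.1 - p'.1) +i* (p.2 - p'.2).
    by simpc.
  apply: le_lt_trans (normc_le_ReIm _ _) _.
  rewrite -ball_normE /= in p1; rewrite -ball_normE /= in p2.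
  have k (x q x' : R) : `|q - x| < n.+1%:R^-1 -> `|q - x'| < n.+1%:R^-1 ->
     `|x - x'| < d + d.
    move=> a1 a2; rewrite -(subrKA q) (le_lt_trans (ler_normD _ _))//.
    by rewrite ltrD//; [rewrite distrC|]; exact: lt_trans nd.
  have -> : complex.Re e = (d + d) + (d + d).
    by rewrite -!mulr2n -mulrnA -mulr_natr /d divfK.
  by apply: ltrD; [exact: k h1 p1|exact: k h2 p2].
apply: bigcupT_measurable => n.
apply: bigcupT_measurable_rat => q1; apply: bigcupT_measurable_rat => q2.
case: ifPn => // _; apply: measurableX; by rewrite ball_itv; exact: measurable_itv.
Qed.

Lemma measurable_normc f : entire f ->
  measurable_fun setT (fun p : measurableTypeR R * measurableTypeR R =>
    normc (f (p.1 +i* p.2))).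
Proof.
move=> ef.
have cf : continuous (f : R[i]^o -> R[i]^o).
  move=> z; apply: differentiable_continuous.
  by apply/derivable1_diffP; exact: ef.
apply: (@measurability _ _ _ _ _ _ _ (RGenOInfty.measurableE R)) => _ [_ [t ->]] <-.
rewrite setTI.
have -> : (fun p : R * R => normc (f (p.1 +i* p.2))) @^-1` `]t, +oo[ =
   [set p : R * R | (f @^-1` [set w : R[i]^o | t < normc w]) (p.1 +i* p.2)].
  by apply/seteqP; split => p /=; rewrite in_itv/= andbT.
apply: measurable_open_complex.
apply: (@open_comp R[i]^o R[i]^o f) => [z _|]; first exact: cf.
rewrite openE => w /= tw; apply/nbhs_ballP.
exists (normc w - t)%:C => /=; first by rewrite ltcR subr_gt0.
move=> w'; rewrite -ball_normE /= normcE ltcR.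
by have := ler_normcD (w - w') w'; rewrite subrK; lra.
Qed.

Lemma measurable_fock f : entire f ->
  measurable_fun setT (fun p : measurableTypeR R * measurableTypeR R =>
    (normc (f (p.1 +i* p.2)) ^+ 2 * expR (- normc (p.1 +i* p.2) ^+ 2))%:E).
Proof.
move=> ef; apply/measurable_EFinP; apply: measurable_funM.
  by apply: measurable_funX; exact: measurable_normc.
apply: measurableT_comp => //; apply: measurableT_comp => //.
apply: measurable_funX; apply: (@measurable_normc id) => z; exact: derivable_id.
Qed.

Lemma in_fock0 : in_fock (0 : R[i] -> R[i]).
Proof.
split=> [z|]; first exact: derivable_cst.
rewrite /fock_sqnorm (eq_integral (cst 0%E)) ?integral_cst_set0.
  by rewrite integral0 mule0.
by move=> p _ /=; rewrite expr0n /= addr0 sqrtr0 expr0n mul0r.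
Qed.

Lemma in_fock_lin (a : R[i]) f g :
  in_fock f -> in_fock g -> in_fock (a *: f + g).
Proof.
move=> [ef f2] [eg g2].
have efg : entire (a *: f + g).
  move=> z; apply: (@derivableD _ R[i]^o R[i]^o) => //.
  by apply: (@derivableZ _ R[i]^o R[i]^o).
split=> //.
have pi0 : (0 <= (pi^-1 : R)%:E)%E by rewrite lee_fin invr_ge0 pi_ge0.
have fin h : (fock_sqnorm h < +oo)%E <-> (\int[@area R]_p
     (normc (h (p.1 +i* p.2)) ^+ 2 * expR (- normc (p.1 +i* p.2) ^+ 2))%:E < +oo)%E.
  rewrite /fock_sqnorm; split=> h2.
    rewrite ltey; apply: contraPN h2 => /eqP ->.
    by rewrite gt0_muley ?ltxx// lte_fin invr_gt0 pi_gt0.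
  by rewrite lte_mul_pinfty.
move/fin: f2 => f2; move/fin: g2 => g2; apply/fin.
pose k (h : R[i] -> R[i]) (p : measurableTypeR R * measurableTypeR R) :=
  (normc (h (p.1 +i* p.2)) ^+ 2 * expR (- normc (p.1 +i* p.2) ^+ 2))%:E.
have k0 h p : setT p -> (0 <= k h p)%E.
  by move=> _; rewrite lee_fin mulr_ge0 ?sqr_ge0 ?expR_ge0.
have mk h : entire h -> measurable_fun setT (k h) by exact: measurable_fock.
have c0 : (0 : R) <= 2 * normc a ^+ 2 by rewrite mulr_ge0 ?sqr_ge0.
apply: (@le_lt_trans _ _ (\int[@area R]_p
   ((2 * normc a ^+ 2)%:E * k f p + 2%:E * k g p))%E).
  apply: ge0_le_integral => //.
  - exact: k0.
  - exact: mk.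
  - by apply: emeasurable_funD; apply: measurable_funeM; exact: mk.
  - move=> p _; rewrite /k -!EFinM -EFinD lee_fin !mulrA -mulrDl.
    apply: ler_wpM2r; first exact: expR_ge0.
    set x := f _; set y := g _; have -> : (a *: f + g) (p.1 +i* p.2) = a * x + y.
      by [].
    apply: (@le_trans _ _ ((normc (a * x) + normc y) ^+ 2)).
      by rewrite ler_pXn2r ?nnegrE ?addr_ge0 ?normc_ge0 ?ler_normcD.
    rewrite normcM; move: (normc a) (normc x) (normc y) => A X Y.
    have : 0 <= (A * X - Y) ^+ 2 by exact: sqr_ge0.
    by nra.
rewrite ge0_integralD//=.
- rewrite !ge0_integralZl//=; try (exact: mk); try (by move=> *; exact: k0).
  by rewrite lte_add_pinfty// lte_mul_pinfty.
- by move=> p _; apply: mule_ge0; rewrite ?lee_fin//; exact: k0.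
- by apply: measurable_funeM; exact: mk.
- by move=> p _; apply: mule_ge0; rewrite ?lee_fin//; exact: k0.
- by apply: measurable_funeM; exact: mk.
Qed.

Lemma fock_submod_closed : submod_closed (@fock_pred R).
Proof.
split; first by apply/asboolP; exact: in_fock0.
by move=> a f g /asboolP ff /asboolP fg; apply/asboolP; exact: in_fock_lin.
Qed.

HB.instance Definition _ :=
  GRing.isSubmodClosed.Build R[i] (R[i] -> R[i]) (@fock_pred R)
    fock_submod_closed.

End FockClosed.

Record fock (R : realType) := Fock {
  fock_fun :> R[i] -> R[i];
  fock_funP : fock_fun \in @fock_pred R }.

HB.instance Definition _ (R : realType) := [isSub for @fock_fun R].
HB.instance Definition _ (R : realType) := [Choice of fock R by <:].
HB.instance Definition _ (R : realType) := [SubChoice_isSubLmodule of fock R by <:].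

(* Operators on a complex vector space [V] with inner product [ip], linear in
   the first argument. *)
Section ComplexSymmetry.
Variables (R : realType) (V : lmodType R[i]) (ip : V -> V -> R[i]).
Implicit Types (C S T : V -> V).

Definition antilinear C :=
  forall (k : R[i]) x y, C (k *: x + y) = k^* *: C x + C y.

Definition conjugation C :=
  [/\ antilinear C, forall x, C (C x) = x &
      forall x y, ip (C x) (C y) = ip y x].

Definition adjoint T S := forall x y, ip (T x) y = ip x (S y).

(* C is a conjugation and T = C T^* C, where S plays the role of T^*; the
   adjoint of a bounded operator on a Hilbert space exists and is unique *)
Definition complex_symmetric_wrt C T :=
  conjugation C /\ exists2 S, adjoint T S & forall x, T x = C (S (C x)).

Definition complex_symmetric T := exists C, complex_symmetric_wrt C T.

End ComplexSymmetry.

Section WeightedComposition.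
Variable R : realType.

Definition fock_ip (f g : fock R) : R[i] :=
  (pi^-1)%:C * cintegral (fun z => f z * (g z)^* * cexp (- `|z| ^+ 2)).

Definition fock_bounded (T : fock R -> fock R) :=
  exists M : R, forall f, fock_norm (T f) <= M * fock_norm f.

(* the codomain of W records that psi * (f \o phi) lies in F^2 for every f in F^2 *)
Definition weighted_composition (psi phi : R[i] -> R[i])
    (W : fock R -> fock R) :=
  forall f z, W f z = psi z * f (phi z).

End WeightedComposition.

(* Main.v *)
From HB Require Import structures.
Require Import Defs.
From mathcomp Require Import all_boot all_order all_algebra.
From mathcomp Require Import all_classical all_reals all_analysis.
From mathcomp Require Import complex measurable_realfun ring lra.

(* Put q(z) = exp(cz^2 + bz). Since q(z) = psi(z) q(az), W maps q g to
   q (g o phi), so its eigenfunctions for the eigenvalues 1 and a are the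
   multiples of q and of zq.

   Necessity: the adjoint of W fixes 1 and multiplies z - b^* by a^*, so a
   conjugation C making W symmetric maps these two functions to multiples of q
   and zq. Comparing norms and inner products, with the moments of q read off
   the Gaussian integral <q_s, q_t> for q_s(z) = exp(cz^2 + sz), leaves
   c (b^2 + b^*^2 + 4 c |b|^2) = 0, which is the stated condition.

   Sufficiency: under this condition |rho|^2 = D, rho L = - b and
   c rho^2 = - c D. The Gaussian integral then shows that the functions
   kappa_z(w) = q(z) q(w) exp(rho z w) / |q| satisfy J kappa_z = K_z, the
   reproducing kernel; as kappa_z(w) is symmetric in z and w, J is an involution
   and <Jf, g> = <Jg, f>. The kernel of W J is again symmetric in z and w, so
   <WJf, g> = <WJg, f>, which makes J W J the adjoint of W. Schur's test gives
   the boundedness of both integral operators. *)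

(** [entire] is bare complex differentiability at every point, and its consequences pass through one
    fact, the reproducing property of the kernels. This property comes from the mean value property
    at the origin, hence from Goursat's theorem: the exponential map carries vertical segments to
    circles, and averaging over all rotations replaces polar coordinates. The choice
    [v = b (1 - a)], [u = c (1 - a^2)] makes [q] a fixed vector of [W]. Hence [psi z] times the
    kernel of [J] at [(a z, w)] is a kernel of the same form with [rho * a] in place of [rho], and
    its symmetry is visible. The Gaussian integrals are computed only up to the factor [<q_0, q_0>],
    which cancels against the normalisation by [|q|]; moments follow by differentiating in the
    parameter [s] and comparing derivatives. Schur's test for the kernel of [J] works because the
    relations on [rho] remove the base point from the integral of a row; the rows of [W J] are then
    controlled by testing the boundedness of [W] on kernels. The inequality
    [x y <= t/2 x^2 + y^2/(2 t)] with a suitable [t] takes the place of Cauchy-Schwarz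
    throughout. *)

Section Fock.
Set Implicit Arguments.
Unset Strict Implicit.
Unset Printing Implicit Defensive.

Import Order.TTheory GRing.Theory Num.Theory numFieldNormedType.Exports.
Import ComplexField.Normc.
Local Open Scope classical_set_scope.
Local Open Scope ring_scope.
Local Open Scope complex_scope.
Local Notation Re := complex.Re.
Local Notation Im := complex.Im.
Local Notation "x ^*" := (conjc x) : ring_scope.

(** * Complex-valued integrals *)

Section ComplexIntegral.
Context {R : realType}.
Implicit Types z w : R[i].

Lemma normc_sqr z : normc z ^+ 2 = Re z ^+ 2 + Im z ^+ 2.
Proof. by case: z => x y; rewrite /= sqr_sqrtr// addr_ge0 ?sqr_ge0. Qed.

Lemma ler_normc_Re z : `|Re z| <= normc z.
Proof.
rewrite -(@ler_pXn2r _ 2) ?nnegrE ?normc_ge0// normc_sqr real_normK ?num_real//.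
by rewrite lerDl sqr_ge0.
Qed.

Lemma ler_normc_Im z : `|Im z| <= normc z.
Proof.
rewrite -(@ler_pXn2r _ 2) ?nnegrE ?normc_ge0// normc_sqr real_normK ?num_real//.
by rewrite lerDr sqr_ge0.
Qed.

Lemma normc_conj z : normc z^* = normc z.
Proof. by case: z => x y /=; rewrite sqrrN. Qed.

Lemma normcR (x : R) : normc x%:C = `|x|.
Proof. by rewrite /= expr0n addr0 sqrtr_sqr. Qed.

Lemma normcN z : normc (- z) = normc z.
Proof. by case: z => x y /=; rewrite !sqrrN. Qed.

Lemma normc_dist z w : normc (z - w) = normc (w - z).
Proof. by rewrite -opprB normcN. Qed.

Lemma cReD z w : Re (z + w) = Re z + Re w. Proof. by case: z; case: w. Qed.
Lemma cImD z w : Im (z + w) = Im z + Im w. Proof. by case: z; case: w. Qed.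
Lemma cReN z : Re (- z) = - Re z. Proof. by case: z. Qed.
Lemma cImN z : Im (- z) = - Im z. Proof. by case: z. Qed.
Lemma cReM z w : Re (z * w) = Re z * Re w - Im z * Im w.
Proof. by case: z; case: w. Qed.
Lemma cImM z w : Im (z * w) = Re z * Im w + Im z * Re w.
Proof. by case: z; case: w. Qed.
Lemma cReJ z : Re z^* = Re z. Proof. by case: z. Qed.
Lemma cImJ z : Im z^* = - Im z. Proof. by case: z. Qed.

Lemma cJD z w : (z + w)^* = z^* + w^*. Proof. exact: rmorphD. Qed.
Lemma cJN z : (- z)^* = - z^*. Proof. exact: rmorphN. Qed.
Lemma cJM z w : (z * w)^* = z^* * w^*. Proof. exact: rmorphM. Qed.
Lemma cJX z n : (z ^+ n)^* = z^* ^+ n. Proof. exact: rmorphXn. Qed.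
Lemma cJV z : (z^-1)^* = z^* ^-1. Proof. exact: fmorphV. Qed.
Lemma cJnat n : (n%:R : R[i])^* = n%:R. Proof. exact: rmorph_nat. Qed.
Lemma cJ0 : (0 : R[i])^* = 0. Proof. exact: rmorph0. Qed.
Lemma cJ1 : (1 : R[i])^* = 1. Proof. exact: rmorph1. Qed.
Lemma cJK z : z^*^* = z. Proof. exact: conjcK. Qed.
Lemma cJR (x : R) : (x%:C)^* = x%:C. Proof. exact: conjc_real. Qed.

Definition cJE := (cJX, cJV, cJnat, cJ0, cJ1, cJK, cJR, cJN, cJM, cJD).

Lemma mulcJ z : z * z^* = (normc z ^+ 2)%:C.
Proof.
by rewrite normc_sqr; apply/eqP; rewrite eq_complex cReM cImM cReJ cImJ/=;
  apply/andP; split; apply/eqP; ring.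
Qed.

Section Generic.
Context d (T : measurableType d).
Implicit Types (F G : T -> R[i]) (h k : T -> R).

Definition cmeas F :=
  measurable_fun setT (fun x => Re (F x)) /\
  measurable_fun setT (fun x => Im (F x)).

Lemma cmeas_cst z : cmeas (fun=> z). Proof. by split. Qed.

Lemma cmeasD F G : cmeas F -> cmeas G -> cmeas (fun x => F x + G x).
Proof.
move=> [F1 F2] [G1 G2]; split.
  by under eq_fun do rewrite cReD; exact: measurable_funD.
by under eq_fun do rewrite cImD; exact: measurable_funD.
Qed.

Lemma cmeasM F G : cmeas F -> cmeas G -> cmeas (fun x => F x * G x).
Proof.
move=> [F1 F2] [G1 G2]; split.
  by under eq_fun do rewrite cReM; apply: measurable_funB; exact: measurable_funM.
by under eq_fun do rewrite cImM; apply: measurable_funD; exact: measurable_funM.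
Qed.

Lemma cmeasX F n : cmeas F -> cmeas (fun x => F x ^+ n).
Proof.
move=> mF; elim: n => [|n ih]; first exact: cmeas_cst.
by under eq_fun do rewrite exprS; exact: cmeasM.
Qed.

Lemma cmeasJ F : cmeas F -> cmeas (fun x => (F x)^*).
Proof.
move=> [F1 F2]; split; first by under eq_fun do rewrite cReJ.
by under eq_fun do rewrite cImJ; exact: measurableT_comp.
Qed.

Lemma cmeasR h : measurable_fun setT h -> cmeas (fun x => (h x)%:C).
Proof. by move=> mh; split. Qed.

Lemma cmeas_cexp F : cmeas F -> cmeas (fun x => cexp (F x)).
Proof.
move=> [F1 F2]; apply: cmeasM.
  by apply: cmeasR; exact: measurableT_comp.
split=> /=.
  by apply: measurableT_comp => //; apply: continuous_measurable_fun; exact: continuous_cos.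
by apply: measurableT_comp => //; apply: continuous_measurable_fun; exact: continuous_sin.
Qed.

Lemma measurable_cmeas_normc F : cmeas F -> measurable_fun setT (fun x => normc (F x)).
Proof.
move=> [F1 F2].
have -> : (fun x => normc (F x)) = (fun x => Num.sqrt (Re (F x) ^+ 2 + Im (F x) ^+ 2)).
  by apply/funext => x; case: (F x).
apply: measurableT_comp => //.
  exact: (continuous_measurable_fun (@sqrt_continuous R)).
by apply: measurable_funD; apply: measurable_funX.
Qed.

Variable nu : {measure set T -> \bar R}.

Lemma integral_ltyW h k : measurable_fun setT h -> measurable_fun setT k ->
  (forall x, 0 <= h x <= k x) ->
  (\int[nu]_x (k x)%:E < +oo)%E -> (\int[nu]_x (h x)%:E < +oo)%E.
Proof.
move=> mh mk hk ky; apply: (le_lt_trans _ ky); apply: ge0_le_integral => //.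
- by move=> x _; rewrite lee_fin; case/andP: (hk x).
- exact/measurable_EFinP.
- exact/measurable_EFinP.
- by move=> x _; rewrite lee_fin; case/andP: (hk x).
Qed.

Lemma integral_ltyD h k : measurable_fun setT h -> measurable_fun setT k ->
  (forall x, 0 <= h x) -> (forall x, 0 <= k x) ->
  (\int[nu]_x (h x)%:E < +oo)%E -> (\int[nu]_x (k x)%:E < +oo)%E ->
  (\int[nu]_x (h x + k x)%:E < +oo)%E.
Proof.
move=> mh mk h0 k0 hy ky; under eq_integral do rewrite EFinD.
rewrite ge0_integralD//.
- exact: lte_add_pinfty.
- by move=> x _; rewrite lee_fin.
- exact/measurable_EFinP.
- by move=> x _; rewrite lee_fin.
- exact/measurable_EFinP.
Qed.

Lemma integral_ltyZ r h : measurable_fun setT h -> (forall x, 0 <= h x) ->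
  0 <= r -> (\int[nu]_x (h x)%:E < +oo)%E -> (\int[nu]_x (r * h x)%:E < +oo)%E.
Proof.
move=> mh h0 r0 hy; under eq_integral do rewrite EFinM.
rewrite ge0_integralZl//.
- exact: lte_mul_pinfty.
- exact/measurable_EFinP.
- by move=> x _; rewrite lee_fin.
Qed.

Definition cintegrable F :=
  cmeas F /\ (\int[nu]_x (normc (F x))%:E < +oo)%E.

Lemma integrable_lty_ge0 h : measurable_fun setT h -> (forall x, 0 <= h x) ->
  (\int[nu]_x (h x)%:E < +oo)%E -> nu.-integrable setT (EFin \o h).
Proof.
move=> mh h0 hy; apply/integrableP; split; first exact/measurable_EFinP.
by under eq_integral do rewrite /= ger0_norm//.
Qed.

Lemma cintegrable_norm F : cintegrable F ->
  nu.-integrable setT (EFin \o (fun x => normc (F x))).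
Proof.
move=> [mF Fy]; apply: integrable_lty_ge0 => //; first exact: measurable_cmeas_normc.
by move=> x; exact: normc_ge0.
Qed.

Lemma cintegrable_Re F : cintegrable F -> nu.-integrable setT (EFin \o (fun x => Re (F x))).
Proof.
move=> iF; apply: le_integrable (cintegrable_norm iF) => //.
  by apply/measurable_EFinP; case: iF => -[].
by move=> x _ /=; rewrite lee_fin (ger0_norm (normc_ge0 _)) ler_normc_Re.
Qed.

Lemma cintegrable_Im F : cintegrable F -> nu.-integrable setT (EFin \o (fun x => Im (F x))).
Proof.
move=> iF; apply: le_integrable (cintegrable_norm iF) => //.
  by apply/measurable_EFinP; case: iF => -[].
by move=> x _ /=; rewrite lee_fin (ger0_norm (normc_ge0 _)) ler_normc_Im.
Qed.

Lemma cintegrable_le F h : cmeas F -> measurable_fun setT h ->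
  (forall x, normc (F x) <= h x) -> (\int[nu]_x (h x)%:E < +oo)%E ->
  cintegrable F.
Proof.
move=> mF mh Fh hy; split=> //; apply: integral_ltyW hy => //.
  exact: measurable_cmeas_normc.
by move=> x; rewrite normc_ge0 Fh.
Qed.

Lemma cintegrableD F G : cintegrable F -> cintegrable G ->
  cintegrable (fun x => F x + G x).
Proof.
move=> [mF Fy] [mG Gy].
apply: (@cintegrable_le _ (fun x => normc (F x) + normc (G x))).
- exact: cmeasD.
- by apply: measurable_funD; exact: measurable_cmeas_normc.
- by move=> x; exact: ler_normcD.
- apply: integral_ltyD => //; try exact: measurable_cmeas_normc;
  by move=> x; exact: normc_ge0.
Qed.

Lemma cintegrableZ z F : cintegrable F -> cintegrable (fun x => z * F x).
Proof.
move=> [mF Fy]; split; first by apply: cmeasM => //; exact: cmeas_cst.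
under eq_integral do rewrite normcM.
apply: integral_ltyZ => //; [exact: measurable_cmeas_normc|
  by move=> x; exact: normc_ge0|exact: normc_ge0].
Qed.

(** Over [area] this is convertible with [cintegral], which is how the integrals of the statement
    are reached. *)
Definition cint F : R[i] := (\int[nu]_x Re (F x)) +i* (\int[nu]_x Im (F x)).

Lemma eq_cint F G : F =1 G -> cint F = cint G.
Proof. by move=> /funext ->. Qed.

Lemma cintD F G : cintegrable F -> cintegrable G ->
  cint (fun x => F x + G x) = cint F + cint G.
Proof.
move=> iF iG; apply/eqP; rewrite eq_complex /=; apply/andP; split; apply/eqP.
  under eq_Rintegral do rewrite cReD.
  by rewrite RintegralD//; exact: cintegrable_Re.
under eq_Rintegral do rewrite cImD.
by rewrite RintegralD//; exact: cintegrable_Im.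
Qed.

Lemma cintZ z F : cintegrable F -> cint (fun x => z * F x) = z * cint F.
Proof.
move=> iF; have iR := cintegrable_Re iF; have iI := cintegrable_Im iF.
have iZ r h : nu.-integrable setT (EFin \o h) ->
    nu.-integrable setT (EFin \o (fun x => r * h x)).
  move=> ih; have := integrableZl measurableT r ih; apply: eq_integrable => //.
apply/eqP; rewrite eq_complex; apply/andP; split; apply/eqP.
  rewrite cReM /=; under eq_Rintegral do rewrite cReM.
  by rewrite RintegralB// ?RintegralZl//; exact: iZ.
rewrite cImM /=; under eq_Rintegral do rewrite cImM.
by rewrite RintegralD// ?RintegralZl//; exact: iZ.
Qed.

Lemma cintJ F : cintegrable F -> cint (fun x => (F x)^*) = (cint F)^*.
Proof.
move=> iF; rewrite /cint; apply/eqP; rewrite eq_complex; apply/andP; split; apply/eqP => /=.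
  by under eq_Rintegral do rewrite cReJ.
under eq_Rintegral do rewrite cImJ -mulN1r.
by rewrite RintegralZl ?mulN1r//; exact: cintegrable_Im.
Qed.

Lemma cintB F G : cintegrable F -> cintegrable G ->
  cint (fun x => F x - G x) = cint F - cint G.
Proof.
move=> iF iG; rewrite -[RHS]/(cint F + - cint G) -mulN1r -cintZ// -cintD//.
  by apply: eq_cint => x; rewrite mulN1r.
exact: cintegrableZ.
Qed.

(** Real and imaginary parts are estimated separately, whence the factor 2; all later estimates
    absorb it. *)
Lemma normc_cint_le F h : cintegrable F -> (forall x, normc (F x) <= h x) ->
  nu.-integrable setT (EFin \o h) ->
  normc (cint F) <= 2 * \int[nu]_x h x.
Proof.
move=> iF Fh ih; apply: le_trans (normc_le_ReIm _ _) _.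
have H u : nu.-integrable setT (EFin \o u) -> (forall x, `|u x| <= h x) ->
    `|\int[nu]_x u x| <= \int[nu]_x h x.
  move=> iu uh; apply: le_trans (le_normr_Rintegral _ iu) _ => //.
  by apply: le_Rintegral => //; exact: integrable_norm.
rewrite mulr2n mulrDl mul1r; apply: lerD; apply: H.
- exact: cintegrable_Re.
- by move=> x; exact: le_trans (ler_normc_Re _) _.
- exact: cintegrable_Im.
- by move=> x; exact: le_trans (ler_normc_Im _) _.
Qed.

Lemma cintR h : cint (fun x => (h x)%:C) = (\int[nu]_x h x)%:C.
Proof. by rewrite /cint /= /Rintegral integral0. Qed.

End Generic.

Lemma cmeas_comp d1 d2 (T1 : measurableType d1) (T2 : measurableType d2)
  (u : T1 -> T2) (F : T2 -> R[i]) :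
  measurable_fun setT u -> cmeas F -> cmeas (fun x => F (u x)).
Proof.
by move=> mu [F1 F2]; split; [exact: (measurableT_comp F1 mu)|exact: (measurableT_comp F2 mu)].
Qed.

(** With every slice integrable, the inner real integrals, which are [fine] of extended ones, can be
    replaced by the latter at every point, without exceptional sets. *)
Lemma cint_Fubini d1 d2 (T1 : measurableType d1) (T2 : measurableType d2)
  (m1 : {sigma_finite_measure set T1 -> \bar R})
  (m2 : {sigma_finite_measure set T2 -> \bar R}) (F : T1 * T2 -> R[i]) :
  cmeas F -> (\int[m1]_x \int[m2]_y (normc (F (x, y)))%:E < +oo)%E ->
  (forall x, cintegrable m2 (fun y => F (x, y))) ->
  (forall y, cintegrable m1 (fun x => F (x, y))) ->
  cint m1 (fun x => cint m2 (fun y => F (x, y))) =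
  cint m2 (fun y => cint m1 (fun x => F (x, y))).
Proof.
move=> mF Fy i1 i2.
have iF : cintegrable (m1 \x m2)%E F.
  split=> //; rewrite fubini_tonelli1//.
    by apply/measurable_EFinP; exact: measurable_cmeas_normc.
  by move=> x; rewrite lee_fin normc_ge0.
have E (u : T1 * T2 -> R) : (m1 \x m2)%E.-integrable setT (EFin \o u) ->
    (forall x, m2.-integrable setT (EFin \o (fun y => u (x, y)))) ->
    (forall y, m1.-integrable setT (EFin \o (fun x => u (x, y)))) ->
    \int[m1]_x (\int[m2]_y u (x, y)) = \int[m2]_y (\int[m1]_x u (x, y)).
  move=> iu iu1 iu2; congr fine.
  transitivity (\int[m1]_x \int[m2]_y (u (x, y))%:E)%E.
    by apply: eq_integral => x _; rewrite fineK//; exact: (integrable_fin_num measurableT (iu1 x)).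
  transitivity (\int[m2]_y \int[m1]_x (u (x, y))%:E)%E; first exact: (Fubini iu).
  by apply: eq_integral => y _; rewrite fineK//; exact: (integrable_fin_num measurableT (iu2 y)).
rewrite /cint; apply/eqP; rewrite eq_complex; apply/andP; split; apply/eqP => /=.
  apply: (E (fun p => Re (F p))) => [|x|y]; first exact: (cintegrable_Re iF).
  - exact: (cintegrable_Re (i1 x)).
  - exact: (cintegrable_Re (i2 y)).
apply: (E (fun p => Im (F p))) => [|x|y]; first exact: (cintegrable_Im iF).
- exact: (cintegrable_Im (i1 x)).
- exact: (cintegrable_Im (i2 y)).
Qed.

End ComplexIntegral.

(** * Complex derivatives *)

Section ComplexDerivative.
Context {R : realType}.
Implicit Types (z w h d : R[i]) (f g : R[i] -> R[i]).

(** The derivative as a first-order expansion with real error bounds: no division by [h], no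
    exclusion of [h = 0], and estimates that chain directly. [cderivP] identifies it with
    [is_derive] over [R[i]]. *)
Definition cderiv f z d := forall e : R, 0 < e -> exists2 r : R, 0 < r &
  forall h, normc h < r -> normc (f (z + h) - f z - d * h) <= e * normc h.

Lemma gt0_complex (e : R[i]) : 0 < e -> 0 < Re e /\ e = (Re e)%:C.
Proof. by case: e => e1 e2; rewrite ltcE /= => /andP[/eqP -> ->]. Qed.

Lemma cderiv_cvg f z d : cderiv f z d <->
  (fun h : R[i]^o => h^-1 *: ((f : R[i]^o -> R[i]^o) (h *: (1 : R[i]^o) + z) - f z))
    @ (0 : R[i]^o)^' --> (d : R[i]^o).
Proof.
split.
  move=> fd; apply/cvgrPdist_le => e /gt0_complex[e0 ->].
  have [r r0 hr] := fd _ e0.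
  rewrite /dnbhs /within /=; apply/nbhs_ballP; exists r%:C => /=.
    by rewrite ltcR.
  move=> h; rewrite -ball_normE /= sub0r Defs.normcE ltcR normcN => hr' h0.
  rewrite Defs.normcE lecR.
  have nh0 : 0 < normc h.
    by rewrite lt_neqAle normc_ge0 andbT eq_sym; apply: contra_neq h0; exact: eq0_normc.
  rewrite -(ler_pM2r nh0) -normcM; apply: le_trans (hr h hr').
  rewrite normc_dist mulrBl; rewrite /GRing.scale/= mulr1 [h + z]addrC.
  by rewrite [h^-1 * _ * h]mulrC mulVKf.
move=> /cvgrPdist_le fd e e0.
have /fd : 0 < e%:C by rewrite ltcR.
rewrite /dnbhs /within /= => /nbhs_ballP[r /= /gt0_complex[r0 ->]] hr.
exists (Re r) => // h hr'.
have [->|h0] := eqVneq h 0.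
  by rewrite addr0 subrr mulr0 subr0 normc0 mulr0.
have := hr h; rewrite -ball_normE /= sub0r Defs.normcE ltcR normcN => /(_ hr' h0).
rewrite Defs.normcE lecR /GRing.scale/= mulr1 [h + z]addrC => H.
rewrite (_ : f (z + h) - f z - d * h = - ((d - h^-1 * (f (z + h) - f z)) * h)); last first.
  by rewrite mulrBl mulrAC mulVf// mul1r opprB.
by rewrite normcN normcM ler_wpM2r ?normc_ge0.
Qed.

Lemma cderivP f z d :
  cderiv f z d <-> is_derive (z : R[i]^o) 1 (f : R[i]^o -> R[i]^o) d.
Proof.
rewrite cderiv_cvg; split=> [H|[H1 H2]].
  by apply: DeriveDef; [apply/cvg_ex; exists d|exact: cvg_lim].
by move: H1; rewrite -H2.
Qed.

Lemma entireP f : entire f <-> forall z, exists d, cderiv f z d.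
Proof.
split=> [ef z|ef z].
  by exists ('D_1 (f : R[i]^o -> R[i]^o) z); apply/cderivP/derivableP; exact: ef.
by have [d /cderivP[]] := ef z.
Qed.

Lemma cderiv_unique f z d1 d2 : cderiv f z d1 -> cderiv f z d2 -> d1 = d2.
Proof. by move=> /cderivP[_ <-] /cderivP[_ <-]. Qed.

Lemma cderiv_ext f g z d : f =1 g -> cderiv f z d -> cderiv g z d.
Proof. by move=> /funext ->. Qed.

Lemma cderivD f g z d1 d2 : cderiv f z d1 -> cderiv g z d2 ->
  cderiv (fun x => f x + g x) z (d1 + d2).
Proof. by move=> /cderivP Hf /cderivP Hg; apply/cderivP; exact: is_deriveD. Qed.

Lemma cderiv_lip f z d : cderiv f z d -> exists2 r : R, 0 < r &
  forall h, normc h < r -> normc (f (z + h) - f z) <= (normc d + 1) * normc h.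
Proof.
move=> /(_ 1 ltr01)[r r0 H]; exists r => // h /H hr.
rewrite -(subrK (d * h) (f (z + h) - f z)) (le_trans (ler_normcD _ _))//.
by rewrite normcM mulrDl addrC lerD2l.
Qed.

Lemma cderivM f g z d1 d2 : cderiv f z d1 -> cderiv g z d2 ->
  cderiv (fun x => f x * g x) z (d1 * g z + f z * d2).
Proof.
move=> Hf Hg e e0; have [r1 r10 Lf] := cderiv_lip Hf.
have [r2 r20 Lg] := cderiv_lip Hg.
pose K1 := normc d1 + 1; have K10 : 0 < K1 by rewrite ltr_wpDl ?normc_ge0.
pose K2 := normc d2 + 1; have K20 : 0 < K2 by rewrite ltr_wpDl ?normc_ge0.
pose N1 := normc (f z) + 1; have N10 : 0 < N1 by rewrite ltr_wpDl ?normc_ge0.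
pose N2 := normc (g z) + 1; have N20 : 0 < N2 by rewrite ltr_wpDl ?normc_ge0.
have e30 : 0 < e / 3 by rewrite divr_gt0.
have [r3 r30 F] := Hf _ (divr_gt0 e30 N20).
have [r4 r40 G] := Hg _ (divr_gt0 e30 N10).
(* The error is split into three parts of size [e / 3 * normc h]. The last radius serves the product
   of the two increments, which is at most [K1 * K2 * normc h ^+ 2]. *)
exists (Num.min (Num.min r1 r2) (Num.min (Num.min r3 r4) (e / 3 / (K1 * K2)))).
  by rewrite !lt_min r10 r20 r30 r40 !divr_gt0// mulr_gt0.
move=> h; rewrite !lt_min => /andP[/andP[h1 h2] /andP[/andP[h3 h4] h5]].
have {}Lf := Lf h h1; have {}Lg := Lg h h2; have {}F := F h h3; have {}G := G h h4.
rewrite -/K1 in Lf; rewrite -/K2 in Lg.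
have A1 : normc ((f (z + h) - f z - d1 * h) * g z) <= e / 3 * normc h.
  rewrite normcM (_ : e / 3 * normc h = (e / 3 / N2 * normc h) * N2); last by field; rewrite gt_eqF.
  by apply: ler_pM => //; rewrite ?normc_ge0// lerDl.
have A2 : normc (f z * (g (z + h) - g z - d2 * h)) <= e / 3 * normc h.
  rewrite normcM (_ : e / 3 * normc h = N1 * (e / 3 / N1 * normc h)); last by field; rewrite gt_eqF.
  by apply: ler_pM => //; rewrite ?normc_ge0// lerDl.
have A3 : normc ((f (z + h) - f z) * (g (z + h) - g z)) <= e / 3 * normc h.
  rewrite normcM; apply: (@le_trans _ _ ((K1 * normc h) * (K2 * normc h))).
    by apply: ler_pM => //; exact: normc_ge0.
  rewrite mulrACA mulrA ler_wpM2r ?normc_ge0// mulrC -ler_pdivlMr ?mulr_gt0//.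
  exact: ltW.
rewrite (_ : _ - _ - _ = (f (z + h) - f z - d1 * h) * g z + f z * (g (z + h) - g z - d2 * h)
  + (f (z + h) - f z) * (g (z + h) - g z)); last by ring.
apply: le_trans (ler_normcD _ _) _.
have := ler_normcD ((f (z + h) - f z - d1 * h) * g z) (f z * (g (z + h) - g z - d2 * h)); lra.
Qed.

Lemma cderiv_cst w z : cderiv (fun=> w) z 0.
Proof. by move=> e e0; exists 1 => // h _; rewrite subrr mul0r subr0 normc0 mulr_ge0 ?normc_ge0 ?ltW. Qed.

Lemma cderiv_id z : cderiv id z 1.
Proof. by move=> e e0; exists 1 => // h _; rewrite /= mul1r (addrC z) addrK subrr normc0 mulr_ge0 ?normc_ge0 ?ltW. Qed.

Lemma cderivZ w f z d : cderiv f z d -> cderiv (fun x => w * f x) z (w * d).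
Proof.
by move=> H; have := cderivM (cderiv_cst w z) H; rewrite mul0r add0r.
Qed.

Lemma cderiv_comp f g z d1 d2 : cderiv f (g z) d1 -> cderiv g z d2 ->
  cderiv (fun x => f (g x)) z (d1 * d2).
Proof.
move=> Hf Hg e e0; have [r1 r10 L] := cderiv_lip Hg.
pose K := normc d2 + 1; have K0 : 0 < K by rewrite ltr_wpDl ?normc_ge0.
pose N := normc d1 + 1; have N0 : 0 < N by rewrite ltr_wpDl ?normc_ge0.
have [r2 r20 F] := Hf (e / 2 / K) (divr_gt0 (divr_gt0 e0 (@ltr0Sn R 1)) K0).
have [r3 r30 G] := Hg (e / 2 / N) (divr_gt0 (divr_gt0 e0 (@ltr0Sn R 1)) N0).
exists (Num.min (Num.min r1 (r2 / K)) r3); first by rewrite !lt_min r10 r30 divr_gt0.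
move=> h; rewrite !lt_min => /andP[/andP[h1 h2] h3].
have gh := L h h1; have {}G := G h h3.
have {}F := F (g (z + h) - g z); rewrite [g z + _]addrC subrK in F.
have {F}F : normc (f (g (z + h)) - f (g z) - d1 * (g (z + h) - g z)) <= e / 2 * normc h.
  apply: (le_trans (F _)).
    by apply: le_lt_trans gh _; rewrite -/K mulrC -ltr_pdivlMr.
  rewrite (_ : e / 2 * normc h = e / 2 / K * (K * normc h)); last by field; rewrite gt_eqF.
  by rewrite ler_wpM2l// !divr_ge0// ?ltW.
have {}G : normc (d1 * (g (z + h) - g z - d2 * h)) <= e / 2 * normc h.
  rewrite normcM (_ : e / 2 * normc h = N * (e / 2 / N * normc h)); last by field; rewrite gt_eqF.
  by apply: ler_pM => //; rewrite ?normc_ge0// lerDl.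
rewrite (_ : _ - _ - _ = (f (g (z + h)) - f (g z) - d1 * (g (z + h) - g z)) +
   d1 * (g (z + h) - g z - d2 * h)); last by ring.
by apply: le_trans (ler_normcD _ _) _; lra.
Qed.

(** The entry point for concrete functions: the exponential, quadratic exponents and parametric
    integrals all come with a quadratic remainder on the unit disc. *)
Lemma cderiv_quad f z d (C : R) : (forall h, normc h <= 1 ->
  normc (f (z + h) - f z - d * h) <= C * normc h ^+ 2) -> cderiv f z d.
Proof.
move=> H e e0; pose K := `|C| + 1; have K0 : 0 < K by rewrite ltr_wpDl.
exists (Num.min 1 (e / K)); first by rewrite lt_min ltr01 divr_gt0.
move=> h; rewrite lt_min => /andP[/ltW h1 h2]; apply: le_trans (H h h1) _.
rewrite expr2 mulrA ler_wpM2r ?normc_ge0//.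
apply: (@le_trans _ _ (K * normc h)).
  rewrite ler_wpM2r ?normc_ge0// /K; apply: le_trans (ler_norm C) _.
  by rewrite lerDl.
by rewrite mulrC -ler_pdivlMr// ltW.
Qed.

Lemma cderivX f z d n : cderiv f z d ->
  exists d', cderiv (fun x => f x ^+ n) z d'.
Proof.
move=> H; elim: n => [|n [d' H']]; first by exists 0; exact: cderiv_cst.
exists (d * f z ^+ n + f z * d').
by apply: (@cderiv_ext (fun x => f x * f x ^+ n)) => [x|]; [rewrite exprS|exact: cderivM].
Qed.

Lemma cexp0 : cexp 0 = 1 :> R[i].
Proof. by rewrite /cexp /= expR0 cos0 sin0 mul1r. Qed.

Lemma cexpD z w : cexp (z + w) = cexp z * cexp w.
Proof.
case: z => a b; case: w => x y; rewrite /cexp /= expRD cosD sinD.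
by apply/eqP; rewrite eq_complex !cReM !cImM /=; apply/andP; split; apply/eqP; ring.
Qed.

Lemma normc_cexp z : normc (cexp z) = expR (Re z).
Proof.
rewrite /cexp normcM normcR ger0_norm ?expR_ge0//=.
by rewrite cos2Dsin2 sqrtr1 mulr1.
Qed.

Lemma cexpJ z : (cexp z)^* = cexp z^*.
Proof.
case: z => a b; apply/eqP; rewrite eq_complex !cReJ !cImJ /cexp !cReM !cImM /= cosN sinN.
by apply/andP; split; apply/eqP; ring.
Qed.

Lemma cexpR (x : R) : cexp x%:C = (expR x)%:C.
Proof. by rewrite /cexp /= cos0 sin0 mulr1. Qed.

Lemma cexpNK z : cexp z * cexp (- z) = 1.
Proof. by rewrite -cexpD subrr cexp0. Qed.

Lemma cexp_wt w : cexp (- `|w| ^+ 2) = (expR (- normc w ^+ 2))%:C.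
Proof. by rewrite -cexpR Defs.normcE rmorphN rmorphXn. Qed.

(** The bound on the intermediate point, for either sign of [b], lets the estimates for sine and
    cosine below be bootstrapped from one another. *)
Lemma mvt0 (f df : R -> R) b : (forall x : R, is_derive x 1 f (df x)) ->
  exists2 c, `|c| <= `|b| & f b - f 0 = df c * b.
Proof.
move=> H.
have cf : continuous f by move=> x; apply: differentiable_continuous; apply/derivable1_diffP; case: (H x).
have [b0|/ltW b0] := leP 0 b.
  have [c] := @MVT_segment _ f df 0 b b0 (fun x _ => H x) (continuous_subspaceT cf).
  rewrite in_itv/= => /andP[c0 cb] ->; exists c; last by rewrite subr0.
  by rewrite !ger0_norm.
have [c] := @MVT_segment _ f df b 0 b0 (fun x _ => H x) (continuous_subspaceT cf).
rewrite in_itv/= => /andP[c0 cb] E; exists c; first by rewrite !ler0_norm// lerN2.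
by rewrite -opprB E sub0r mulrN opprK.
Qed.

Lemma sin_le_abs (b : R) : `|sin b| <= `|b|.
Proof.
have [c _] := @mvt0 sin cos b (fun x => is_derive_sin x).
rewrite sin0 subr0 => ->; rewrite normrM -[leRHS]mul1r ler_wpM2r//; exact: cos_max.
Qed.

Lemma cos_sub1_le (b : R) : `|cos b - 1| <= b ^+ 2.
Proof.
have [c cb] := @mvt0 cos _ b (fun x => is_derive_cos x).
rewrite cos0 => ->; rewrite normrM normrN -(real_normK (num_real b)) expr2 ler_wpM2r//.
by apply: le_trans (sin_le_abs _) _.
Qed.

Lemma cos_sub1_le_abs (b : R) : `|cos b - 1| <= `|b|.
Proof.
have [c cb] := @mvt0 cos _ b (fun x => is_derive_cos x).
rewrite cos0 => ->; rewrite normrM normrN -[leRHS]mul1r ler_wpM2r//; exact: sin_max.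
Qed.

Lemma sin_sub_le (b : R) : `|sin b - b| <= b ^+ 2.
Proof.
have [c cb] := @mvt0 sin cos b (fun x => is_derive_sin x).
rewrite sin0 subr0 => ->; rewrite -[X in _ - X]mul1r -mulrBl normrM.
rewrite -(real_normK (num_real b)) expr2 ler_wpM2r//.
by apply: le_trans (cos_sub1_le_abs _) _.
Qed.

Lemma expR_sub1_le (a : R) : `|expR a - 1| <= `|a| * expR `|a|.
Proof.
have h1 := expR_ge1Dx a; have h2 := expR_ge1Dx (- a).
have e0 := expR_gt0 a.
(* This is [1 - a <= expR (- a)] multiplied by [expR a]. *)
have h3 : expR a - 1 <= a * expR a.
  have : (1 + - a) * expR a <= expR (- a) * expR a by rewrite ler_wpM2r// ltW.
  by rewrite -expRD addNr expR0 mulrDl mul1r mulNr => H; lra.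
have [a0|a0] := leP 0 a.
  rewrite !ger0_norm//; lra.
have -> : `|expR a - 1| = 1 - expR a.
  by rewrite ler0_norm ?opprB// subr_le0 -expR0 ler_expR ltW.
rewrite ltr0_norm//; apply: (@le_trans _ _ (- a * 1)); first lra.
by rewrite ler_wpM2l ?oppr_ge0 ?ltW// -expR0 ltr_expR oppr_gt0.
Qed.

Lemma expR_sub1x_le (a : R) : `|expR a - 1 - a| <= a ^+ 2 * expR `|a|.
Proof.
have h1 := expR_ge1Dx a; have h2 := expR_ge1Dx (- a).
have e0 := expR_gt0 a.
have h3 : expR a - 1 <= a * expR a.
  have : (1 + - a) * expR a <= expR (- a) * expR a by rewrite ler_wpM2r// ltW.
  by rewrite -expRD addNr expR0 mulrDl mul1r mulNr => H; lra.
rewrite ger0_norm; last lra.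
apply: (@le_trans _ _ (a * (expR a - 1))); first lra.
apply: le_trans (ler_norm _) _; rewrite normrM -(real_normK (num_real a)) expr2 -mulrA ler_wpM2l//.
exact: expR_sub1_le.
Qed.

(** A bound for all [z], and not only near 0, because it is later integrated with [z] replaced by
    the unbounded function [h * m x]. *)
Lemma cexp_sub1x_le z : normc (cexp z - 1 - z) <= 4 * normc z ^+ 2 * expR (normc z).
Proof.
rewrite normc_sqr; set N := expR (normc z).
have NR : expR `|Re z| <= N by rewrite ler_expR ler_normc_Re.
have NN : expR (Re z) <= N by apply: le_trans NR; rewrite ler_expR ler_norm.
have N1 : 1 <= N by rewrite -expR0 ler_expR normc_ge0.
pose a := Re z; pose b := Im z; rewrite -/a -/b in NR NN *.
have -> : cexp z - 1 - z = (expR a * cos b - 1 - a) +i* (expR a * sin b - b).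
  rewrite /a /b; apply/eqP; rewrite eq_complex; case: (z) => x y.
  by rewrite /cexp /= !mul0r subr0 addr0; apply/andP; split; apply/eqP; ring.
apply: le_trans (normc_le_ReIm _ _) _.
have A1 := expR_sub1x_le a; have A2 := expR_sub1_le a.
have B1 := cos_sub1_le b; have B2 := sin_sub_le b.
have a2 : 0 <= a ^+ 2 by exact: sqr_ge0.
have b2 : 0 <= b ^+ 2 by exact: sqr_ge0.
have H1 : `|expR a * cos b - 1 - a| <= (a ^+ 2 + b ^+ 2) * N.
  have -> : expR a * cos b - 1 - a = (expR a - 1 - a) + expR a * (cos b - 1) by ring.
  apply: le_trans (ler_normD _ _) _; rewrite [leRHS]mulrDl; apply: lerD.
    by apply: le_trans A1 _; rewrite ler_wpM2l.
  rewrite normrM (ger0_norm (expR_ge0 _)) mulrC.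
  by apply: ler_pM => //; exact: expR_ge0.
have H2 : `|expR a * sin b - b| <= (`|a| * `|b| + b ^+ 2) * N.
  have -> : expR a * sin b - b = (expR a - 1) * sin b + (sin b - b) by ring.
  apply: le_trans (ler_normD _ _) _; rewrite [leRHS]mulrDl; apply: lerD.
    rewrite normrM mulrAC; apply: ler_pM => //; last exact: sin_le_abs.
    by apply: le_trans A2 _; rewrite ler_wpM2l.
  by apply: le_trans B2 _; rewrite ler_peMr.
have H3 : `|a| * `|b| <= a ^+ 2 + b ^+ 2.
  rewrite -(real_normK (num_real a)) -(real_normK (num_real b)).
  have := sqr_ge0 (`|a| - `|b|); have := sqr_ge0 (`|a| + `|b|); nra.
have : (`|a| * `|b| + b ^+ 2) * N <= (a ^+ 2 + b ^+ 2 + b ^+ 2) * N.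
  by rewrite ler_wpM2r//; lra.
have := mulr_ge0 a2 (le_trans ler01 N1); have := mulr_ge0 b2 (le_trans ler01 N1).
rewrite /= in H1 H2 *; lra.
Qed.

Lemma cderiv_cexp z : cderiv (@cexp R) z (cexp z).
Proof.
apply: (@cderiv_quad _ _ _ (normc (cexp z) * 4 * expR 1)) => h h1.
have -> : cexp (z + h) - cexp z - cexp z * h = cexp z * (cexp h - 1 - h).
  by rewrite cexpD; ring.
rewrite normcM -!mulrA ler_wpM2l ?normc_ge0//.
apply: le_trans (cexp_sub1x_le h) _.
rewrite -mulrA ler_wpM2l// mulrC ler_wpM2r ?sqr_ge0//.
by rewrite ler_expR.
Qed.

Lemma entire_cst w : entire (fun=> w).
Proof. by apply/entireP => z; exists 0; exact: cderiv_cst. Qed.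

Lemma entire_id : entire (@id R[i]).
Proof. by apply/entireP => z; exists 1; exact: cderiv_id. Qed.

Lemma entireD f g (ef : entire f) (eg : entire g) : entire (fun x => f x + g x).
Proof.
move: ef eg => /entireP ef /entireP eg; apply/entireP => z.
by have [d1 H1] := ef z; have [d2 H2] := eg z; eexists; exact: cderivD H1 H2.
Qed.

Lemma entireM f g (ef : entire f) (eg : entire g) : entire (fun x => f x * g x).
Proof.
move: ef eg => /entireP ef /entireP eg; apply/entireP => z.
by have [d1 H1] := ef z; have [d2 H2] := eg z; eexists; exact: cderivM H1 H2.
Qed.

Lemma entire_comp f g (ef : entire f) (eg : entire g) : entire (fun x => f (g x)).
Proof.
move: ef eg => /entireP ef /entireP eg; apply/entireP => z.
by have [d2 H2] := eg z; have [d1 H1] := ef (g z); eexists; exact: cderiv_comp H1 H2.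
Qed.

Lemma entireX f n (ef : entire f) : entire (fun x => f x ^+ n).
Proof. by move: ef => /entireP ef; apply/entireP => z; have [d /(cderivX n)] := ef z. Qed.

Lemma entire_cexp f (ef : entire f) : entire (fun x => cexp (f x)).
Proof.
have ec : entire (@cexp R).
  by apply/entireP => z; exists (cexp z); exact: cderiv_cexp.
exact: (@entire_comp (@cexp R) f ec ef).
Qed.

End ComplexDerivative.

(* [entire] unfolds to a product, whose variables would otherwise become
   implicit arguments. *)
Arguments entire_cst {R} w.
Arguments entire_id {R}.
Arguments entireD {R f g} ef eg.
Arguments entireM {R f g} ef eg.
Arguments entire_comp {R f g} ef eg.
Arguments entireX {R f} n ef.
Arguments entire_cexp {R f} ef.

(** * Invariance of the area measure *)

Section Param.
Context {R : realType} d (T : measurableType d) (nu : {measure set T -> \bar R}).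
Variables (m g : T -> R[i]).
Hypothesis mm : cmeas m.
Hypothesis mg : cmeas g.
Hypothesis mgy : forall A : R,
  (\int[nu]_x (expR (A * normc (m x)) * normc (g x))%:E < +oo)%E.

Let mE (A : R) : measurable_fun setT (fun x => expR (A * normc (m x)) * normc (g x)).
Proof.
apply: measurable_funM; last exact: measurable_cmeas_normc.
apply: measurableT_comp => //; apply: measurable_funM => //.
exact: measurable_cmeas_normc.
Qed.

Lemma cintegrable_param z : cintegrable nu (fun x => cexp (z * m x) * g x).
Proof.
apply: (cintegrable_le _ (mE (normc z))) => [|x|]; last exact: mgy.
  by apply: cmeasM => //; apply: cmeas_cexp; apply: cmeasM => //; exact: cmeas_cst.
rewrite normcM ler_wpM2r ?normc_ge0// normc_cexp ler_expR -normcM.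
by apply: le_trans (ler_normc_Re _); exact: ler_norm.
Qed.

Lemma cintegrable_param1 z : cintegrable nu (fun x => m x * cexp (z * m x) * g x).
Proof.
apply: (cintegrable_le _ (mE (normc z + 1))) => [|x|]; last exact: mgy.
  apply: cmeasM => //; apply: cmeasM => //; apply: cmeas_cexp; apply: cmeasM => //; exact: cmeas_cst.
rewrite normcM ler_wpM2r ?normc_ge0// normcM normc_cexp mulrDl mul1r expRD mulrC.
apply: ler_pM => //; rewrite ?expR_ge0 ?normc_ge0//.
  by rewrite ler_expR -normcM; apply: le_trans (ler_normc_Re _); exact: ler_norm.
by apply: le_trans (expR_ge1Dx _); rewrite lerDr.
Qed.

(** The explicit remainder of [cexp] replaces dominated convergence. In the majorant [h0], the extra
    2 in the exponent consists of one [normc (m x)] from that remainder and one that absorbs [normc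
    (m x) ^+ 2 <= 2 * expR (normc (m x))]. *)
Lemma cderiv_param z : cderiv (fun z => cint nu (fun x => cexp (z * m x) * g x)) z
  (cint nu (fun x => m x * cexp (z * m x) * g x)).
Proof.
pose h0 x := expR ((normc z + 2) * normc (m x)) * normc (g x).
(* 16 is the pointwise constant 8 of [L] times the factor 2 of [normc_cint_le]. *)
apply: (@cderiv_quad _ _ _ _ (16 * \int[nu]_x h0 x)) => h h1.
have I0 := cintegrable_param; have I1 := cintegrable_param1.
have iB a b : cintegrable nu a -> cintegrable nu b -> cintegrable nu (fun x => a x - b x).
  move=> ia ib; have := cintegrableD ia (cintegrableZ (-1) ib).
  by under eq_fun do rewrite mulN1r.
rewrite -cintB// [_ * h]mulrC -cintZ// -cintB//; [|exact: iB|exact: cintegrableZ].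
have L x : normc (cexp ((z + h) * m x) * g x - cexp (z * m x) * g x -
      h * (m x * cexp (z * m x) * g x)) <= 8 * normc h ^+ 2 * h0 x.
    have -> : cexp ((z + h) * m x) * g x - cexp (z * m x) * g x -
      h * (m x * cexp (z * m x) * g x) =
      cexp (z * m x) * (cexp (h * m x) - 1 - h * m x) * g x.
      by rewrite mulrDl cexpD; ring.
    rewrite /h0 2!normcM mulrA ler_wpM2r ?normc_ge0//.
    have A1 : normc (cexp (z * m x)) <= expR (normc z * normc (m x)).
      by rewrite normc_cexp ler_expR -normcM; apply: le_trans (ler_normc_Re _); exact: ler_norm.
    have A2 := cexp_sub1x_le (h * m x).
    have A3 : expR (normc (h * m x)) <= expR (normc (m x)).
      by rewrite ler_expR normcM ler_piMl ?normc_ge0.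
    have A4 : normc (m x) ^+ 2 <= 2 * expR (normc (m x)).
      by have := expR_ge1Dxn 1%N (normc_ge0 (m x)); rewrite /= (_ : 2`! = 2)%N //; lra.
    have -> : 8 * normc h ^+ 2 * expR ((normc z + 2) * normc (m x)) =
      expR (normc z * normc (m x)) *
      (4 * normc h ^+ 2 * (2 * expR (normc (m x))) * expR (normc (m x))).
      have -> : (normc z + 2) * normc (m x) =
        normc z * normc (m x) + (normc (m x) + normc (m x)) by ring.
      by rewrite !expRD; ring.
    apply: ler_pM; rewrite ?normc_ge0//.
    apply: le_trans A2 _; rewrite normcM exprMn.
    apply: ler_pM; rewrite ?expR_ge0// ?(normcM h) in A3 *.
    - by apply: mulr_ge0 => //; apply: mulr_ge0; exact: sqr_ge0.
    - by rewrite mulrA; apply: ler_wpM2l => //; apply: mulr_ge0 => //; exact: sqr_ge0.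
    - exact: A3.
  have ih0 : nu.-integrable setT (EFin \o h0).
    apply: integrable_lty_ge0 => //; first exact: mE.
      by move=> x; rewrite mulr_ge0 ?expR_ge0 ?normc_ge0.
    exact: mgy.
  apply: le_trans (normc_cint_le _ L _) _.
  + by apply: (iB); [exact: iB|exact: cintegrableZ].
  + by have := integrableZl measurableT (8 * normc h ^+ 2) ih0; apply: eq_integrable.
  + by rewrite RintegralZl//; lra.
Qed.

End Param.

(** * Translations, shears and rotations of the plane *)

Section AreaInvariance.
Context {R : realType}.
Local Notation T1 := (measurableTypeR R).
Local Notation T2 := (measurableTypeR R * measurableTypeR R)%type.
Local Notation mu := (@lebesgue_measure R).
Local Notation area := (@area R).
(** Allows [area] as a factor in Tonelli and Fubini: next to the angle in the mean value property,
    and next to a second copy of itself for integral operators. *)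
Lemma area_sigma_finite : sigma_finite setT (@Defs.area R).
Proof.
exists (fun k : nat => `](- k%:R)%R, k%:R]%classic `*` `](- k%:R)%R, k%:R]%classic).
  apply/seteqP; split => // -[x y] _; exists (Num.truncn (Num.max `|x| `|y|)).+1 => //.
  have H (u : R) : `|u| <= Num.max `|x| `|y| ->
      u \in `](- (Num.truncn (Num.max `|x| `|y|)).+1%:R), (Num.truncn (Num.max `|x| `|y|)).+1%:R]%R.
    move=> uM; have := le_lt_trans uM (truncnS_gt _).
    by rewrite in_itv/= ltr_norml => /andP[-> /ltW].
  by split; apply: H; rewrite le_max lexx ?orbT.
move=> k; split; first exact: measurableX.
have fin : (mu `](- k%:R)%R, k%:R]%classic < +oo)%E.
  by rewrite lebesgue_measure_itv/=; case: ifP; rewrite ltry.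
by rewrite /Defs.area product_measure1E//; apply: lte_mul_pinfty; rewrite ?ge0_fin_numE.
Qed.

HB.instance Definition _ := Measure.on (@Defs.area R).
HB.instance Definition _ := Measure_isSigmaFinite.Build _ _ _ (@Defs.area R) area_sigma_finite.

Local Open Scope ereal_scope.

(** The pushforward of Lebesgue measure under a translation gives each interval []a, b]] its length,
    so it is Lebesgue measure by uniqueness. *)
Lemma integral_shift (x0 : R) (f : T1 -> \bar R) : measurable_fun setT f ->
  (forall x, 0 <= f x) -> \int[mu]_x f (x + x0)%R = \int[mu]_x f x.
Proof.
move=> mf f0.
have ms : measurable_fun setT (fun x : T1 => (x + x0)%R : T1).
  by apply: measurable_funD.
transitivity (\int[pushforward mu (fun x : T1 => (x + x0)%R : T1)]_x f x).
  by rewrite ge0_integral_pushforward//.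
apply: eq_measure_integral => A mA _; apply/esym.
apply: lebesgue_measure_unique => // _ [[a b] _ <-] /=.
rewrite /pushforward.
have -> : (fun x : T1 => (x + x0)%R : T1) @^-1` `]a, b] = `](a - x0)%R, (b - x0)%R]%classic.
  by apply/seteqP; split => x /=; rewrite !in_itv/= ltrBlDr lerBrDr.
rewrite !lebesgue_measure_itv /= !lte_fin ltrD2r; case: ifP => // _.
by rewrite -!EFinB; congr EFin; rewrite opprB addrA subrK.
Qed.

(** Invariance is phrased by integrals instead of measures of sets: this form composes, and it is
    the change of variables that is applied later. *)
Definition area_preserving (phi : T2 -> T2) :=
  measurable_fun setT phi /\
  forall f : T2 -> \bar R, measurable_fun setT f -> (forall x, 0 <= f x) ->
    \int[area]_x f (phi x) = \int[area]_x f x.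

Lemma area_preserving_comp phi psi : area_preserving phi -> area_preserving psi ->
  area_preserving (fun x => phi (psi x)).
Proof.
move=> [m1 H1] [m2 H2]; split; first exact: measurableT_comp.
move=> f mf f0; rewrite -[RHS]H1// (H2 (fun x => f (phi x)))//.
exact: measurableT_comp.
Qed.

Lemma area_preserving_Rintegral phi (f : T2 -> R) : area_preserving phi ->
  measurable_fun setT f ->
  (\int[area]_x f (phi x) = \int[area]_x f x)%R.
Proof.
move=> [mphi H] mf; congr fine.
have mf' : measurable_fun setT (EFin \o f) by exact/measurable_EFinP.
rewrite integralE [RHS]integralE; congr (_ - _).
  rewrite -[RHS](H _ (measurable_funepos mf') (funepos_ge0 _)).
  by apply: eq_integral => x _; rewrite !funeposE.
rewrite -[RHS](H _ (measurable_funeneg mf') (funeneg_ge0 _)).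
by apply: eq_integral => x _; rewrite !funenegE.
Qed.

Lemma area_preserving_cint phi (F : T2 -> R[i]) : area_preserving phi -> cmeas F ->
  cint area (fun x => F (phi x)) = cint area F.
Proof.
move=> ap [m1 m2].
by rewrite /cint (area_preserving_Rintegral ap m1) (area_preserving_Rintegral ap m2).
Qed.

(** On each horizontal line a shear is a translation, so Tonelli reduces the claim to
    [integral_shift]. *)
Lemma area_preserving_shearx (t x0 : R) :
  area_preserving (fun p => (p.1 + (t * p.2 + x0), p.2)%R).
Proof.
have m : measurable_fun setT (fun p : T2 => (p.1 + (t * p.2 + x0), p.2)%R : T2).
  apply: measurable_fun_pair => //=.
  by apply: measurable_funD => //; apply: measurable_funD => //; apply: measurable_funM.
split=> // f mf f0.
rewrite fubini_tonelli2//; last exact: measurableT_comp.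
rewrite [RHS](fubini_tonelli2 f mf f0); congr (integral _ _ _); apply/funext => y.
rewrite /fubini_G /= (integral_shift _ (f := fun x => f (x, y)))//.
exact: measurableT_comp.
Qed.

Lemma area_preserving_sheary (t y0 : R) :
  area_preserving (fun p => (p.1, p.2 + (t * p.1 + y0))%R).
Proof.
have m : measurable_fun setT (fun p : T2 => (p.1, p.2 + (t * p.1 + y0))%R : T2).
  apply: measurable_fun_pair => //=.
  by apply: measurable_funD => //; apply: measurable_funD => //; apply: measurable_funM.
split=> // f mf f0.
rewrite fubini_tonelli1//; last exact: measurableT_comp.
rewrite [RHS](fubini_tonelli1 f mf f0); congr (integral _ _ _); apply/funext => x.
rewrite /fubini_F /= (integral_shift _ (f := fun y => f (x, y)))//.
exact: measurableT_comp.
Qed.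

Lemma area_preserving_ext phi psi : phi =1 psi -> area_preserving phi -> area_preserving psi.
Proof. by move=> /funext ->. Qed.

Lemma area_preserving_translate (x0 y0 : R) :
  area_preserving (fun p => (p.1 + x0, p.2 + y0)%R).
Proof.
have := area_preserving_comp (area_preserving_shearx 0 x0) (area_preserving_sheary 0 y0).
by apply: area_preserving_ext => p /=; rewrite !mul0r !add0r.
Qed.

(* A rotation is a product of three shears, unless its angle is [pi]; that one
   is the square of a quarter turn. *)
Lemma area_preserving_rotation (c s : R) : (c ^+ 2 + s ^+ 2 = 1)%R ->
  area_preserving (fun p => (c * p.1 - s * p.2, s * p.1 + c * p.2)%R).
Proof.
have H (c' s' : R) : (c' ^+ 2 + s' ^+ 2 = 1)%R -> (1 + c' != 0)%R ->
    area_preserving (fun p => (c' * p.1 - s' * p.2, s' * p.1 + c' * p.2)%R).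
  (* [t] is minus the tangent of half the angle. *)
  move=> cs c1; pose t := (- s' / (1 + c'))%R.
  have := area_preserving_comp (area_preserving_shearx t 0)
    (area_preserving_comp (area_preserving_sheary s' 0) (area_preserving_shearx t 0)).
  apply: area_preserving_ext => -[x y] /=; rewrite !addr0.
  have ts : (s' * t = c' - 1)%R.
    have -> : (s' * t = - s' ^+ 2 / (1 + c'))%R by rewrite /t; field.
    have -> : (s' ^+ 2 = (1 - c') * (1 + c'))%R.
      have -> : (s' ^+ 2 = 1 - c' ^+ 2)%R by rewrite -cs addrAC subrr add0r.
      ring.
    by rewrite mulNr mulfK// opprB.
  have tc : (t * c' = - s' - t)%R by rewrite /t; field.
  congr pair; last by rewrite mulrDr mulrA ts; ring.
  rewrite !mulrDr (mulrA s') ts mulrBl mul1r addrA.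
  have -> : (t * (s' * x) = (c' - 1) * x)%R by rewrite mulrA [(t * s')%R]mulrC ts.
  have -> : (t * (c' * y - y) = - s' * y - t * y - t * y)%R by rewrite mulrBr mulrA tc; ring.
  ring.
move=> cs; have [c1|c1] := eqVneq (1 + c)%R 0%R; last exact: H.
have c0 : c = (- 1)%R by lra.
have s0 : s = 0%R.
  by apply/eqP; rewrite -sqrf_eq0; apply/eqP; move: cs; rewrite c0 sqrrN expr1n; lra.
have H01 : area_preserving (fun p => (0 * p.1 - 1 * p.2, 1 * p.1 + 0 * p.2)%R).
  by apply: H; rewrite ?expr0n ?expr1n/= ?add0r ?addr0// oner_eq0.
have := area_preserving_comp H01 H01.
by apply: area_preserving_ext => -[x y] /=; rewrite c0 s0; congr pair; ring.
Qed.

End AreaInvariance.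

(** * Cauchy's theorem *)

Section Goursat.
Context {R : realType}.
Local Notation mu := (@lebesgue_measure R).
Implicit Types (g : R[i] -> R[i]) (h : R -> R).

Lemma continuous_along_line g (a b : R[i]) : entire g ->
  continuous (fun x : R => Re (g (a + x%:C * b))) /\
  continuous (fun x : R => Im (g (a + x%:C * b))).
Proof.
move=> /entireP eg.
have H (x : R) (e : R) : 0 < e -> \forall y \near x,
    normc (g (a + x%:C * b) - g (a + y%:C * b)) <= e.
  move=> e0; have [d /cderiv_lip[r r0 L]] := eg (a + x%:C * b).
  pose K := normc d + 1; have K0 : 0 < K by rewrite ltr_wpDl ?normc_ge0.
  pose B := normc b + 1; have B0 : 0 < B by rewrite ltr_wpDl ?normc_ge0.
  apply/nbhs_ballP; exists (Num.min (r / B) (e / K / B)) => /=.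
    by rewrite lt_min !divr_gt0.
  move=> y; rewrite -ball_normE /= lt_min => /andP[y1 y2].
  have nb : normc ((y - x)%:C * b) <= `|x - y| * B.
    by rewrite normcM normcR distrC ler_wpM2l// /B lerDl.
  have -> : a + y%:C * b = a + x%:C * b + (y - x)%:C * b by rewrite rmorphB; ring.
  rewrite normc_dist; apply: le_trans (L _ _) _.
    by apply: le_lt_trans nb _; rewrite -ltr_pdivlMr.
  rewrite -/K mulrC -ler_pdivlMr//; apply: le_trans nb _.
  by rewrite -ler_pdivlMr// ltW.
split=> x; apply/cvgrPdist_le => e /(H x) [r r0 {}H]; exists r => // y /H;
  apply: le_trans; rewrite -?cReN -?cImN -?cReD -?cImD.
  exact: ler_normc_Re.
exact: ler_normc_Im.
Qed.

Definition seg_int h (a l : R) : R := \int[mu]_(x in `[a, a + l]) h x.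

Lemma integrable_seg h (a b : R) : continuous h ->
  mu.-integrable `[a, b] (EFin \o h).
Proof.
move=> ch; apply: continuous_compact_integrable; first exact: segment_compact.
exact: continuous_subspaceT.
Qed.

Lemma seg_int_split h (a l1 l2 : R) : continuous h -> 0 <= l1 -> 0 <= l2 ->
  seg_int h a (l1 + l2) = seg_int h a l1 + seg_int h (a + l1) l2.
Proof.
move=> ch l10 l20; rewrite /seg_int addrA.
have := @Rintegral_itvB R h (BLeft a) (BRight (a + l1 + l2)) (a + l1) (integrable_seg _ _ ch).
rewrite !bnd_simp !lerDl => /(_ l10 l20) E.
have E2 : \int[mu]_(x in `]a + l1, a + l1 + l2]) h x =
    \int[mu]_(x in `[a + l1, a + l1 + l2]) h x.
  apply: Rintegral_itv_obnd_cbnd.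
  have := integrable_seg (a + l1) (a + l1 + l2) ch.
  by apply: integrableS => //; exact: subset_itv_oc_cc.
by rewrite -E2 -E [RHS]addrC subrK.
Qed.

Lemma seg_int_bound h (a l k e : R) : continuous h -> 0 <= l ->
  (forall x, a <= x <= a + l -> `|h x - k| <= e) -> `|seg_int h a l - k * l| <= e * l.
Proof.
move=> ch l0 H; have ih := integrable_seg a (a + l) ch.
have cst r : seg_int (fun=> r) a l = r * l.
  rewrite /seg_int Rintegral_cst//= lebesgue_measure_itv/= lte_fin.
  move: l0; rewrite le_eqVlt => /predU1P[<-|l0].
    by rewrite addr0 ltxx /= !mulr0.
  by rewrite ltrDl l0 -EFinB/= addrAC subrr add0r.
have ic r : mu.-integrable `[a, a + l] (EFin \o (fun=> r)).
  by apply: integrable_seg => x; exact: cvg_cst.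
rewrite ler_distl -!mulrBl -mulrDl -!cst /seg_int; apply/andP; split.
  by apply: le_Rintegral => // x; rewrite /= in_itv/= => /H; rewrite ler_distl => /andP[].
by apply: le_Rintegral => // x; rewrite /= in_itv/= => /H; rewrite ler_distl => /andP[].
Qed.

Lemma seg_intB h1 h2 (a l : R) : continuous h1 -> continuous h2 ->
  seg_int h1 a l - seg_int h2 a l = seg_int (fun x => h1 x - h2 x) a l.
Proof. by move=> c1 c2; rewrite /seg_int RintegralB//; exact: integrable_seg. Qed.

Lemma nested_segments (u v : R^nat) : nondecreasing_seq u -> nonincreasing_seq v ->
  (forall n, u n <= v n) -> exists x, forall n, u n <= x <= v n.
Proof.
move=> nu nv uv; have H n m : u n <= v m.
  apply: (@le_trans _ _ (u (maxn n m))); first by apply: nu; exact: leq_maxl.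
  by apply: le_trans (uv _) _; apply: nv; exact: leq_maxr.
exists (sup (range u)) => n; apply/andP; split.
  by apply: ub_le_sup; [exists (v 0%N) => _ [m _ <-]|exists n].
by apply: ge_sup; [exists (u 0%N), 0%N|move=> _ [m _ <-]].
Qed.

Section Square.
Variable g : R[i] -> R[i].
Hypothesis eg : entire g.

Let H s t l := seg_int (fun x => Im (g (x +i* t))) s l.
Let V s t l := seg_int (fun y => Re (g (s +i* y))) t l.
(* imaginary part of the integral of [g] along the boundary of the square with
   lower left corner [s +i* t] and side [l] *)
Let Phi s t l := (H s t l - H s (t + l) l) + (V (s + l) t l - V s t l).

Let cH t : continuous (fun x => Im (g (x +i* t))).
Proof.
have := (continuous_along_line (0 +i* t) 1 eg).2.
by under eq_fun do rewrite mulr1 -[_ + _%:C]/((0 + _) +i* (t + 0)) add0r addr0.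
Qed.

Let cV s : continuous (fun y => Re (g (s +i* y))).
Proof.
have := (continuous_along_line (s +i* 0) 'i eg).1.
under eq_fun do rewrite -[_%:C * _]/((_ * 0 - 0 * 1) +i* (_ * 1 + 0 * 0)) -[_ + _]/((_ + _) +i* (_ + _))
  !mulr0 !mul0r mulr1 subr0 !addr0 add0r.
by [].
Qed.

(** A side shared by two quarters is traversed once in each direction and cancels. *)
Let PhiD s t l : 0 <= l ->
  Phi s t (l + l) = Phi s t l + Phi (s + l) t l + Phi s (t + l) l + Phi (s + l) (t + l) l.
Proof.
move=> l0; rewrite /Phi /H /V !seg_int_split// !addrA; ring.
Qed.

(** Opposite sides are compared. Up to an error [e / 2 * l ^+ 2] each, the affine part of [g]
    contributes [- Re d * l ^+ 2] on the horizontal sides and [Re d * l ^+ 2] on the vertical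
    ones. *)
Let Phi_local s0 t0 e : 0 < e -> exists2 r, 0 < r & forall s t l,
  0 <= l -> l < r -> s <= s0 <= s + l -> t <= t0 <= t + l ->
  `|Phi s t l| <= e * l ^+ 2.
Proof.
move=> e0; have [d Hd] := (entireP g).1 eg (s0 +i* t0).
have [r r0 Hr] := Hd (e / 8) (divr_gt0 e0 (ltr0Sn R 7)).
exists (r / 2); first by rewrite divr_gt0.
move=> s t l l0 lr /andP[s1 s2] /andP[t1 t2].
have B x y : s <= x <= s + l -> t <= y <= t + l ->
    normc (g (x +i* y) - g (s0 +i* t0) - d * ((x - s0) +i* (y - t0))) <= e / 4 * l.
  move=> /andP[x1 x2] /andP[y1 y2].
  have D : normc ((x - s0) +i* (y - t0)) <= 2 * l.
    apply: le_trans (normc_le_ReIm _ _) _.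
    have h1 : `|x - s0| <= l by rewrite ler_distl; lra.
    have h2 : `|y - t0| <= l by rewrite ler_distl; lra.
    lra.
  have := Hr ((x - s0) +i* (y - t0)).
  rewrite (_ : s0 +i* t0 + _ = x +i* y); last by simpc; congr Complex; ring.
  move=> K; apply: le_trans (K _) _; first by lra.
  by have := ler_wpM2l (ltW (divr_gt0 e0 (ltr0Sn R 7))) D; lra.
have B2 x y x' y' : s <= x <= s + l -> t <= y <= t + l -> s <= x' <= s + l -> t <= y' <= t + l ->
    normc (g (x +i* y) - g (x' +i* y') - d * ((x - x') +i* (y - y'))) <= e / 2 * l.
  move=> hx hy hx' hy'; have := ler_normcD (g (x +i* y) - g (s0 +i* t0) - d * ((x - s0) +i* (y - t0)))
     (- (g (x' +i* y') - g (s0 +i* t0) - d * ((x' - s0) +i* (y' - t0)))).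
  rewrite normcN (_ : _ - _ - _ + - _ = g (x +i* y) - g (x' +i* y') - d * ((x - x') +i* (y - y'))).
    by have := B x y hx hy; have := B x' y' hx' hy'; lra.
  rewrite (_ : (x - x') +i* (y - y') = ((x - s0) +i* (y - t0)) - ((x' - s0) +i* (y' - t0))); first ring.
  by simpc; congr Complex; ring.
have tl : t <= t + l <= t + l by lra.
have tt : t <= t <= t + l by lra.
have sl : s <= s + l <= s + l by lra.
have ss : s <= s <= s + l by lra.
have A1 : `|(H s t l - H s (t + l) l) - (- (Re d * l)) * l| <= e / 2 * l * l.
  rewrite /H seg_intB//; apply: seg_int_bound => //.
    by move=> x; apply: cvgB; exact: cH.
  move=> x hx; have := B2 x t x (t + l) hx tt hx tl; apply: le_trans.
  apply: le_trans (ler_normc_Im _); rewrite !cImD !cImN cImM /=.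
  by rewrite (_ : Im _ - _ - _ = Im (g (x +i* t)) - Im (g (x +i* (t + l))) - (Re d * (t - (t + l)) + Im d * (x - x))) ?lexx//; ring.
have A2 : `|(V (s + l) t l - V s t l) - (Re d * l) * l| <= e / 2 * l * l.
  rewrite /V seg_intB//; apply: seg_int_bound => //.
    by move=> x; apply: cvgB; exact: cV.
  move=> y hy; have := B2 (s + l) y s y sl hy ss hy; apply: le_trans.
  apply: le_trans (ler_normc_Re _); rewrite !cReD !cReN cReM /=.
  by rewrite (_ : Re _ - _ - _ = Re (g ((s + l) +i* y)) - Re (g (s +i* y)) - (Re d * (s + l - s) - Im d * (y - y))) ?lexx//; ring.
rewrite /Phi; move: A1 A2; rewrite !ler_distl ler_norml !expr2; lra.
Qed.

(* Goursat's bisection *)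
Lemma square_integral0 s0 t0 l0 : 0 < l0 -> Phi s0 t0 l0 = 0.
Proof.
move=> l00; apply/eqP; apply: contraT => P0.
have l2 : 0 < l0 ^+ 2 by rewrite exprn_gt0.
pose e := `|Phi s0 t0 l0| / l0 ^+ 2.
have e0 : 0 < e by rewrite divr_gt0// normr_gt0.
pose good (p : R * R) l := e * l ^+ 2 <= `|Phi p.1 p.2 l|.
(* The upper right quarter is the default value: by [nxtP] it is good when the square is good and
   the other three quarters are not. *)
pose nxt (p : R * R) l := if good p l then p else
  if good (p.1 + l, p.2) l then (p.1 + l, p.2) else
  if good (p.1, p.2 + l) l then (p.1, p.2 + l) else (p.1 + l, p.2 + l).
have nxtP p l : 0 <= l -> good p (l + l) -> good (nxt p l) l.
  move=> l_ge0 G; rewrite /nxt; case: ifPn => // n1; case: ifPn => // n2; case: ifPn => // n3.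
  apply: contraT => n4; move: G n1 n2 n3 n4; rewrite /good /= -!ltNge PhiD//.
  move=> G n1 n2 n3 n4; suff : `|Phi p.1 p.2 l + Phi (p.1 + l) p.2 l + Phi p.1 (p.2 + l) l +
      Phi (p.1 + l) (p.2 + l) l| < e * (l + l) ^+ 2 by rewrite ltNge G.
  have -> : e * (l + l) ^+ 2 = e * l ^+ 2 + e * l ^+ 2 + e * l ^+ 2 + e * l ^+ 2 by ring.
  do 3 (apply: le_lt_trans (ler_normD _ _) _; apply: ltrD => //).
pose ell (n : nat) := l0 / 2 ^+ n.
have ell0 n : 0 < ell n by rewrite divr_gt0// exprn_gt0.
have ellS n : ell n = ell n.+1 + ell n.+1.
  by rewrite /ell exprS; field; rewrite expf_neq0.
pose sq := fix sq n := if n is m.+1 then nxt (sq m) (ell n) else (s0, t0).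
have sqS n : sq n.+1 = nxt (sq n) (ell n.+1) by [].
have sqG n : good (sq n) (ell n).
  elim: n => [|n ih]; first by rewrite /good /ell expr0 divr1 /= divfK// gt_eqF.
  by rewrite sqS; apply: nxtP; [exact: ltW|rewrite -ellS].
have mono n : ((sq n).1 <= (sq n.+1).1 <= (sq n).1 + ell n.+1) /\
              ((sq n).2 <= (sq n.+1).2 <= (sq n).2 + ell n.+1).
  have := ell0 n.+1; rewrite sqS /nxt; do !case: ifP => _ /=; split; lra.
have [s1 S1] : exists x, forall n, (sq n).1 <= x <= (sq n).1 + ell n.
  apply: nested_segments; last by move=> n; rewrite lerDl ltW.
    by apply/nondecreasing_seqP => n; case: (mono n) => /andP[].
  by apply/nonincreasing_seqP => n; have := ellS n; case: (mono n) => /andP[]; lra.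
have [t1 T1] : exists x, forall n, (sq n).2 <= x <= (sq n).2 + ell n.
  apply: nested_segments; last by move=> n; rewrite lerDl ltW.
    by apply/nondecreasing_seqP => n; case: (mono n) => _ /andP[].
  by apply/nonincreasing_seqP => n; have := ellS n; case: (mono n) => _ /andP[]; lra.
(* At the common point of all squares the local estimate with [e / 2] contradicts [good], which
   bounds [Phi] from below with [e]. *)
have [r r0 L] := Phi_local s1 t1 (divr_gt0 e0 (ltr0Sn R 1)).
pose n := Num.truncn (l0 / r).
have ln : ell n < r.
  rewrite /ell ltr_pdivrMr ?exprn_gt0// mulrC -ltr_pdivrMr//.
  apply: lt_le_trans (truncnS_gt _) _.
  by rewrite -natrX ler_nat -/n ltn_expl.
have := L _ _ _ (ltW (ell0 n)) ln (S1 n) (T1 n); have := sqG n; rewrite /good.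
have : 0 < e * ell n ^+ 2 by rewrite mulr_gt0// exprn_gt0.
lra.
Qed.

(** For a square whose side equals the period, the two horizontal integrals cancel, and
    [square_integral0] equates the two vertical ones. So the segment moves left by one period at a
    time. *)
Lemma periodic_line_integral s0 (n : nat) :
  (forall z, g (z + (pi *+ 2) *i) = g z) ->
  seg_int (fun y => Re (g ((s0 - pi *+ 2 *+ n) +i* y))) 0 (pi *+ 2) =
  seg_int (fun y => Re (g (s0 +i* y))) 0 (pi *+ 2).
Proof.
move=> per; have pi0 : 0 < pi *+ 2 :> R by rewrite mulrn_wgt0// pi_gt0.
elim: n => [|n <-]; first by rewrite mulr0n subr0.
have := square_integral0 (s0 - pi *+ 2 *+ n.+1) 0 pi0; rewrite /Phi.
have -> : H (s0 - pi *+ 2 *+ n.+1) (0 + pi *+ 2) (pi *+ 2) = H (s0 - pi *+ 2 *+ n.+1) 0 (pi *+ 2).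
  congr seg_int; apply/funext => x; rewrite -[in RHS]per; congr (Im (g _)).
  by rewrite -[(x +i* 0) + _]/((x + 0) +i* (0 + pi *+ 2)) addr0.
rewrite subrr add0r => /subr0_eq /esym; rewrite /V mulrSr opprD addrA subrK.
by [].
Qed.

End Square.

(* [g w = f (z * cexp w)] is [2 pi i]-periodic, so its mean over a vertical
   segment of length [2 pi] does not change when the segment moves to
   [Re w = - oo], where it tends to [f 0]. *)
Lemma circle_mean (f : R[i] -> R[i]) z : entire f ->
  seg_int (fun t => Re (f (z * (cos t +i* sin t)))) 0 (pi *+ 2) = Re (f 0) * (pi *+ 2).
Proof.
move=> ef; have pi0 : 0 < pi *+ 2 :> R by rewrite mulrn_wgt0// pi_gt0.
pose g w := f (z * cexp w).
have eg : entire g.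
  apply: (@entire_comp R f (fun w => z * cexp w) ef).
  apply: (@entireM R (fun=> z) (@cexp R)); first exact: entire_cst.
  exact: (@entire_cexp R id (@entire_id R)).
have per w : g (w + (pi *+ 2) *i) = g w.
  rewrite /g cexpD (_ : cexp ((pi *+ 2) *i) = 1) ?mulr1//.
  by rewrite /cexp /= expR0 mul1r cos2pi sin2pi.
have -> : (fun t => Re (f (z * (cos t +i* sin t)))) = (fun y => Re (g (0 +i* y))).
  by apply/funext => t; rewrite /g /cexp /= expR0 mul1r.
have [d /cderiv_lip[r r0 L]] := (entireP f).1 ef 0.
apply/eqP; rewrite -subr_eq0 -normr_le0; apply/ler_addgt0Pr => e e0; rewrite add0r.
pose K := normc d + 1; have K0 : 0 < K by rewrite ltr_wpDl ?normc_ge0.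
pose e' := e / (pi *+ 2); have e'0 : 0 < e' by rewrite divr_gt0.
pose Z := normc z + 1; have Z0 : 0 < Z by rewrite ltr_wpDl ?normc_ge0.
(* The first bound keeps [z * cexp w] within the radius of the Lipschitz estimate of [f] at 0, the
   second makes that estimate at most [e']. *)
pose del := Num.min (r / Z) (e' / K / Z).
have del0 : 0 < del by rewrite lt_min !divr_gt0.
pose n := Num.truncn (del^-1).
have nd : expR (- (pi *+ 2 *+ n.+1)) < del.
  rewrite expRN invf_plt ?posrE ?expR_gt0//.
  apply: lt_le_trans (truncnS_gt _) _; rewrite -/n.
  apply: le_trans (expR_ge1Dx _); apply: le_trans (_ : pi *+ 2 *+ n.+1 <= _); last by rewrite lerDr.
  have p2 := @pi_ge2 R; rewrite -[leRHS]mulr_natr.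
  by rewrite ler_peMl// mulr2n; lra.
rewrite -(periodic_line_integral eg 0 n.+1 per) sub0r.
have -> : e = e' * (pi *+ 2) by rewrite /e' divfK// gt_eqF.
apply: seg_int_bound; [|exact: ltW|] => [x|y _].
  have := (continuous_along_line ((- (pi *+ 2 *+ n.+1)) +i* 0) 'i eg).1.
  under eq_fun do rewrite -[_%:C * _]/((_ * 0 - 0 * 1) +i* (_ * 1 + 0 * 0)) -[_ + _]/((_ + _) +i* (_ + _))
    !mulr0 !mul0r mulr1 subr0 !addr0 add0r.
  by apply.
rewrite -cReN -cReD; apply: le_trans (ler_normc_Re _) _.
have nz : normc (z * cexp ((- (pi *+ 2 *+ n.+1)) +i* y)) < del * Z.
  rewrite normcM normc_cexp /= mulrC; apply: (@le_lt_trans _ _ (expR (- (pi *+ 2 *+ n.+1)) * Z)).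
    by rewrite ler_wpM2l ?expR_ge0// /Z lerDl.
  by rewrite ltr_pM2r.
have := L (z * cexp ((- (pi *+ 2 *+ n.+1)) +i* y)); rewrite add0r => {}L.
apply: le_trans (L _) _.
  by apply: lt_le_trans nz _; rewrite -ler_pdivlMr// ge_min lexx.
rewrite -/K mulrC -ler_pdivlMr//; apply: le_trans (ltW nz) _.
by rewrite -ler_pdivlMr// ge_min lexx orbT.
Qed.

End Goursat.

(** * The mean value property for the Gaussian weight *)

Section MeanValue.
Context {R : realType}.
Local Notation T1 := (measurableTypeR R).
Local Notation T2 := (measurableTypeR R * measurableTypeR R)%type.
Local Notation mu := (@lebesgue_measure R).
Local Notation area := (@area R).

Definition cpx (p : R * R) : R[i] := p.1 +i* p.2.

Definition wt (p : R * R) : R := expR (- normc (cpx p) ^+ 2).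

Lemma wt_ge0 p : 0 <= wt p. Proof. exact: expR_ge0. Qed.

Lemma wtE p : wt p = expR (- p.1 ^+ 2 + - p.2 ^+ 2).
Proof. by rewrite /wt normc_sqr opprD. Qed.

Lemma cmeas_cpx : cmeas (cpx : T2 -> R[i]).
Proof. by split; [exact: measurable_fst|exact: measurable_snd]. Qed.

Lemma measurable_wt : measurable_fun setT (wt : T2 -> R).
Proof.
apply: measurableT_comp => //; apply: measurableT_comp => //.
by apply: measurable_funX; exact: (measurable_cmeas_normc cmeas_cpx).
Qed.

Lemma cmeas_wt : cmeas (fun p : T2 => (wt p)%:C).
Proof. exact: (cmeasR measurable_wt). Qed.

Lemma cmeas_entire f : entire f -> cmeas (fun p : T2 => f (cpx p)).
Proof.
move=> ef.
have cf : continuous (f : R[i]^o -> R[i]^o).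
  move=> z; apply: differentiable_continuous.
  by apply/derivable1_diffP; exact: ef.
have H (u : R[i] -> R) : (forall z w, u (z - w) = u z - u w) ->
    (forall z, `|u z| <= normc z) ->
    measurable_fun setT (fun p : T2 => u (f (cpx p))).
  move=> uB un.
  apply: (@measurability _ _ _ _ _ _ _ (RGenOInfty.measurableE R)) => _ [_ [t ->]] <-.
  rewrite setTI.
  have -> : (fun p : R * R => u (f (cpx p))) @^-1` `]t, +oo[ =
     [set p : R * R | (f @^-1` [set w : R[i]^o | t < u w]) (p.1 +i* p.2)].
    by apply/seteqP; split => p /=; rewrite in_itv/= andbT.
  apply: measurable_open_complex.
  apply: (@open_comp R[i]^o R[i]^o f) => [z _|]; first exact: cf.
  rewrite openE => w /= tw; apply/nbhs_ballP.
  exists (u w - t)%:C => /=; first by rewrite ltcR subr_gt0.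
  move=> w'; rewrite -ball_normE /= Defs.normcE ltcR => lt1.
  have := un (w - w'); rewrite uB ler_norml => /andP[_]; lra.
split; apply: H => [z w|z].
- by rewrite cReD cReN.
- exact: ler_normc_Re.
- by rewrite cImD cImN.
- exact: ler_normc_Im.
Qed.

Lemma cintegrable_ReIm d (T : measurableType d) (nu : {measure set T -> \bar R}) (F : T -> R[i]) :
  nu.-integrable setT (EFin \o (fun x => Re (F x))) ->
  nu.-integrable setT (EFin \o (fun x => Im (F x))) -> cintegrable nu F.
Proof.
move=> i1 i2.
have m1 : measurable_fun setT (fun x => Re (F x)) by move/integrableP: i1 => [/measurable_EFinP].
have m2 : measurable_fun setT (fun x => Im (F x)) by move/integrableP: i2 => [/measurable_EFinP].
apply: (cintegrable_le (h := fun x => `|Re (F x)| + `|Im (F x)|)) => //.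
- by apply: measurable_funD; exact: measurableT_comp.
- by move=> x; case: (F x) => a b; exact: normc_le_ReIm.
- apply: integral_ltyD => //; try exact: measurableT_comp.
  + by move/integrableP: i1 => [].
  + by move/integrableP: i2 => [].
Qed.

Lemma gauss1 (al : R) : 0 < al -> (\int[mu]_x (expR (- (al * x ^+ 2)))%:E < +oo)%E.
Proof.
(* With this standard deviation the integrand is a multiple of the normal density. *)
move=> al0; pose s := Num.sqrt ((2 * al)^-1).
have s0 : s != 0 by rewrite gt_eqF// sqrtr_gt0 invr_gt0 mulr_gt0.
have s2 : s ^+ 2 *+ 2 = al^-1.
  rewrite /s sqr_sqrtr; last by rewrite invr_ge0 mulr_ge0// ltW.
  by rewrite invfM -mulr_natr mulrAC mulVf ?mul1r.
have p0 := normal_peak_gt0 s0.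
have := integrable_lty measurableT (integrableZl measurableT (normal_peak s)^-1 (integrable_normal_pdf 0 s)).
under eq_integral => x _.
  rewrite normal_pdfE// -EFinM mulKf ?gt_eqF// /normal_fun subr0 s2 invrK mulNr mulrC.
  over.
by [].
Qed.

Lemma measurable_gaussx (al : R) : measurable_fun setT (fun x : T1 => expR (- (al * x ^+ 2))).
Proof.
by apply: measurableT_comp => //; apply: measurableT_comp => //; apply: measurable_funM.
Qed.

Lemma gauss2 (al be : R) : (\int[area]_p (expR (- (al * p.1 ^+ 2)) * expR (- (be * p.2 ^+ 2)))%:E =
  (\int[mu]_x (expR (- (al * x ^+ 2)))%:E) * (\int[mu]_x (expR (- (be * x ^+ 2)))%:E))%E.
Proof.
have m (be' : R) := measurable_gaussx be'.
rewrite fubini_tonelli1; first last.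
- by move=> p; rewrite lee_fin mulr_ge0 ?expR_ge0.
- apply/measurable_EFinP; apply: measurable_funM.
    exact: (measurableT_comp (m al) measurable_fst).
  exact: (measurableT_comp (m be) measurable_snd).
rewrite /fubini_F /=.
transitivity (\int[mu]_x ((expR (- (al * x ^+ 2)))%:E * \int[mu]_y (expR (- (be * y ^+ 2)))%:E))%E.
  apply: eq_integral => x _; under eq_integral do rewrite EFinM.
  rewrite ge0_integralZl//.
  by apply/measurable_EFinP; exact: m.
rewrite ge0_integralZr//.
- by apply/measurable_EFinP; exact: m.
- by apply: integral_ge0 => y _; rewrite lee_fin expR_ge0.
Qed.

Lemma integral_wt : (\int[area]_p (wt p)%:E = pi%:E)%E.
Proof.
transitivity (\int[area]_p (expR (- (1 * p.1 ^+ 2)) * expR (- (1 * p.2 ^+ 2)))%:E)%E.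
  by apply: eq_integral => p _; rewrite wtE expRD !mul1r.
rewrite gauss2; have -> : (\int[mu]_x (expR (- (1 * x ^+ 2)))%:E = (Num.sqrt pi)%:E)%E.
  by rewrite -integralT_gauss; apply: eq_integral => x _; rewrite mul1r.
by rewrite -EFinM -expr2 sqr_sqrtr// pi_ge0.
Qed.

Lemma measurable_gauss_bound (e A : R) :
  measurable_fun setT (fun p : T2 => expR (- (e * normc (cpx p) ^+ 2) + A * normc (cpx p))).
Proof.
have m := measurable_cmeas_normc cmeas_cpx.
apply: measurableT_comp => //; apply: measurable_funD.
  by apply: measurableT_comp => //; apply: measurable_funM => //; exact: measurable_funX.
exact: measurable_funM.
Qed.

Lemma gauss_bound (e A : R) : 0 < e ->
  (\int[area]_p (expR (- (e * normc (cpx p) ^+ 2) + A * normc (cpx p)))%:E < +oo)%E.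
Proof.
move=> e0; have e20 : 0 < e / 2 by rewrite divr_gt0.
(* From completing the square: [A * r <= e / 2 * r ^+ 2 + A ^+ 2 / (2 * e)]. The linear term costs
   half of the decay. *)
pose K := expR (A ^+ 2 / (2 * e)).
have m (be' : R) := measurable_gaussx be'.
have mg : measurable_fun setT (fun p : T2 => expR (- (e / 2 * p.1 ^+ 2)) * expR (- (e / 2 * p.2 ^+ 2))).
  apply: measurable_funM; first exact: (measurableT_comp (m (e / 2)) measurable_fst).
  exact: (measurableT_comp (m (e / 2)) measurable_snd).
apply: (integral_ltyW (T := T2) (h := fun p => expR (- (e * normc (cpx p) ^+ 2) + A * normc (cpx p))) (k := fun p => K * (expR (- (e / 2 * p.1 ^+ 2)) * expR (- (e / 2 * p.2 ^+ 2))))).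
- exact: measurable_gauss_bound.
- exact: measurable_funM.
- move=> p; apply/andP; split; first exact: expR_ge0.
  rewrite /K -!expRD ler_expR -opprD -mulrDr.
  rewrite -[p.1 ^+ 2 + _](normc_sqr (cpx p)); move: (normc (cpx p)) => r.
  have : 0 <= e / 2 * (r - A / e) ^+ 2 by rewrite mulr_ge0 ?sqr_ge0// ltW.
  rewrite (_ : e / 2 * (r - A / e) ^+ 2 = e / 2 * r ^+ 2 - A * r + A ^+ 2 / (2 * e)).
    by move: (A ^+ 2 / (2 * e)) => B; lra.
  by field; rewrite gt_eqF.
- apply: integral_ltyZ => //; first exact: expR_ge0.
  have G0 : (0 <= \int[mu]_x (expR (- (e / 2 * x ^+ 2)))%:E)%E.
    by apply: integral_ge0 => x _; rewrite lee_fin expR_ge0.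
  by rewrite gauss2; apply: lte_mul_pinfty; rewrite ?ge0_fin_numE ?gauss1.
Qed.

Definition rot (t : R) (p : R * R) : R * R :=
  (cos t * p.1 - sin t * p.2, sin t * p.1 + cos t * p.2).

Lemma cpx_rot t p : cpx (rot t p) = cpx p * (cos t +i* sin t).
Proof. by rewrite /cpx; simpc; rewrite /rot /=; congr Complex; ring. Qed.

Lemma wt_rot t p : wt (rot t p) = wt p.
Proof. by rewrite /wt cpx_rot normcM /= cos2Dsin2 sqrtr1 mulr1. Qed.

Lemma area_preserving_rot t : area_preserving (rot t).
Proof. exact: (area_preserving_rotation (cos2Dsin2 t)). Qed.

Lemma measurable_rot : measurable_fun setT (fun x : T1 * T2 => rot x.1 x.2 : T2).
Proof.
have mc : measurable_fun setT (fun x : T1 * T2 => cos x.1).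
  apply: measurableT_comp => //; apply: continuous_measurable_fun; exact: continuous_cos.
have ms : measurable_fun setT (fun x : T1 * T2 => sin x.1).
  apply: measurableT_comp => //; apply: continuous_measurable_fun; exact: continuous_sin.
have m1 : measurable_fun setT (fun x : T1 * T2 => x.2.1).
  exact: (measurableT_comp measurable_fst measurable_snd).
have m2 : measurable_fun setT (fun x : T1 * T2 => x.2.2).
  exact: (measurableT_comp measurable_snd measurable_snd).
apply: measurable_fun_pair; first by apply: measurable_funB; exact: measurable_funM.
by apply: measurable_funD; exact: measurable_funM.
Qed.

(** The indicator turns the circle mean into an integral over the whole line, the form in which
    [cint_Fubini] takes it. *)
Lemma circle_cint (f : R[i] -> R[i]) z : entire f ->
  cintegrable mu (fun t : T1 => (\1_(`[0, pi *+ 2]) t)%:C * f (z * (cos t +i* sin t))) /\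
  cint mu (fun t : T1 => (\1_(`[0, pi *+ 2]) t)%:C * f (z * (cos t +i* sin t))) =
    (pi *+ 2)%:C * f 0.
Proof.
move=> ef; pose D : set R := [set` `[0, pi *+ 2]].
have ind (t : R) (w : R[i]) : Re ((\1_D t)%:C * w) = \1_D t * Re w /\
    Im ((\1_D t)%:C * w) = \1_D t * Im w.
  by rewrite cReM cImM /= !mul0r subr0 addr0.
have eg : entire (fun w => f (z * cexp w)).
  apply: (@entire_comp R f (fun w => z * cexp w) ef).
  apply: (@entireM R (fun=> z) (@cexp R)); first exact: entire_cst.
  exact: (@entire_cexp R id (@entire_id R)).
have [c1 c2] := continuous_along_line 0 'i eg.
have E (t : R) : z * cexp (0 + t%:C * 'i) = z * (cos t +i* sin t).
  by rewrite add0r (_ : t%:C * 'i = 0 +i* t) /cexp /= ?expR0 ?mul1r//; simpc.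
have {}c1 : continuous (fun t => Re (f (z * (cos t +i* sin t)))).
  by under eq_fun do rewrite -E.
have {}c2 : continuous (fun t => Im (f (z * (cos t +i* sin t)))).
  by under eq_fun do rewrite -E.
have iD (h : R -> R) : continuous h -> mu.-integrable setT (EFin \o (fun t => \1_D t * h t)).
  move=> ch; have := (integrable_mkcond _ _).1 (integrable_seg 0 (pi *+ 2) ch) => /(_ (measurable_itv _)).
  apply: eq_integrable => // x _; rewrite /= patchE /D indicE.
  by case: (x \in _); rewrite ?mul1r ?mul0r.
have I1 (h : R -> R) : \int[mu]_t (\1_D t * h t) = seg_int h 0 (pi *+ 2).
  rewrite /seg_int add0r [RHS]Rintegral_mkcond; apply: eq_Rintegral => x _.
  by rewrite patchE /D indicE; case: (x \in _); rewrite ?mul1r ?mul0r.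
split.
  apply: cintegrable_ReIm.
    by under eq_fun do rewrite (ind _ _).1; exact: iD.
  by under eq_fun do rewrite (ind _ _).2; exact: iD.
rewrite /cint; under eq_Rintegral do rewrite (ind _ _).1.
under [X in _ +i* X]eq_Rintegral do rewrite (ind _ _).2.
rewrite !I1 circle_mean//.
(* [circle_mean] speaks of real parts; the imaginary part is obtained by applying it to
   [- 'i * f]. *)
have E3 (w : R[i]) : Re (- 'i * w) = Im w.
  by rewrite cReM /= oppr0 mul0r sub0r mulN1r opprK.
have eif : entire (fun w => - 'i * f w).
  exact: (entireM (entire_cst (- 'i)) ef).
have CM : seg_int (fun t => Im (f (z * (cos t +i* sin t)))) 0 (pi *+ 2) = Im (f 0) * (pi *+ 2).
  rewrite -E3 -(circle_mean z eif); congr seg_int; apply/funext => t.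
  by rewrite E3.
rewrite CM; apply/eqP; rewrite eq_complex cReM cImM /=; apply/andP; split; apply/eqP; ring.
Qed.

(** The function is integrated over the plane and over all rotations at once. Rotation invariance
    makes this [2 pi] times the left-hand side; in the other order each circle gives [2 pi * f 0],
    and the weight has total mass [pi]. *)
Lemma mean_value (f : R[i] -> R[i]) : entire f ->
  (\int[area]_p (normc (f (cpx p)) * wt p)%:E < +oo)%E ->
  cint area (fun p => f (cpx p) * (wt p)%:C) = pi%:C * f 0.
Proof.
move=> ef fy; have mf := cmeas_entire ef.
have mfw : cmeas (fun p : T2 => f (cpx p) * (wt p)%:C) by apply: cmeasM => //; exact: cmeas_wt.
have nfw p : normc (f (cpx p) * (wt p)%:C) = normc (f (cpx p)) * wt p.
  by rewrite normcM normcR (ger0_norm (wt_ge0 p)).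
have ifw : cintegrable area (fun p : T2 => f (cpx p) * (wt p)%:C).
  by split=> //; under eq_integral do rewrite nfw.
pose ind (t : R) : R := \1_(`[0, pi *+ 2]) t.
have ind01 t : 0 <= ind t by rewrite /ind indicE; case: (_ \in _).
have mind : measurable_fun setT (ind : T1 -> R) by exact: measurable_indic.
pose F (x : T1 * T2) := (ind x.1)%:C * (f (cpx (rot x.1 x.2)) * (wt (rot x.1 x.2))%:C).
have mF : cmeas F.
  apply: cmeasM.
    by apply: cmeasR; exact: (measurableT_comp mind measurable_fst).
  exact: (cmeas_comp measurable_rot mfw).
have nF t p : normc (F (t, p)) = ind t * normc (f (cpx (rot t p)) * (wt (rot t p))%:C).
  by rewrite /F normcM normcR ger0_norm.
have mn := measurable_cmeas_normc mfw.
have rotn t : (\int[area]_p (normc (f (cpx (rot t p)) * (wt (rot t p))%:C))%:E =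
    \int[area]_p (normc (f (cpx p) * (wt p)%:C))%:E)%E.
  have [_ H] := area_preserving_rot t.
  apply: (H (fun p => (normc (f (cpx p) * (wt p)%:C))%:E)).
    exact/measurable_EFinP.
  by move=> x; rewrite lee_fin normc_ge0.
have irot t : cintegrable area (fun p : T2 => f (cpx (rot t p)) * (wt (rot t p))%:C).
  split; last by rewrite rotn; case: ifw.
  have [mr _] := area_preserving_rot t; exact: (cmeas_comp mr mfw).
have rotc t : cint area (fun p => f (cpx (rot t p)) * (wt (rot t p))%:C) =
    cint area (fun p => f (cpx p) * (wt p)%:C).
  exact: (area_preserving_cint (area_preserving_rot t) mfw).
have H := cint_Fubini (m1 := mu) (m2 := area) mF.
have {}H : cint mu (fun x => cint area (fun y => F (x, y))) =
           cint area (fun y => cint mu (fun x => F (x, y))).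
  apply: H.
  - under eq_integral => t _.
      under eq_integral do rewrite nF EFinM.
      rewrite ge0_integralZl//; last 3 first.
      + by apply/measurable_EFinP; apply: measurable_cmeas_normc; case: (irot t).
      + by move=> p _; rewrite lee_fin normc_ge0.
      + by rewrite lee_fin.
      rewrite rotn; over.
    rewrite /= ge0_integralZr//; last 3 first.
    + exact/measurable_EFinP.
    + by move=> t _; rewrite lee_fin.
    + by apply: integral_ge0 => p _; rewrite lee_fin normc_ge0.
    have G0 : (0 <= \int[mu]_t (ind t)%:E)%E.
      by apply: integral_ge0 => t _; rewrite lee_fin.
    apply: lte_mul_pinfty => //; last by case: ifw.
    rewrite ge0_fin_numE//.
    by rewrite integral_indic//= setIT lebesgue_measure_itv/=; case: ifP => _; rewrite ltry.
  - by move=> t; exact: (cintegrableZ (ind t)%:C (irot t)).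
  - move=> p; have [+ _] := circle_cint (cpx p) ef.
    move=> /(cintegrableZ (wt p)%:C); congr cintegrable; apply/funext => t.
    by rewrite /F /= wt_rot cpx_rot -/(ind t); ring.
have pi20 : (pi *+ 2)%:C != 0 :> R[i].
  by rewrite gt_eqF// ltcR mulrn_wgt0// pi_gt0.
apply: (mulfI pi20).
have E1 : cint mu (fun x => cint area (fun y => F (x, y))) =
    (pi *+ 2)%:C * cint area (fun p => f (cpx p) * (wt p)%:C).
  have [i1 c1] := @circle_cint (fun=> 1) 0 (entire_cst 1).
  transitivity (cint mu (fun t => cint area (fun p => f (cpx p) * (wt p)%:C) * ((ind t)%:C * 1))).
    by apply: eq_cint => t; rewrite /F /= cintZ ?rotc; [ring|exact: irot].
  by rewrite cintZ// c1 mulr1 mulrC.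
rewrite -E1 H.
have E2 p : cint mu (fun x => F (x, p)) = (pi *+ 2)%:C * f 0 * (wt p)%:C.
  have [i1 c1] := @circle_cint f (cpx p) ef.
  rewrite -c1 mulrC -cintZ//; apply: eq_cint => t.
  by rewrite /F /= wt_rot cpx_rot -/(ind t); ring.
under eq_cint do rewrite E2.
rewrite cintZ.
  by rewrite cintR /Rintegral integral_wt /=; ring.
split; first exact: cmeas_wt.
under eq_integral do rewrite normcR (ger0_norm (wt_ge0 _)).
by rewrite integral_wt ltry.
Qed.

End MeanValue.

(** * The Fock space *)

Section FockIntegrals.
Context {R : realType}.
Local Notation T2 := (measurableTypeR R * measurableTypeR R)%type.
Local Notation area := (@Defs.area R).
Implicit Types f g : R[i] -> R[i].

(** Kept apart from holomorphy, since it is also applied to non-entire functions such as a kernel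
    multiplied by [expR (B * normc w)]. *)
Definition l2 f := cmeas (fun p : T2 => f (cpx p)) /\
  (\int[area]_p (normc (f (cpx p)) ^+ 2 * wt p)%:E < +oo)%E.

Lemma in_fockP f : in_fock f <-> entire f /\ l2 f.
Proof.
have pi0 : (0 <= (pi^-1 : R)%:E)%E by rewrite lee_fin invr_ge0 pi_ge0.
rewrite /in_fock /fock_sqnorm /l2; split=> [[ef h2]|[ef [_ h2]]]; split => //; last first.
  exact: lte_mul_pinfty.
split; first exact: cmeas_entire.
rewrite ltey; apply: contraPN h2 => /eqP E.
have -> : (\int[area]_p (normc (f (p.1 +i* p.2)) ^+ 2 * expR (- normc (p.1 +i* p.2) ^+ 2))%:E = +oo)%E by [].
by rewrite gt0_muley ?ltxx// lte_fin invr_gt0 pi_gt0.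
Qed.

Lemma measurable_l2 f : cmeas (fun p : T2 => f (cpx p)) ->
  measurable_fun setT (fun p : T2 => normc (f (cpx p)) ^+ 2 * wt p).
Proof.
move=> mf; apply: measurable_funM; last exact: measurable_wt.
by apply: measurable_funX; exact: measurable_cmeas_normc.
Qed.

Lemma measurable_l2M f g : cmeas (fun p : T2 => f (cpx p)) -> cmeas (fun p : T2 => g (cpx p)) ->
  measurable_fun setT (fun p : T2 => normc (f (cpx p)) * normc (g (cpx p)) * wt p).
Proof.
move=> mf mg; apply: measurable_funM; last exact: measurable_wt.
by apply: measurable_funM; exact: measurable_cmeas_normc.
Qed.

Lemma l2M f g : l2 f -> l2 g ->
  (\int[area]_p (normc (f (cpx p)) * normc (g (cpx p)) * wt p)%:E < +oo)%E.
Proof.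
move=> [mf fy] [mg gy].
apply: (integral_ltyW (T := T2) (h := fun p => normc (f (cpx p)) * normc (g (cpx p)) * wt p)
  (k := fun p => normc (f (cpx p)) ^+ 2 * wt p + normc (g (cpx p)) ^+ 2 * wt p)).
- exact: measurable_l2M.
- by apply: measurable_funD; exact: measurable_l2.
- move=> p; have w0 := wt_ge0 p; apply/andP; split.
    by rewrite !mulr_ge0 ?normc_ge0.
  rewrite -mulrDl ler_wpM2r//.
  have := sqr_ge0 (normc (f (cpx p)) - normc (g (cpx p))).
  have := normc_ge0 (f (cpx p)); have := normc_ge0 (g (cpx p)); nra.
- apply: integral_ltyD => //; try exact: measurable_l2;
  by move=> p; rewrite mulr_ge0 ?sqr_ge0 ?wt_ge0.
Qed.

Lemma normc_wt (z : R[i]) p : normc (z * (wt p)%:C) = normc z * wt p.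
Proof. by rewrite normcM normcR (ger0_norm (wt_ge0 p)). Qed.

Lemma cintegrable_l2 f g : l2 f -> l2 g ->
  cintegrable area (fun p => f (cpx p) * (g (cpx p))^* * (wt p)%:C).
Proof.
move=> lf lg; split.
  apply: cmeasM; last exact: cmeas_wt.
  by apply: cmeasM; [case: lf|apply: cmeasJ; case: lg].
under eq_integral do rewrite normc_wt normcM normc_conj.
exact: l2M.
Qed.

(** The weight gives the square of [f] a decay of order [1 - 2 * be], positive exactly below the
    threshold [2^-1]; [gauss_bound] does the rest. *)
Lemma l2_growth f (C be A : R) : cmeas (fun p : T2 => f (cpx p)) -> be < 2^-1 ->
  (forall w, normc (f w) <= C * expR (be * normc w ^+ 2 + A * normc w)) -> l2 f.
Proof.
move=> mf b12 fC; split=> //.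
apply: (integral_ltyW (T := T2) (h := fun p => normc (f (cpx p)) ^+ 2 * wt p)
   (k := fun p => C ^+ 2 * expR (- ((1 - 2 * be) * normc (cpx p) ^+ 2) + (2 * A) * normc (cpx p)))).
- exact: measurable_l2.
- by apply: measurable_funM => //; exact: measurable_gauss_bound.
- move=> p; apply/andP; split; first by rewrite mulr_ge0 ?sqr_ge0 ?wt_ge0.
  pose X := be * normc (cpx p) ^+ 2 + A * normc (cpx p).
  have -> : expR (- ((1 - 2 * be) * normc (cpx p) ^+ 2) + 2 * A * normc (cpx p)) = expR X ^+ 2 * wt p.
    by rewrite /wt [expR X ^+ 2]expr2 -!expRD /X; congr expR; ring.
  rewrite mulrA -exprMn ler_wpM2r ?wt_ge0//.
  by rewrite ler_pXn2r ?nnegrE ?normc_ge0//; apply: le_trans (fC _); exact: normc_ge0.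
- apply: integral_ltyZ => //; last by apply: gauss_bound; lra.
  + exact: measurable_gauss_bound.
  + exact: sqr_ge0.
Qed.

Lemma normc_cexp_le (z : R[i]) : normc (cexp z) <= expR (normc z).
Proof. by rewrite normc_cexp ler_expR; apply: le_trans (ler_normc_Re _); exact: ler_norm. Qed.

Lemma l2_cexp (c s : R[i]) : normc c < 2^-1 -> l2 (fun w => cexp (c * w ^+ 2 + s * w)).
Proof.
move=> c12; apply: (@l2_growth _ 1 (normc c) (normc s)) => //.
  apply: cmeas_cexp; apply: cmeasD; apply: cmeasM; try exact: cmeas_cst.
    by apply: cmeasX; exact: cmeas_cpx.
  exact: cmeas_cpx.
move=> w; rewrite mul1r; apply: le_trans (normc_cexp_le _) _; rewrite ler_expR.
apply: le_trans (ler_normcD _ _) _.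
by rewrite expr2 !normcM -expr2.
Qed.

Lemma entire_quad (c s : R[i]) : entire (fun w => cexp (c * w ^+ 2 + s * w)).
Proof.
apply: entire_cexp.
exact: (entireD (entireM (entire_cst c) (entireX 2 entire_id)) (entireM (entire_cst s) entire_id)).
Qed.

Lemma in_fock_quad (c s : R[i]) : normc c < 2^-1 -> in_fock (fun w => cexp (c * w ^+ 2 + s * w)).
Proof. by move=> c12; apply/in_fockP; split; [exact: entire_quad|exact: l2_cexp]. Qed.

(** Supplies the exponential moments that [cderiv_param] requires. The factor [expR (B * normc w)]
    is given to [g], whose quadratic growth rate [be] it leaves unchanged. *)
Lemma l2_exp_norm f g (be A : R) : l2 f -> cmeas (fun p : T2 => g (cpx p)) -> be < 2^-1 ->
  (forall w, normc (g w) <= expR (be * normc w ^+ 2 + A * normc w)) ->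
  forall B, (\int[area]_p (expR (B * normc (cpx p)) * normc (g (cpx p) * f (cpx p) * (wt p)%:C))%:E < +oo)%E.
Proof.
move=> lf mg b12 gA B.
have mc : measurable_fun setT (fun p : T2 => expR (B * normc (cpx p))).
  apply: measurableT_comp => //; apply: measurable_funM => //.
  exact: (measurable_cmeas_normc cmeas_cpx).
have lg : l2 (fun w => (expR (B * normc w))%:C * g w).
  apply: (@l2_growth _ 1 be (B + A)) => //; first by apply: cmeasM => //; exact: cmeasR.
  move=> w; rewrite normcM normcR ger0_norm ?expR_ge0// mul1r mulrDl addrCA [leRHS]expRD.
  by rewrite ler_wpM2l ?expR_ge0.
have := l2M lg lf; congr (_ < _)%E; apply: eq_integral => p _.
by rewrite normc_wt !normcM normcR ger0_norm ?expR_ge0// !mulrA.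
Qed.

Lemma l2_exp f (B : R) : l2 f ->
  (\int[area]_p (expR (B * normc (cpx p)) * normc (f (cpx p) * (wt p)%:C))%:E < +oo)%E.
Proof.
move=> lf; have := @l2_exp_norm f (fun=> 1) 0 0 lf (cmeas_cst _ _) _ _ B.
under eq_integral do rewrite mul1r; apply; first by rewrite invr_gt0.
by move=> w; rewrite !mul0r addr0 expR0 normc1.
Qed.

(** The cross terms of the translated weight are split so that the first factor is holomorphic in
    [cpx p], while the second is the inverse of the kernel at the translated point. *)
Lemma wt_translate (p : R * R) (z : R[i]) :
  (wt (p.1 + Re z, p.2 + Im z))%:C =
  cexp (- z^* * cpx p) * cexp (- (z * (cpx p + z)^*)) * (wt p)%:C.
Proof.
rewrite /wt -!cexpR -!cexpD; congr cexp; rewrite !normc_sqr /cpx; case: z => x y /=.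
by apply/eqP; rewrite eq_complex /=; apply/andP; split; apply/eqP; ring.
Qed.

(** Translating by [z] turns the integrand into [g] times the weight, where [g] is entire and
    [g 0 = f z]; this is then [mean_value] for [g]. *)
Lemma reproducing f z : in_fock f ->
  cint area (fun p => cexp (z * (cpx p)^*) * (f (cpx p) * (wt p)%:C)) = pi%:C * f z.
Proof.
move=> /in_fockP[ef lf].
pose T (p : R * R) := (p.1 + Re z, p.2 + Im z).
have aT : area_preserving T by exact: area_preserving_translate.
have cT p : cpx (T p) = cpx p + z.
  by apply/eqP; rewrite eq_complex cReD cImD /= !eqxx.
pose g w := f (w + z) * cexp (- z^* * w).
have eg : entire g.
  apply: entireM; first exact: (entire_comp ef (entireD entire_id (entire_cst z))).
  exact: (entire_cexp (entireM (entire_cst (- z^*)) entire_id)).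
have mF : cmeas (fun p : T2 => cexp (z * (cpx p)^*) * (f (cpx p) * (wt p)%:C)).
  apply: cmeasM.
    apply: cmeas_cexp; apply: cmeasM; first exact: cmeas_cst.
    by apply: cmeasJ; exact: cmeas_cpx.
  by apply: cmeasM; [case: lf|exact: cmeas_wt].
have gT p : g (cpx p) * (wt p)%:C =
    cexp (z * (cpx (T p))^*) * (f (cpx (T p)) * (wt (T p))%:C).
  have aux (F E1 E2 E3 W : R[i]) : E2 * E3 = 1 -> F * E1 * W = E2 * (F * (E1 * E3 * W)).
    move=> E; have -> : E2 * (F * (E1 * E3 * W)) = (E2 * E3) * (F * E1 * W) by ring.
    by rewrite E mul1r.
  have E := wt_translate p z; rewrite -/(T p) in E; rewrite E {E} cT.
  rewrite /g.
  exact: (aux _ _ _ _ _ (cexpNK (z * (cpx p + z)^*))).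
rewrite -(area_preserving_cint aT mF).
under eq_cint do rewrite -gT.
rewrite mean_value//; first by rewrite /g add0r mulr0 cexp0 mulr1.
have lK : (\int[area]_p (normc (cexp (z * (cpx p)^*) * (f (cpx p) * (wt p)%:C)))%:E < +oo)%E.
  apply: (integral_ltyW _ _ _ (l2_exp (normc z) lf)).
  - exact: measurable_cmeas_normc.
  - apply: measurable_funM.
      apply: measurableT_comp => //; apply: measurable_funM => //.
      exact: (measurable_cmeas_normc cmeas_cpx).
    by apply: measurable_cmeas_normc; apply: cmeasM; [case: lf|exact: cmeas_wt].
  - move=> p; apply/andP; split; first exact: normc_ge0.
    rewrite normcM ler_wpM2r ?normc_ge0//.
    by apply: le_trans (normc_cexp_le _) _; rewrite normcM normc_conj.
under eq_integral do rewrite -normc_wt gT.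
have [_ H] := aT.
rewrite (H (fun p => (normc (cexp (z * (cpx p)^*) * (f (cpx p) * (wt p)%:C)))%:E))//.
- by apply/measurable_EFinP; exact: measurable_cmeas_normc.
- by move=> p; rewrite lee_fin normc_ge0.
Qed.

(** The reproducing formula differentiated in [z] under the integral. At 0 it expresses the
    derivative of [f] as its inner product with the identity function. *)
Lemma cderiv_reproducing f z : in_fock f ->
  cderiv f z ((pi^-1)%:C * cint area (fun p => (cpx p)^* * cexp (z * (cpx p)^*) * (f (cpx p) * (wt p)%:C))).
Proof.
move=> ff; have [ef lf] := (in_fockP f).1 ff.
have m1 : cmeas (fun p : T2 => (cpx p)^*) by apply: cmeasJ; exact: cmeas_cpx.
have m2 : cmeas (fun p : T2 => f (cpx p) * (wt p)%:C).
  by apply: cmeasM; [case: lf|exact: cmeas_wt].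
have m3 (A : R) : (\int[area]_p (expR (A * normc (cpx p)^*) * normc (f (cpx p) * (wt p)%:C))%:E < +oo)%E.
  by under eq_integral do rewrite normc_conj; exact: l2_exp.
have H := cderivZ (pi^-1)%:C (cderiv_param m1 m2 m3 z).
apply: cderiv_ext H => w.
by rewrite reproducing// mulrA -rmorphM mulVf ?mul1r// gt_eqF// pi_gt0.
Qed.

End FockIntegrals.

(** * A rigidity property of entire functions *)

Section HolomorphicSymmetry.
Context {R : realType}.

Lemma is_derive0_quot (r : R -> R) (x : R) :
  (forall e, 0 < e -> exists2 dl, 0 < dl & forall h, `|h| < dl -> `|r (x + h) - r x| <= e * `|h|) ->
  is_derive x 1 r 0.
Proof.
move=> H.
have C : (fun h : R => h^-1 *: (r (h *: 1 + x) - r x)) @ 0^' --> (0 : R).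
  apply/cvgrPdist_le => e e0; have [dl dl0 hd] := H e e0.
  rewrite /dnbhs /within /=; apply/nbhs_ballP; exists dl => //= h.
  rewrite -ball_normE /= sub0r normrN => hdl h0.
  rewrite sub0r normrN /GRing.scale /= mulr1 normrM normfV mulrC.
  by rewrite ler_pdivrMr ?normr_gt0// [h + x]addrC hd.
by apply: DeriveDef; [apply/cvg_ex; exists 0|exact: cvg_lim].
Qed.

(** Along the ray through [z] the real and imaginary parts, both covered by [u], are real functions
    with zero derivative, and the real mean value theorem applies. *)
Lemma cst_of_cderiv0 (f : R[i] -> R[i]) : (forall z, cderiv f z 0) -> forall z, f z = f 0.
Proof.
move=> f0 z.
have H (u : R[i] -> R) : (forall a b, u (a - b) = u a - u b) -> (forall a, `|u a| <= normc a) ->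
    u (f z) = u (f 0).
  move=> uB un; pose r (x : R) := u (f (x%:C * z)).
  have dr (x : R) : is_derive x 1 r 0.
    apply: is_derive0_quot => e e0.
    pose Z := normc z + 1; have Z0 : 0 < Z by rewrite ltr_wpDl ?normc_ge0.
    have [dl dl0 hd] := f0 (x%:C * z) (e / Z) (divr_gt0 e0 Z0).
    exists (dl / Z); first by rewrite divr_gt0.
    move=> h hh; have nz : normc (h%:C * z) <= `|h| * Z.
      by rewrite normcM normcR ler_wpM2l// /Z lerDl.
    rewrite /r -uB; apply: le_trans (un _) _.
    rewrite rmorphD mulrDl; have := hd (h%:C * z); rewrite mul0r subr0 => {}hd.
    apply: le_trans (hd _) _; first by apply: le_lt_trans nz _; rewrite -ltr_pdivlMr.
    rewrite mulrAC ler_pdivrMr// -mulrA ler_wpM2l// ltW//.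
  have [c _ /eqP] := mvt0 1 dr; rewrite mul0r subr_eq0 => /eqP.
  by rewrite /r mul1r mul0r.
apply/eqP; rewrite eq_complex; apply/andP; split; apply/eqP; apply: H.
- by move=> a b; rewrite cReD cReN.
- exact: ler_normc_Re.
- by move=> a b; rewrite cImD cImN.
- exact: ler_normc_Im.
Qed.

(* Since [f z = (f (- z))^*], [f] is both holomorphic and antiholomorphic. *)
Lemma cst_of_conj_sym (f : R[i] -> R[i]) : entire f -> (forall z, f (- z) = (f z)^*) ->
  forall z, f z = f 0.
Proof.
move=> ef fJ; apply: cst_of_cderiv0 => z.
have [d Hd] := (entireP f).1 ef z; have [d' Hd'] := (entireP f).1 ef (- z).
suff d0 : d = 0 by rewrite -d0.
apply: eq0_normc; apply/eqP; rewrite -normr_le0 ger0_norm ?normc_ge0//.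
apply/ler_addgt0Pr => e e0; rewrite add0r.
have e20 : 0 < e / 2 by rewrite divr_gt0.
have [r1 r10 H1] := Hd _ e20; have [r2 r20 H2] := Hd' _ e20.
pose r := Num.min r1 r2 / 2.
have m0 : 0 < Num.min r1 r2 by rewrite lt_min r10.
have r0 : 0 < r by rewrite divr_gt0.
have [rr1 rr2] : r < r1 /\ r < r2.
  by split; apply: (@lt_le_trans _ _ (Num.min r1 r2)); rewrite ?ge_min ?lexx ?orbT//; rewrite /r; lra.
(* The expansions of [f] at [z] and at [- z] describe the same increment. Taking [h] real and then
   imaginary bounds both [d' + d^*] and [d' - d^*] by [e], hence also [d]. *)
have K (h : R[i]) : normc h = r -> normc (d' * h + d^* * h^*) <= e * r.
  move=> hr; have := H1 h; have := H2 (- h); rewrite normcN hr => /(_ rr2) A2 /(_ rr1) A1.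
  rewrite -opprD !fJ in A2; rewrite -normc_conj in A1.
  have -> : d' * h + d^* * h^* = ((f (z + h))^* - (f z)^* - d' * - h) - (f (z + h) - f z - d * h)^*.
    by rewrite !rmorphB rmorphM /=; ring.
  by apply: le_trans (ler_normcD _ _) _; rewrite normcN; lra.
have nr : normc r%:C = r by rewrite normcR gtr0_norm.
pose I : R[i] := 0 +i* 1.
have nI : normc I = 1 by rewrite /= expr0n expr1n add0r sqrtr1.
have B1 : normc (d' + d^*) <= e.
  by have := K r%:C nr; rewrite conjc_real -mulrDl normcM nr ler_pM2r.
have B2 : normc (d' - d^*) <= e.
  have nrI : normc (r%:C * I) = r by rewrite normcM nr nI mulr1.
  have := K (r%:C * I) nrI; have -> : (r%:C * I)^* = - (r%:C * I).
    by apply/eqP; rewrite eq_complex cReJ cImJ cReN cImN cReM cImM /=; apply/andP; split; apply/eqP; ring.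
  have -> : d' * (r%:C * I) + d^* * - (r%:C * I) = (d' - d^*) * (r%:C * I) by ring.
  by rewrite normcM nrI ler_pM2r.
rewrite -normc_conj; have := ler_normcD (d' + d^*) (- (d' - d^*)).
rewrite normcN (_ : d' + d^* + - (d' - d^*) = 2%:R%:C * d^*); last by rewrite rmorph_nat; ring.
by rewrite normcM normcR ger0_norm//; lra.
Qed.

End HolomorphicSymmetry.

(** * Gaussian integrals *)

Section Gaussian.
Context {R : realType}.
Local Notation T2 := (measurableTypeR R * measurableTypeR R)%type.
Local Notation area := (@Defs.area R).

Definition gquad (cc : R) (s w : R[i]) : R[i] := cexp (cc%:C * w ^+ 2 + s * w).

Definition quad_ip (cc : R) (s t : R[i]) : R[i] :=
  cint area (fun p => gquad cc s (cpx p) * (gquad cc t (cpx p))^* * (wt p)%:C).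

(** The exponent of the ratio [quad_ip cc s t / quad_ip cc 0 0], as [gaussian_ip] shows. It is
    holomorphic in [s] and antiholomorphic in [t]. *)
Definition quad_exponent (cc : R) (s t : R[i]) : R[i] :=
  (s * t^* + cc%:C * s ^+ 2 + cc%:C * t^* ^+ 2) / (1 - 4 * cc%:C ^+ 2).

Variable cc : R.
Hypothesis cc12 : `|cc| < 2^-1.
Local Notation c := (cc%:C : R[i]).
Implicit Types (s t k h w z : R[i]).

Local Notation quad := (gquad cc).
Local Notation I := (quad_ip cc).
Local Notation E := (quad_exponent cc).
Local Notation DC := (1 - 4 * c ^+ 2).

Let DC_neq0 : DC != 0.
Proof.
have -> : DC = (1 - 4 * cc ^+ 2)%:C by rewrite rmorphB rmorphM rmorphXn rmorph_nat.
rewrite (inj_eq (@complexI R)) gt_eqF//.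
by move: cc12; rewrite ltr_norml => /andP[h1 h2]; nra.
Qed.

Lemma l2_quad s : l2 (quad s).
Proof. by apply: l2_cexp; rewrite normcR. Qed.

Lemma entire_quad_fun s : entire (quad s).
Proof. exact: entire_quad. Qed.

Lemma in_fock_quad_fun s : in_fock (quad s).
Proof. by apply/in_fockP; split; [exact: entire_quad|exact: l2_quad]. Qed.

Lemma gquadD s t w : quad (s + t) w = cexp (t * w) * quad s w.
Proof. by rewrite /gquad -cexpD; congr cexp; ring. Qed.

(** Differentiating in the parameter brings down a factor [cpx p]. This yields both the holomorphy
    of the integral operators and the moments of [q]. *)
Lemma cderiv_ip g s : l2 g ->
  cderiv (fun s => cint area (fun p => quad s (cpx p) * (g (cpx p))^* * (wt p)%:C)) s
   (cint area (fun p => cpx p * quad s (cpx p) * (g (cpx p))^* * (wt p)%:C)).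
Proof.
move=> lg.
have m1 := @cmeas_cpx R.
have m2 : cmeas (fun p : T2 => quad 0 (cpx p) * (g (cpx p))^* * (wt p)%:C).
  apply: cmeasM; last exact: cmeas_wt.
  by apply: cmeasM; [case: (l2_quad 0)|apply: cmeasJ; case: lg].
have m3 (A : R) : (\int[area]_p (expR (A * normc (cpx p)) *
    normc (quad 0 (cpx p) * (g (cpx p))^* * (wt p)%:C))%:E < +oo)%E.
  under eq_integral do rewrite !normcM normc_conj -!normcM.
  apply: (@l2_exp_norm _ g (quad 0) `|cc| 0) => //; first by case: (l2_quad 0).
  move=> w; apply: le_trans (normc_cexp_le _) _.
  by rewrite ler_expR !mul0r !addr0 normcM normcR expr2 normcM -expr2.
have := cderiv_param m1 m2 m3 s.
have qE s' w : quad s' w = cexp (s' * w) * quad 0 w by rewrite -gquadD add0r.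
rewrite (_ : cint _ _ = cint area (fun p => cpx p * quad s (cpx p) * (g (cpx p))^* * (wt p)%:C)); last first.
  by apply: eq_cint => p; rewrite (qE s) !mulrA.
by apply: cderiv_ext => s'; apply: eq_cint => p; rewrite (qE s') !mulrA.
Qed.

Let I_int s t : cintegrable area (fun p => quad s (cpx p) * (quad t (cpx p))^* * (wt p)%:C).
Proof. by apply: cintegrable_l2; exact: l2_quad. Qed.

(* translation of the integration variable by [h] *)
Let I_shift s t h : let k := h^* - 2 * c * h in
  I s t = cexp (c * h ^+ 2 + s * h + c * h^* ^+ 2 + t^* * h^* - h * h^*) * I (s - k) (t - k).
Proof.
move=> k; rewrite /quad_ip -cintZ//.
pose T (p : R * R) := (p.1 + Re h, p.2 + Im h).
have aT : area_preserving T by exact: area_preserving_translate.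
have cT p : cpx (T p) = cpx p + h.
  by apply/eqP; rewrite eq_complex cReD cImD /= !eqxx.
rewrite -(area_preserving_cint aT); last by case: (I_int s t).
apply: eq_cint => p; rewrite cT.
have W := wt_translate p h; rewrite -/(T p) in W; rewrite {}W.
rewrite /gquad !cexpJ !cJE.
have aux (A B C D W F G H : R[i]) : A * B * C * D = F * G * H -> A * B * (C * D * W) = F * (G * H * W).
  by move=> e; rewrite !mulrA e.
apply: aux; rewrite -!cexpD; congr cexp; rewrite /k.
move: (cpx p) (cpx p)^* (h^*) (t^*) => w w' h' t'; ring.
Qed.

Let E_shift s t h : let k := h^* - 2 * c * h in
  E s t = c * h ^+ 2 + s * h + c * h^* ^+ 2 + t^* * h^* - h * h^* + E (s - k) (t - k).
Proof.
move=> k; apply: (mulIf DC_neq0); rewrite [RHS]mulrDl /quad_exponent !divfK// /k.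
rewrite !cJE.
move: (h^*) (t^*) => h' t'; ring.
Qed.

Let shiftE s t k : I s t * cexp (- E s t) = I (s - k) (t - k) * cexp (- E (s - k) (t - k)).
Proof.
(* The solution of the real-linear equation [h^* - 2 * c * h = k], found by eliminating [h^*] with
   the conjugate equation. *)
pose h := (k^* + 2 * c * k) / DC.
have kE : h^* - 2 * c * h = k.
  have DJ : DC^* = DC by rewrite !cJE.
  have hD : h * DC = k^* + 2 * c * k by rewrite /h divfK.
  have hD' : h^* * DC = k + 2 * c * k^*.
    by have := congr1 (@conjc R) hD; rewrite cJM DJ => ->; rewrite !cJE.
  apply: (mulIf DC_neq0); rewrite mulrBl hD' -(mulrA (2 * c)) hD; move: (k^*) => k'; ring.
have := I_shift s t h; have := E_shift s t h; rewrite /= kE => -> ->.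
have aux (A B C F : R[i]) : A * B = 1 -> A * F * (B * C) = F * C.
  by move=> e; rewrite mulrACA e mul1r.
have cN (A B : R[i]) : cexp (- (A + B)) = cexp (- A) * cexp (- B) by rewrite opprD cexpD.
by rewrite cN; apply: aux; exact: cexpNK.
Qed.

(* By [shiftE] the product of the integral with [cexp (- E s t)] depends on
   [s - t] only, and is then constant by [cst_of_conj_sym]. *)
Lemma gaussian_ip s t : I s t = I 0 0 * cexp (E s t).
Proof.
pose phi s' := I s' 0 * cexp (- E s' 0).
have ephi : entire phi.
  apply: entireM.
    by apply/entireP => z; eexists; exact: (cderiv_ip z (l2_quad 0)).
  apply: entire_cexp; rewrite /quad_exponent cJ0.
  have -> : (fun x => - ((x * 0 + c * x ^+ 2 + c * 0 ^+ 2) / DC)) = (fun x => - (c / DC) * x ^+ 2).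
    by apply/funext => x; rewrite expr0n /= mulr0 add0r mulr0 addr0 mulrAC mulNr.
  exact: (entireM (entire_cst _) (entireX 2 entire_id)).
have IJ s' t' : I t' s' = (I s' t')^*.
  rewrite /quad_ip -cintJ//; apply: eq_cint => p.
  by rewrite !cJE [X in X * _]mulrC.
have EJ s' t' : E t' s' = (E s' t')^*.
  have DJ : (DC^-1)^* = DC^-1.
    rewrite cJV; congr (_^-1).
    by rewrite !cJE.
  rewrite /quad_exponent cJM DJ !cJE; congr (_ * _); ring.
(* Shifting both parameters by [z] takes the pair [(- z, 0)] to [(0, z)], and exchanging the
   parameters is conjugation. *)
have phiJ z : phi (- z) = (phi z)^*.
  rewrite /phi (shiftE (- z) 0 (- z)) subrr sub0r opprK cJM -IJ cexpJ.
  by rewrite cJN -EJ.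
have phiE := cst_of_conj_sym ephi phiJ.
have := shiftE s t t; rewrite subrr -/(phi (s - t)) phiE /phi => H.
have -> : I s t = I s t * cexp (- E s t) * cexp (E s t).
  by rewrite -mulrA -cexpD addNr cexp0 mulr1.
rewrite H; congr (_ * _).
by rewrite /quad_exponent cJ0 expr0n /= !mulr0 !addr0 mul0r oppr0 cexp0 mulr1.
Qed.

(** The integral behind Schur's test: a first power with half the weight. It splits into real
    Gaussians with rates [2^-1 - cc] and [2^-1 + cc]. *)
Lemma gauss_half_lty :
  (\int[area]_p (expR (Re (c * cpx p ^+ 2) - normc (cpx p) ^+ 2 / 2))%:E < +oo)%E.
Proof.
have h12 := cc12; rewrite ltr_norml in h12; case/andP: h12 => h1 h2.
have a0 : 0 < 2^-1 - cc by lra.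
have b0 : 0 < 2^-1 + cc by lra.
have -> : (\int[area]_p (expR (Re (c * cpx p ^+ 2) - normc (cpx p) ^+ 2 / 2))%:E =
  \int[area]_p (expR (- ((2^-1 - cc) * p.1 ^+ 2)) * expR (- ((2^-1 + cc) * p.2 ^+ 2)))%:E)%E.
  apply: eq_integral => -[x y] _; rewrite -expRD normc_sqr /cpx expr2 !cReM !cImM /=.
  by congr (expR _)%:E; field.
rewrite gauss2.
have G0 al : (0 <= \int[@lebesgue_measure R]_x (expR (- (al * x ^+ 2)))%:E)%E.
  by apply: integral_ge0 => x _; rewrite lee_fin expR_ge0.
by apply: lte_mul_pinfty; rewrite ?ge0_fin_numE ?gauss1.
Qed.

Lemma measurable_gauss_half s :
  measurable_fun setT (fun p : T2 => expR (Re (c * cpx p ^+ 2 + s * cpx p) - normc (cpx p) ^+ 2 / 2)).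
Proof.
apply: measurableT_comp => //; apply: measurable_funB.
  have [] // : cmeas (fun p : T2 => c * cpx p ^+ 2 + s * cpx p).
  apply: cmeasD; apply: cmeasM; try exact: cmeas_cst; last exact: cmeas_cpx.
  by apply: cmeasX; exact: cmeas_cpx.
apply: measurable_funM => //; apply: measurable_funX.
exact: (measurable_cmeas_normc cmeas_cpx).
Qed.

(** With this [s], translation by [h] removes the term linear in [cpx p] and leaves the constant
    [Re (s * h) / 2]. *)
Lemma gauss_half_shift h : let s := h^* - 2 * c * h in
  (\int[area]_p (expR (Re (c * cpx p ^+ 2 + s * cpx p) - normc (cpx p) ^+ 2 / 2))%:E =
   (expR (Re (s * h) / 2))%:E *
   \int[area]_p (expR (Re (c * cpx p ^+ 2) - normc (cpx p) ^+ 2 / 2))%:E)%E.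
Proof.
move=> s; pose T (p : R * R) := (p.1 + Re h, p.2 + Im h).
have aT : area_preserving T by exact: area_preserving_translate.
have [_ H] := aT.
rewrite -(H (fun p => (expR (Re (c * cpx p ^+ 2 + s * cpx p) - normc (cpx p) ^+ 2 / 2))%:E)); first last.
- by move=> p; rewrite lee_fin expR_ge0.
- by apply/measurable_EFinP; exact: measurable_gauss_half.
rewrite -ge0_integralZl//.
- apply: eq_integral => -[x y] _; rewrite -EFinM -expRD; congr (expR _)%:E.
  rewrite !normc_sqr /s /T /cpx; case: (h) => h1 h2.
  by rewrite !expr2 /= !mul0r !addr0; field.
- apply/measurable_EFinP; have := measurable_gauss_half 0.
  by under eq_fun do rewrite mul0r addr0.
Qed.

End Gaussian.

(** * Inner product, reproducing kernels and pointwise bounds *)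

Section FockSpace.
Context {R : realType}.
Local Notation area := (@Defs.area R).
Implicit Types f g : R[i] -> R[i].

(** [fock_ip] on bare functions, so that kernels and images of integral operators can be paired
    before they are known to be elements of [fock R]. *)
Definition fip f g : R[i] :=
  (pi^-1)%:C * cint area (fun p => f (cpx p) * (g (cpx p))^* * (wt p)%:C).

Lemma fock_ipE (f g : fock R) : fock_ip f g = fip f g.
Proof.
rewrite /fock_ip /fip; congr (_ * _); apply: eq_cint => p.
by rewrite cexp_wt.
Qed.

Lemma fock_in_fock (f : fock R) : in_fock f.
Proof. by case: f => f /= /asboolP. Qed.

Lemma fock_l2 (f : fock R) : l2 f.
Proof. by have /in_fockP[] := fock_in_fock f. Qed.

Lemma fock_entire (f : fock R) : entire f.
Proof. by have /in_fockP[] := fock_in_fock f. Qed.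

Lemma fock_ext (f g : fock R) : f =1 g -> f = g.
Proof. by move=> fg; apply/val_inj/funext. Qed.

Lemma fock_of f : in_fock f -> exists F : fock R, forall z, F z = f z.
Proof.
move=> ff; have P : f \in @fock_pred R by apply/asboolP.
by exists (Fock P).
Qed.

Lemma fipJ f g : l2 f -> l2 g -> fip g f = (fip f g)^*.
Proof.
move=> lf lg; rewrite /fip cJM cJR -cintJ; last exact: cintegrable_l2.
congr (_ * _); apply: eq_cint => p.
by rewrite !cJM cJK cJR [X in X * _]mulrC.
Qed.

Lemma fipZl k f g : l2 f -> l2 g -> fip (fun w => k * f w) g = k * fip f g.
Proof.
move=> lf lg; rewrite /fip [RHS]mulrCA; congr (_ * _); rewrite -cintZ; last exact: cintegrable_l2.
by apply: eq_cint => p; rewrite !mulrA.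
Qed.

Definition kern (z w : R[i]) : R[i] := cexp (z^* * w).

Lemma in_fock_kern z : in_fock (kern z).
Proof.
have -> : kern z = (fun w => cexp (0 * w ^+ 2 + z^* * w)).
  by apply/funext => w; rewrite mul0r add0r.
by apply: in_fock_quad; rewrite normc0 invr_gt0.
Qed.

Lemma l2_kern z : l2 (kern z).
Proof. by have /in_fockP[] := in_fock_kern z. Qed.

Lemma pi_neq0 : (pi : R) != 0. Proof. by rewrite gt_eqF// pi_gt0. Qed.

Lemma fip_kern f z : in_fock f -> fip f (kern z) = f z.
Proof.
move=> ff; rewrite /fip.
have -> : cint area (fun p => f (cpx p) * (kern z (cpx p))^* * (wt p)%:C) = pi%:C * f z.
  rewrite -reproducing//; apply: eq_cint => p.
  by rewrite /kern cexpJ cJM cJK mulrAC mulrC.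
by rewrite mulrA -rmorphM mulVf ?mul1r// pi_neq0.
Qed.

Lemma fip_ext (y y' : fock R) :
  (forall x : fock R, fock_ip x y = fock_ip x y') -> y = y'.
Proof.
move=> H; apply: fock_ext => z; have [K KE] := fock_of (in_fock_kern z).
have e : (K : R[i] -> R[i]) = kern z by apply/funext.
have := H K; rewrite !fock_ipE e !(fipJ (fock_l2 _) (l2_kern _)) !fip_kern; try exact: fock_in_fock.
by move=> /(congr1 (@conjc R)); rewrite !cJK.
Qed.

Definition nrm2 f : R := pi^-1 * \int[area]_p (normc (f (cpx p)) ^+ 2 * wt p).

Lemma nrm2_ge0 f : 0 <= nrm2 f.
Proof.
rewrite mulr_ge0 ?invr_ge0 ?pi_ge0//; apply: Rintegral_ge0 => p _.
by rewrite mulr_ge0 ?sqr_ge0 ?wt_ge0.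
Qed.

Lemma integrable_l2 f : l2 f ->
  area.-integrable setT (EFin \o (fun p => normc (f (cpx p)) ^+ 2 * wt p)).
Proof.
move=> [mf fy]; apply: integrable_lty_ge0 => //; first exact: measurable_l2.
by move=> p; rewrite mulr_ge0 ?sqr_ge0 ?wt_ge0.
Qed.

Lemma fock_sqnormE f : l2 f -> fock_sqnorm f = (nrm2 f)%:E.
Proof.
move=> lf; rewrite /nrm2 EFinM /Rintegral fineK//.
exact: (integrable_fin_num measurableT (integrable_l2 lf)).
Qed.

Lemma fock_normE f : l2 f -> fock_norm f = Num.sqrt (nrm2 f).
Proof. by move=> lf; rewrite /fock_norm fock_sqnormE. Qed.

Lemma fip_nrm2 f : fip f f = (nrm2 f)%:C.
Proof.
have -> : (nrm2 f)%:C = (pi^-1)%:C * (\int[area]_p (normc (f (cpx p)) ^+ 2 * wt p))%:C.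
  exact: rmorphM.
rewrite /fip -cintR; congr (_ * _); apply: eq_cint => p.
by rewrite mulcJ; apply/esym; exact: rmorphM.
Qed.

Lemma nrm2_kern z : nrm2 (kern z) = expR (normc z ^+ 2).
Proof.
apply: (@complexI R); rewrite -fip_nrm2 fip_kern; last exact: in_fock_kern.
by rewrite /kern mulrC mulcJ cexpR.
Qed.

(** An estimate of [fip f (kern z)]. A positive bound [N] in place of the norm permits division by
    it, and lets [N] tend to 0 in [nrm2_gt0]. *)
Lemma fock_pointwise f (N : R) z : in_fock f -> 0 < N -> nrm2 f <= N ^+ 2 ->
  normc (f z) <= 2 * N * expR (normc z ^+ 2 / 2).
Proof.
move=> ff N0 fN; have [_ lf] := (in_fockP f).1 ff; have lK := l2_kern z.
pose e := expR (normc z ^+ 2 / 2); have e0 : 0 < e by exact: expR_gt0.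
have ee : expR (normc z ^+ 2) = e ^+ 2 by rewrite [e ^+ 2]expr2 /e -expRD -splitr.
(* The weight that makes the two terms of [t/2 x^2 + y^2/(2 t)] equal when [x] has norm [N] and [y]
   has norm [e], the norm of the kernel. *)
pose t := e / N; have t0 : 0 < t by rewrite divr_gt0.
pose h (p : R * R) := t / 2 * (normc (f (cpx p)) ^+ 2 * wt p) + (2 * t)^-1 * (normc (kern z (cpx p)) ^+ 2 * wt p).
have iZ r g : l2 g -> area.-integrable setT (EFin \o (fun p => r * (normc (g (cpx p)) ^+ 2 * wt p))).
  by move=> lg; have := integrableZl measurableT r (integrable_l2 lg); apply: eq_integrable.
have ih : area.-integrable setT (EFin \o h).
  by have := integrableD measurableT (iZ (t / 2) _ lf) (iZ (2 * t)^-1 _ lK); apply: eq_integrable.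
have fh p : normc (f (cpx p) * (kern z (cpx p))^* * (wt p)%:C) <= h p.
  rewrite normc_wt normcM normc_conj /h (mulrA (t / 2)) (mulrA (2 * t)^-1) -mulrDl ler_wpM2r ?wt_ge0//.
  move: (normc (f (cpx p))) (normc (kern z (cpx p))) => x y.
  have : 0 <= (2 * t)^-1 * (t * x - y) ^+ 2 by rewrite mulr_ge0 ?sqr_ge0// invr_ge0 mulr_ge0// ltW.
  have -> : (2 * t)^-1 * (t * x - y) ^+ 2 = t / 2 * x ^+ 2 + (2 * t)^-1 * y ^+ 2 - x * y.
    by field; rewrite gt_eqF.
  by rewrite subr_ge0.
rewrite -(fip_kern z ff) /fip normcM normcR ger0_norm ?invr_ge0 ?pi_ge0//.
apply: (@le_trans _ _ (pi^-1 * (2 * \int[area]_p h p))).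
  rewrite ler_wpM2l ?invr_ge0 ?pi_ge0//.
  by apply: normc_cint_le => //; exact: cintegrable_l2.
rewrite /h RintegralD//; [|exact: iZ|exact: iZ].
rewrite !RintegralZl//; [|exact: integrable_l2|exact: integrable_l2].
have -> : pi^-1 * (2 * (t / 2 * \int[area]_p (normc (f (cpx p)) ^+ 2 * wt p) +
   (2 * t)^-1 * \int[area]_p (normc (kern z (cpx p)) ^+ 2 * wt p))) =
   t * nrm2 f + t^-1 * nrm2 (kern z).
  have aux (a u x y : R) : a != 0 -> u != 0 ->
      a^-1 * (2 * (u / 2 * x + (2 * u)^-1 * y)) = u * (a^-1 * x) + u^-1 * (a^-1 * y).
    by move=> a0 u0; field; rewrite a0 u0.
  by apply: aux; [exact: pi_neq0|rewrite gt_eqF].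
rewrite nrm2_kern ee -/e.
apply: (@le_trans _ _ (t * N ^+ 2 + t^-1 * e ^+ 2)); first by rewrite lerD2r ler_wpM2l// ltW.
have -> : t * N ^+ 2 + t^-1 * e ^+ 2 = 2 * N * e by rewrite /t; field; rewrite !gt_eqF.
by [].
Qed.

Lemma nrm2_gt0 f z : in_fock f -> f z != 0 -> 0 < nrm2 f.
Proof.
move=> ff fz; rewrite lt_neqAle nrm2_ge0 andbT eq_sym; apply: contra_neq fz => f0.
apply: eq0_normc; apply/eqP; rewrite -normr_le0 ger0_norm ?normc_ge0//.
apply/ler_addgt0Pr => e e0; rewrite add0r.
pose x := expR (normc z ^+ 2 / 2); have x0 : 0 < x by exact: expR_gt0.
have N0 : 0 < e / (2 * x) by rewrite divr_gt0// mulr_gt0.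
have := fock_pointwise z ff N0; rewrite f0 sqr_ge0 -/x => /(_ isT).
by rewrite (_ : 2 * _ * _ = e)//; field; rewrite gt_eqF.
Qed.

End FockSpace.

(** * Symmetric integral operators *)

Section SymmetricKernel.
Context {R : realType}.
Local Notation T2 := (measurableTypeR R * measurableTypeR R)%type.
Local Notation area := (@Defs.area R).

Definition hw (p : R * R) : R := expR (- (normc (cpx p) ^+ 2 / 2)).

Lemma hw_ge0 p : 0 <= hw p. Proof. exact: expR_ge0. Qed.

Lemma hwM p : hw p * hw p = wt p.
Proof. by rewrite /hw -expRD -opprD -splitr. Qed.

Lemma measurable_hw : measurable_fun setT (hw : T2 -> R).
Proof.
apply: measurableT_comp => //; apply: measurableT_comp => //; apply: measurable_funM => //.
by apply: measurable_funX; exact: (measurable_cmeas_normc cmeas_cpx).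
Qed.

Variables (H : R[i] -> R[i] -> R[i]) (M : R).
Hypothesis Hsym : forall z w, H z w = H w z.
Hypothesis Hl2 : forall z, l2 (H z).
Hypothesis Hm : cmeas (fun x : T2 * T2 => H (cpx x.1) (cpx x.2)).
Hypothesis M_gt0 : 0 < M.

(* Conjugating by [hw] removes the weight [wt], so that Schur's test applies
   with constant test functions. *)
Definition nkern (p q : R * R) : R := normc (H (cpx p) (cpx q)) * hw p * hw q.

Hypothesis schur : forall p : T2, (\int[area]_q (nkern p q)%:E <= M%:E)%E.

Let nkern_ge0 p q : 0 <= nkern p q.
Proof. by rewrite /nkern !mulr_ge0 ?normc_ge0 ?hw_ge0. Qed.

Let nkernC p q : nkern p q = nkern q p.
Proof. by rewrite /nkern Hsym mulrAC. Qed.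

Let measurable_nkern : measurable_fun setT (fun x : T2 * T2 => nkern x.1 x.2).
Proof.
apply: measurable_funM; last exact: (measurableT_comp measurable_hw measurable_snd).
apply: measurable_funM; last exact: (measurableT_comp measurable_hw measurable_fst).
exact: measurable_cmeas_normc.
Qed.

Let measurable_nkern1 p : measurable_fun setT (fun q : T2 => nkern p q).
Proof. exact: (measurable_fun_pair2 p measurable_nkern). Qed.

Let schur1 (F : T2 -> R) : measurable_fun setT F -> (forall p, 0 <= F p) ->
  (\int[area]_p \int[area]_q (nkern p q * F p)%:E <= M%:E * \int[area]_p (F p)%:E)%E.
Proof.
move=> mF F0; rewrite -ge0_integralZl//; last 3 first.
- exact/measurable_EFinP.
- by move=> p _; rewrite lee_fin.
- by rewrite lee_fin ltW.
have mNF : measurable_fun setT (fun x : T2 * T2 => (nkern x.1 x.2 * F x.1)%:E).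
  apply/measurable_EFinP; apply: measurable_funM => //.
  exact: (measurableT_comp mF measurable_fst).
apply: ge0_le_integral => //.
- by move=> p _; apply: integral_ge0 => q _; rewrite lee_fin mulr_ge0.
- apply: (measurable_fun_fubini_tonelli_F (m2 := area) (fun x : T2 * T2 => (nkern x.1 x.2 * F x.1)%:E)) => //.
  by move=> x; rewrite lee_fin mulr_ge0.
- by apply: measurable_funeM; exact/measurable_EFinP.
- move=> p _; under eq_integral do rewrite EFinM.
  rewrite ge0_integralZr//; [by rewrite lee_wpmul2r ?lee_fin|exact/measurable_EFinP| |].
  - by move=> q _; rewrite lee_fin.
  - by rewrite lee_fin.
Qed.

Let schur2 (F : T2 -> R) : measurable_fun setT F -> (forall p, 0 <= F p) ->
  (\int[area]_p \int[area]_q (nkern p q * F q)%:E <= M%:E * \int[area]_p (F p)%:E)%E.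
Proof.
move=> mF F0; have := schur1 mF F0.
suff -> : (\int[area]_p \int[area]_q (nkern p q * F p)%:E =
           \int[area]_p \int[area]_q (nkern p q * F q)%:E)%E by [].
transitivity (\int[area]_q \int[area]_p (nkern p q * F p)%:E)%E.
  apply: (@fubini_tonelli _ _ _ _ _ area area (fun x : T2 * T2 => (nkern x.1 x.2 * F x.1)%:E)).
    apply/measurable_EFinP; apply: measurable_funM => //.
    exact: (measurableT_comp mF measurable_fst).
  by move=> x; rewrite lee_fin mulr_ge0.
by apply: eq_integral => p _; under eq_integral do rewrite nkernC.
Qed.

(** [F p * G q <= F p ^+ 2 + G q ^+ 2] splits the double integral into one part for each form of the
    Schur bound. *)
Let schur_lty (F G : T2 -> R) : measurable_fun setT F -> (forall p, 0 <= F p) ->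
  measurable_fun setT G -> (forall p, 0 <= G p) ->
  (\int[area]_p (F p ^+ 2)%:E < +oo)%E -> (\int[area]_p (G p ^+ 2)%:E < +oo)%E ->
  (\int[area]_p \int[area]_q (nkern p q * (F p * G q))%:E < +oo)%E.
Proof.
move=> mF F0 mG G0 Fy Gy.
have mF2 : measurable_fun setT (fun p => F p ^+ 2) by exact: measurable_funX.
have mG2 : measurable_fun setT (fun p => G p ^+ 2) by exact: measurable_funX.
have s1 := schur1 mF2 (fun p => sqr_ge0 (F p)).
have s2 := schur2 mG2 (fun p => sqr_ge0 (G p)).
have m1 : measurable_fun setT (fun x : T2 * T2 => F x.1) by exact: (measurableT_comp mF measurable_fst).
have m2 : measurable_fun setT (fun x : T2 * T2 => G x.2) by exact: (measurableT_comp mG measurable_snd).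
have ms (u : T2 * T2 -> R) : measurable_fun setT u -> (forall x, 0 <= u x) ->
    (\int[area]_p \int[area]_q (u (p, q))%:E = \int[(area \x area)%E]_x (u x)%:E)%E.
  move=> mu u0; rewrite (fubini_tonelli1 (fun x => (u x)%:E))//; exact/measurable_EFinP.
have mA : measurable_fun setT (fun x : T2 * T2 => nkern x.1 x.2 * F x.1 ^+ 2).
  by apply: measurable_funM => //; exact: measurable_funX.
have mB : measurable_fun setT (fun x : T2 * T2 => nkern x.1 x.2 * G x.2 ^+ 2).
  by apply: measurable_funM => //; exact: measurable_funX.
have A0 (x : T2 * T2) : 0 <= nkern x.1 x.2 * F x.1 ^+ 2 by rewrite mulr_ge0 ?sqr_ge0.
have B0 (x : T2 * T2) : 0 <= nkern x.1 x.2 * G x.2 ^+ 2 by rewrite mulr_ge0 ?sqr_ge0.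
rewrite (ms (fun x => nkern x.1 x.2 * (F x.1 * G x.2))).
- apply: (integral_ltyW (k := fun x : T2 * T2 => nkern x.1 x.2 * F x.1 ^+ 2 + nkern x.1 x.2 * G x.2 ^+ 2)).
  + by apply: measurable_funM => //; exact: measurable_funM.
  + exact: measurable_funD.
  + move=> x; apply/andP; split; first by apply: mulr_ge0 => //; exact: mulr_ge0.
    rewrite -mulrDr ler_wpM2l//.
    by have := sqr_ge0 (F x.1 - G x.2); have := F0 x.1; have := G0 x.2; nra.
  + apply: integral_ltyD => //.
    * rewrite -(ms (fun x => nkern x.1 x.2 * F x.1 ^+ 2))//; apply: le_lt_trans s1 _.
      by rewrite lte_mul_pinfty ?lee_fin ?ltW.
    * rewrite -(ms (fun x => nkern x.1 x.2 * G x.2 ^+ 2))//; apply: le_lt_trans s2 _.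
      by rewrite lte_mul_pinfty ?lee_fin ?ltW.
- by apply: measurable_funM => //; exact: measurable_funM.
- by move=> x; apply: mulr_ge0 => //; exact: mulr_ge0.
Qed.

(** The function stands in the second slot of [fip], so the operator is antilinear, as a conjugation
    must be. *)
Definition hop (f : R[i] -> R[i]) (z : R[i]) : R[i] := fip (H z) f.

(** Both sides are the double integral of [H] against the conjugates of [f] and [g], with the roles
    of the variables exchanged. The symmetry of [H] and Fubini identify them; [schur_lty] gives
    absolute convergence. *)
Lemma hop_sym f g : l2 f -> l2 g -> fip (hop f) g = fip (hop g) f.
Proof.
move=> lf lg.
pose K (f g : R[i] -> R[i]) (x : T2 * T2) :=
  ((pi^-1)%:C * ((g (cpx x.1))^* * (wt x.1)%:C)) *
  (H (cpx x.1) (cpx x.2) * (f (cpx x.2))^* * (wt x.2)%:C).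
have ch f' p : l2 f' -> cintegrable area (fun q => H (cpx p) (cpx q) * (f' (cpx q))^* * (wt q)%:C).
  by move=> lf'; exact: (cintegrable_l2 (Hl2 (cpx p)) lf').
have iK f' g' p : l2 f' -> cintegrable area (fun q => K f' g' (p, q)).
  move=> lf'; rewrite /K.
  exact: (cintegrableZ ((pi^-1)%:C * ((g' (cpx p))^* * (wt p)%:C)) (ch f' p lf')).
have KC f' g' p q : K f' g' (p, q) = K g' f' (q, p).
  have aux (r a b d e h : R[i]) : r * (a * b) * (h * d * e) = r * (d * e) * (h * a * b) by ring.
  by rewrite /K /= Hsym; exact: aux.
have mf : measurable_fun setT (fun p : T2 => normc (f (cpx p)) * hw p).
  by apply: measurable_funM; [apply: measurable_cmeas_normc; case: lf|exact: measurable_hw].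
have mg : measurable_fun setT (fun p : T2 => normc (g (cpx p)) * hw p).
  by apply: measurable_funM; [apply: measurable_cmeas_normc; case: lg|exact: measurable_hw].
have sq f' : l2 f' -> (\int[area]_p ((normc (f' (cpx p)) * hw p) ^+ 2)%:E < +oo)%E.
  by move=> [_]; under [X in _ -> (X < _)%E]eq_integral do rewrite exprMn [hw _ ^+ 2]expr2 hwM.
have F : cint area (fun p => cint area (fun q => K f g (p, q))) =
         cint area (fun q => cint area (fun p => K f g (p, q))).
  apply: cint_Fubini.
  - have mfst : measurable_fun setT (fst : T2 * T2 -> T2) by exact: measurable_fst.
    have msnd : measurable_fun setT (snd : T2 * T2 -> T2) by exact: measurable_snd.
    apply: cmeasM.
      apply: cmeasM; first exact: cmeas_cst.
      apply: cmeasM; last exact: (cmeas_comp mfst cmeas_wt).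
      by apply: cmeasJ; case: lg => mg' _; exact: (cmeas_comp mfst mg').
    apply: cmeasM; last exact: (cmeas_comp msnd cmeas_wt).
    by apply: cmeasM => //; apply: cmeasJ; case: lf => mf' _; exact: (cmeas_comp msnd mf').
  - have G0 (f' : R[i] -> R[i]) (p : T2) : 0 <= normc (f' (cpx p)) * hw p.
      by rewrite mulr_ge0 ?normc_ge0 ?hw_ge0.
    have := schur_lty mg (G0 g) mf (G0 f) (sq g lg) (sq f lf).
    have nK p q : normc (K f g (p, q)) = pi^-1 *
        (nkern p q * ((normc (g (cpx p)) * hw p) * (normc (f (cpx q)) * hw q))).
      rewrite /K /nkern !normcM !normc_conj !normcR !(ger0_norm (wt_ge0 _)) -!hwM.
      rewrite ger0_norm ?invr_ge0 ?pi_ge0//=; ring.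
    under [X in _ -> (X < _)%E]eq_integral => p _.
      under eq_integral do rewrite nK EFinM.
      rewrite ge0_integralZl//; last 3 first.
      + apply/measurable_EFinP; apply: measurable_funM => //; apply: measurable_funM => //.
      + by move=> q _; rewrite lee_fin !mulr_ge0 ?normc_ge0 ?hw_ge0.
      + by rewrite lee_fin invr_ge0 pi_ge0.
      over.
    move=> Fy; rewrite ge0_integralZl//; last 3 first.
    + apply: (measurable_fun_fubini_tonelli_F (m2 := area) (fun x : T2 * T2 =>
        (nkern x.1 x.2 * (normc (g (cpx x.1)) * hw x.1 * (normc (f (cpx x.2)) * hw x.2)))%:E)).
        apply/measurable_EFinP; apply: measurable_funM => //; apply: measurable_funM.
          exact: (measurableT_comp mg measurable_fst).
        exact: (measurableT_comp mf measurable_snd).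
      by move=> x; rewrite lee_fin !mulr_ge0 ?normc_ge0 ?hw_ge0.
    + by move=> p _; apply: integral_ge0 => q _; rewrite lee_fin !mulr_ge0 ?normc_ge0 ?hw_ge0.
    + by rewrite lee_fin invr_ge0 pi_ge0.
    by rewrite lte_mul_pinfty ?lee_fin ?invr_ge0 ?pi_ge0.
  - by move=> p; exact: iK.
  - by move=> q; under eq_fun do rewrite KC; exact: iK.
have fipK f' g' : l2 f' -> fip (hop f') g' =
    (pi^-1)%:C * cint area (fun p => cint area (fun q => K f' g' (p, q))).
  move=> lf'; rewrite [LHS]/fip; congr (_ * _); apply: eq_cint => p.
  rewrite /K /= cintZ; last exact: ch.
  have aux (r e a b : R[i]) : r * e * a * b = r * (a * b) * e by ring.
  exact: aux.
have e : cint area (fun q => cint area (fun p => K f g (p, q))) =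
         cint area (fun q => cint area (fun p => K g f (q, p))).
  by apply: eq_cint => q; apply: eq_cint => p; exact: KC.
apply: (etrans (fipK f g lf)); apply: (etrans _ (esym (fipK g f lg))).
by apply: (congr1 (fun x => (pi^-1)%:C * x)); exact: (etrans F e).
Qed.

(** Schur's test: the bound on a row gives [key] pointwise, and the bound on a column, equal to it
    by symmetry, controls the integral of [X]. *)
Lemma l2_hop f : l2 f -> cmeas (fun p : T2 => hop f (cpx p)) -> l2 (hop f).
Proof.
move=> lf mh; split=> //.
pose F (p : T2) : R := normc (f (cpx p)) * hw p.
have F0 p : 0 <= F p by rewrite mulr_ge0 ?normc_ge0 ?hw_ge0.
have mF : measurable_fun setT F.
  by apply: measurable_funM; [apply: measurable_cmeas_normc; case: lf|exact: measurable_hw].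
have mF2 : measurable_fun setT (fun p => F p ^+ 2) by exact: measurable_funX.
have F2y : (\int[area]_p (F p ^+ 2)%:E < +oo)%E.
  by case: lf => _; under [X in _ -> (X < _)%E]eq_integral do rewrite exprMn [hw _ ^+ 2]expr2 hwM.
pose X p : \bar R := (\int[area]_q (nkern p q * F q ^+ 2)%:E)%E.
have X0 p : (0 <= X p)%E by apply: integral_ge0 => q _; rewrite lee_fin mulr_ge0 ?sqr_ge0.
have mX : measurable_fun setT X.
  apply: (measurable_fun_fubini_tonelli_F (m2 := area) (fun x : T2 * T2 => (nkern x.1 x.2 * F x.2 ^+ 2)%:E)).
    apply/measurable_EFinP; apply: measurable_funM => //.
    exact: (measurableT_comp mF2 measurable_snd).
  by move=> x; rewrite lee_fin mulr_ge0 ?sqr_ge0.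
have key (p : T2) : ((normc (hop f (cpx p)) ^+ 2 * wt p)%:E <= M%:E * X p)%E.
  pose I := normc (hop f (cpx p)) * hw p.
  have I0 : 0 <= I by rewrite mulr_ge0 ?normc_ge0 ?hw_ge0.
  have -> : normc (hop f (cpx p)) ^+ 2 * wt p = I ^+ 2 by rewrite -hwM /I exprMn [hw p ^+ 2]expr2.
  have [->|I_neq0] := eqVneq I 0.
    by rewrite expr0n /=; apply: mule_ge0 => //; rewrite lee_fin ltW.
  have {I_neq0}Ip : 0 < I by rewrite lt_neqAle eq_sym I_neq0.
  have := X0 p; case E : (X p) => [x| |] //; last first.
    by move=> _; rewrite gt0_muley ?leey ?lte_fin.
  rewrite lee_fin => x0.
  (* With this [t], the inequality [2 * t * I <= t ^+ 2 * M + x] becomes [I ^+ 2 <= M * x]. *)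
  pose t := I / M; have t0 : 0 < t by rewrite divr_gt0.
  pose h (q : T2) := t / 2 * nkern p q + (2 * t)^-1 * (nkern p q * F q ^+ 2).
  have iN : area.-integrable setT (EFin \o (fun q => nkern p q)).
    by apply: integrable_lty_ge0 => //; apply: le_lt_trans (schur p) _; rewrite ltry.
  have iNF : area.-integrable setT (EFin \o (fun q => nkern p q * F q ^+ 2)).
    apply: integrable_lty_ge0 => //.
    - exact: measurable_funM.
    - by move=> q; rewrite mulr_ge0 ?sqr_ge0.
    - by rewrite -/(X p) E ltry.
  have iZ r (u : T2 -> R) : area.-integrable setT (EFin \o u) ->
      area.-integrable setT (EFin \o (fun q => r * u q)).
    by move=> iu; have := integrableZl measurableT r iu; apply: eq_integrable.
  have ih : area.-integrable setT (EFin \o h).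
    by have := integrableD measurableT (iZ (t / 2) _ iN) (iZ (2 * t)^-1 _ iNF); apply: eq_integrable.
  have ch := cintegrableZ (hw p)%:C (cintegrable_l2 (Hl2 (cpx p)) lf).
  have Ile : I <= pi^-1 * (2 * \int[area]_q h q).
    have -> : I = pi^-1 * normc (cint area (fun q => (hw p)%:C *
        (H (cpx p) (cpx q) * (f (cpx q))^* * (wt q)%:C))).
      rewrite cintZ; last exact: (cintegrable_l2 (Hl2 (cpx p)) lf).
      rewrite /I /hop /fip !normcM !normcR (ger0_norm (hw_ge0 p)) ger0_norm ?invr_ge0 ?pi_ge0//.
      by rewrite mulrC mulrCA.
    rewrite ler_wpM2l ?invr_ge0 ?pi_ge0//; apply: normc_cint_le => // q.
    rewrite !normcM normc_conj !normcR (ger0_norm (hw_ge0 p)) (ger0_norm (wt_ge0 q)).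
    rewrite (_ : hw p * _ = nkern p q * F q); last by rewrite /nkern /F -hwM; ring.
    have -> : h q = nkern p q * (t / 2 + (2 * t)^-1 * F q ^+ 2) by rewrite /h; ring.
    rewrite ler_wpM2l//; move: (F q) => y.
    have : 0 <= (2 * t)^-1 * (t - y) ^+ 2 by rewrite mulr_ge0 ?sqr_ge0// invr_ge0 mulr_ge0// ltW.
    have -> : (2 * t)^-1 * (t - y) ^+ 2 = t / 2 + (2 * t)^-1 * y ^+ 2 - y.
      by field; rewrite gt_eqF.
    by rewrite subr_ge0.
  have Nle : \int[area]_q nkern p q <= M.
    have fN := integrable_fin_num measurableT iN.
    by rewrite -lee_fin /Rintegral fineK.
  have NFx : \int[area]_q (nkern p q * F q ^+ 2) = x by rewrite /Rintegral -/(X p) E.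
  rewrite /h RintegralD// in Ile; [|exact: iZ|exact: iZ].
  rewrite !RintegralZl// NFx in Ile.
  (* The normalisation by [pi] outweighs the factor 2 of [normc_cint_le]. *)
  have p1 : pi^-1 <= 2^-1 :> R by rewrite lef_pV2 ?posrE ?pi_gt0// pi_ge2.
  have S0 : 0 <= 2 * (t / 2 * \int[area]_q nkern p q + (2 * t)^-1 * x).
    have t00 := ltW t0; apply: mulr_ge0 => //; apply: addr_ge0; apply: mulr_ge0 => //.
    - exact: divr_ge0.
    - by apply: Rintegral_ge0.
    - by rewrite invr_ge0; exact: mulr_ge0.
  have Ile2 : I <= 2^-1 * (2 * (t / 2 * M + (2 * t)^-1 * x)).
    apply: le_trans Ile _; apply: ler_pM => //; first by rewrite invr_ge0 pi_ge0.
    rewrite ler_wpM2l// lerD2r ler_wpM2l//.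
    by rewrite divr_ge0// ltW.
  have : 2 * t * I <= t ^+ 2 * M + x.
    have := ler_wpM2l (ltW (mulr_gt0 (@ltr0Sn R 1) t0)) Ile2.
    rewrite (_ : 2 * t * (2^-1 * _) = t ^+ 2 * M + x) //.
    by field; rewrite gt_eqF.
  rewrite /t -EFinM lee_fin.
  have -> : 2 * (I / M) * I = 2 * (I ^+ 2 / M) by rewrite expr2; ring.
  have -> : (I / M) ^+ 2 * M = I ^+ 2 / M by field; rewrite gt_eqF.
  by move=> ?; rewrite -ler_pdivrMl// mulrC; lra.
apply: (@le_lt_trans _ _ (\int[area]_p (M%:E * X p))%E).
  apply: ge0_le_integral => //.
  - by move=> p _; rewrite lee_fin mulr_ge0 ?sqr_ge0 ?wt_ge0.
  - by apply/measurable_EFinP; exact: measurable_l2.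
  - exact: measurable_funeM.
rewrite ge0_integralZl//; last by rewrite lee_fin ltW.
rewrite lte_mul_pinfty ?lee_fin ?(ltW M_gt0)//.
apply: le_lt_trans (schur2 mF2 (fun p => sqr_ge0 (F p))) _.
by rewrite lte_mul_pinfty ?lee_fin ?(ltW M_gt0).
Qed.

End SymmetricKernel.

(** * The Gaussian kernel of the conjugation *)

Section GaussianConjugation.
Context {R : realType}.
Local Notation T2 := (measurableTypeR R * measurableTypeR R)%type.
Local Notation area := (@Defs.area R).

Lemma l2Z (k : R[i]) f : l2 f -> l2 (fun w => k * f w).
Proof.
move=> [mf fy]; split; first by apply: cmeasM => //; exact: cmeas_cst.
under eq_integral do rewrite normcM exprMn -mulrA.
apply: integral_ltyZ => //; [exact: measurable_l2| |exact: sqr_ge0].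
by move=> p; rewrite mulr_ge0 ?sqr_ge0 ?wt_ge0.
Qed.

Variables (cc : R) (b : R[i]).
Hypothesis cc12 : `|cc| < 2^-1.
Local Notation c := (cc%:C : R[i]).
Local Notation D := (1 - 4 * c ^+ 2).
Local Notation q := (gquad cc b).

Definition qscale : R := (Num.sqrt (nrm2 q))^-1.
Local Notation n := qscale.

(* the kernel of [J] for [r = rho], and that of [W J] for [r = rho * a] *)
Definition qkern (r z w : R[i]) : R[i] := n%:C * q z * gquad cc (b + r * z) w.

Let q_gt0 : 0 < nrm2 q.
Proof.
apply: (@nrm2_gt0 _ _ 0); first exact: in_fock_quad_fun.
by rewrite /gquad expr0n /= !mulr0 addr0 cexp0 oner_neq0.
Qed.

Let D_neq0 : D != 0.
Proof.
have -> : D = (1 - 4 * cc ^+ 2)%:C by rewrite rmorphB rmorphM rmorphXn rmorph_nat.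
rewrite (inj_eq (@complexI R)) gt_eqF//.
by move: cc12; rewrite ltr_norml => /andP[h1 h2]; nra.
Qed.

Let n_gt0 : 0 < n. Proof. by rewrite /qscale invr_gt0 sqrtr_gt0. Qed.

Let n2 : n ^+ 2 * nrm2 q = 1.
Proof. by rewrite /qscale exprVn sqr_sqrtr ?mulVf ?gt_eqF// nrm2_ge0. Qed.

Lemma qkern_sym r z w : qkern r z w = qkern r w z.
Proof.
have aux (m x y e e' : R[i]) : e = e' -> m * x * (e * y) = m * y * (e' * x).
  by move=> ->; ring.
by rewrite /qkern !gquadD; apply: aux; congr cexp; ring.
Qed.

Lemma l2_qkern r z : l2 (qkern r z).
Proof. exact: (l2Z (n%:C * q z) (l2_quad cc12 (b + r * z))). Qed.

Lemma cmeas_qkern r : cmeas (fun x : T2 * T2 => qkern r (cpx x.1) (cpx x.2)).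
Proof.
have mfst : measurable_fun setT (fst : T2 * T2 -> T2) by exact: measurable_fst.
have msnd : measurable_fun setT (snd : T2 * T2 -> T2) by exact: measurable_snd.
have m1 := cmeas_comp mfst (@cmeas_cpx R).
have m2 := cmeas_comp msnd (@cmeas_cpx R).
have cm (f g : T2 * T2 -> R[i]) : cmeas f -> cmeas g ->
    cmeas (fun x => cexp (cc%:C * f x ^+ 2 + g x * f x)).
  move=> mf mg; apply: cmeas_cexp; apply: cmeasD; last exact: cmeasM.
  by apply: cmeasM; [exact: cmeas_cst|exact: cmeasX].
apply: cmeasM.
  by apply: cmeasM; [exact: cmeas_cst|apply: cm => //; exact: cmeas_cst].
apply: cm => //; apply: cmeasD; first exact: cmeas_cst.
by apply: cmeasM => //; exact: cmeas_cst.
Qed.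

(** The variable [z] enters the integral only through the parameter [s = b + r * z], in which it is
    entire by [cderiv_ip]. *)
Lemma entire_hop_qkern r f : l2 f -> entire (hop (qkern r) f).
Proof.
move=> lf.
have -> : hop (qkern r) f = fun z => (n%:C * q z) * ((pi^-1)%:C *
    cint area (fun p => gquad cc (b + r * z) (cpx p) * (f (cpx p))^* * (wt p)%:C)).
  apply/funext => z; rewrite /hop.
  exact: (fipZl (n%:C * q z) (l2_quad cc12 (b + r * z)) lf).
have e1 : entire (fun z => n%:C * q z) by exact: (@entireM R (fun=> n%:C) q (@entire_cst R n%:C) (@entire_quad_fun R cc b)).
have eI : entire (fun s => cint area (fun p => gquad cc s (cpx p) * (f (cpx p))^* * (wt p)%:C)).
  by apply/entireP => s; eexists; exact: (cderiv_ip cc12 s lf).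
have e2 : entire (fun z => b + r * z) by exact: (entireD (@entire_cst R b) (entireM (@entire_cst R r) (@entire_id R))).
have e3 := entire_comp eI e2.
have e4 := entireM (@entire_cst R (pi^-1)%:C) e3.
exact: (entireM e1 e4).
Qed.

Variable rho : R[i].
(** In the exponent of [hop_qkern], these three relations make the coefficients match at the product
    of [z] and [w^*], at [z], and at [z ^+ 2]; their conjugates serve the powers of [w^*]. *)
Hypothesis rhoN : rho * rho^* = D.
Hypothesis rhoL : rho * (b^* + 2 * c * b) = - b * D.
Hypothesis rho2 : c * rho ^+ 2 = - c * D.

Let rhoLJ : rho^* * (b + 2 * c * b^*) = - b^* * D.
Proof. by have := congr1 (@conjc R) rhoL; rewrite !cJE. Qed.

Let rho2J : c * rho^* ^+ 2 = - c * D.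
Proof. by have := congr1 (@conjc R) rho2; rewrite !cJE. Qed.

Lemma hop_qkern w z : hop (qkern rho) (qkern rho w) z = kern w z.
Proof.
have l s := l2_quad cc12 s.
have qq : (pi^-1)%:C * quad_ip cc b b = (nrm2 q)%:C by rewrite -fip_nrm2.
have -> : hop (qkern rho) (qkern rho w) z = (n ^+ 2)%:C * (q z * (q w)^* *
    ((pi^-1)%:C * quad_ip cc (b + rho * z) (b + rho * w))).
  have aux (m x y e : R[i]) : m * x * (m * y * e) = m ^+ 2 * (x * y * e) by ring.
  have -> : (n ^+ 2)%:C = n%:C ^+ 2 :> R[i] by exact: rmorphXn.
  rewrite -aux.
  have E1 := fipZl (n%:C * q z) (l (b + rho * z)) (l2_qkern rho w).
  have E2 := fipJ (l2_qkern rho w) (l (b + rho * z)).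
  have E3 := fipZl (n%:C * q w) (l (b + rho * w)) (l (b + rho * z)).
  have E4 := fipJ (l (b + rho * z)) (l (b + rho * w)).
  rewrite /hop; apply: (etrans E1); congr (_ * _).
  apply: (etrans E2); apply: (etrans (congr1 (@conjc R) E3)).
  rewrite cJM E4 cJK !cJM cJR.
  by congr (_ * _).
have g0 := gaussian_ip cc12 b b.
have g1 := gaussian_ip cc12 (b + rho * z) (b + rho * w).
have nn : (n ^+ 2)%:C * (nrm2 q)%:C = 1 :> R[i].
  by apply: (etrans (esym (rmorphM (real_complex R) (n ^+ 2) (nrm2 q)))); rewrite n2.
have key : q z * (q w)^* * cexp (quad_exponent cc (b + rho * z) (b + rho * w)) =
    kern w z * cexp (quad_exponent cc b b).
  rewrite /kern /gquad cexpJ -!cexpD; congr cexp; apply: (mulIf D_neq0).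
  rewrite [LHS]mulrDl [RHS]mulrDl /quad_exponent !divfK// !cJE.
  (* Conjugates become independent indeterminates; the difference of the exponents is then a
     polynomial combination of the relations on [rho]. *)
  move: rhoLJ rho2J; move: (b^*) (rho^*) (z^*) (w^*) rhoN rhoL => b' r' z' w' h1 h2 h3 h4.
  apply/eqP; rewrite -subr_eq0; apply/eqP.
  have -> : (c * z ^+ 2 + b * z + (c * w' ^+ 2 + b' * w')) * D +
    ((b + rho * z) * (b' + r' * w') + c * (b + rho * z) ^+ 2 + c * (b' + r' * w') ^+ 2) -
    (w' * z * D + (b * b' + c * b ^+ 2 + c * b' ^+ 2)) =
    z ^+ 2 * (c * D + c * rho ^+ 2) + w' ^+ 2 * (c * D + c * r' ^+ 2) +
    z * (b * D + rho * (b' + 2 * c * b)) + w' * (b' * D + r' * (b + 2 * c * b')) +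
    z * w' * (rho * r' - D) by ring.
  by rewrite h1 h2 h3 h4 rho2; ring.
have aux (m p i e x y s k Q0 Q1 N : R[i]) : p * Q0 = N -> Q0 = i * e -> Q1 = i * s ->
    m * N = 1 -> x * y * s = k * e -> m * (x * y * (p * Q1)) = k.
  move=> <- -> -> h1 h2.
  have -> : m * (x * y * (p * (i * s))) = m * (p * (i * (x * y * s))) by ring.
  rewrite h2; have -> : m * (p * (i * (k * e))) = m * (p * (i * e)) * k by ring.
  by rewrite h1 mul1r.
exact: (aux _ _ _ _ _ _ _ _ _ _ _ qq g0 g1 nn key).
Qed.

(** The value of the Schur integral at the base point 0; the added 1 makes positivity immediate. *)
Definition schur_const : R := n * expR (Re (b * ((b^* + 2 * c * b) / D)) / 2) *
  fine (\int[area]_p (expR (Re (c * cpx p ^+ 2) - normc (cpx p) ^+ 2 / 2))%:E) + 1.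

Lemma schur_const_gt0 : 0 < schur_const.
Proof.
rewrite /schur_const ltr_wpDl// mulr_ge0//; first by rewrite mulr_ge0 ?expR_ge0 ?(ltW n_gt0).
by rewrite fine_ge0// integral_ge0// => p _; rewrite lee_fin expR_ge0.
Qed.

(** [gauss_half_shift] evaluates the integral exactly. Its dependence on [z] is an exponential whose
    exponent is constant, again by the relations on [rho], so every row has the same integral as the
    row at 0. *)
Lemma schur_qkern (p : T2) : (\int[area]_p' (nkern (qkern rho) p p')%:E <= schur_const%:E)%E.
Proof.
pose z := cpx p; pose s := b + rho * z; pose h := (s^* + 2 * c * s) / D.
have DJ : D^* = D by rewrite !cJE.
have sE : h^* - 2 * c * h = s.
  have hD : h * D = s^* + 2 * c * s by rewrite /h divfK.
  have hD' : h^* * D = s + 2 * c * s^*.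
    by have := congr1 (@conjc R) hD; rewrite cJM DJ => ->; rewrite !cJE.
  apply: (mulIf D_neq0); rewrite mulrBl hD' -(mulrA (2 * c)) hD; move: (s^*) => s'; ring.
have E (p' : T2) : nkern (qkern rho) p p' = n * expR (Re (c * z ^+ 2 + b * z) - normc z ^+ 2 / 2) *
    expR (Re (c * cpx p' ^+ 2 + s * cpx p') - normc (cpx p') ^+ 2 / 2).
  have aux (x y : R[i]) (m t' t'' : R) : 0 <= m ->
      normc (m%:C * cexp x * cexp y) * expR t' * expR t'' =
      m * expR (Re x + t') * expR (Re y + t'').
    by move=> m0; rewrite 2!normcM 2!normc_cexp normcR ger0_norm// !expRD; ring.
  exact: (aux (c * z ^+ 2 + b * z) (c * cpx p' ^+ 2 + s * cpx p') n _ _ (ltW n_gt0)).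
have lM := gauss_half_lty cc12.
have M0 : (0 <= \int[area]_p (expR (Re (c * cpx p ^+ 2) - normc (cpx p) ^+ 2 / 2))%:E)%E.
  by apply: integral_ge0 => x _; rewrite lee_fin expR_ge0.
under eq_integral do rewrite E EFinM.
rewrite ge0_integralZl//; last 2 first.
- by apply/measurable_EFinP; exact: measurable_gauss_half.
- by rewrite lee_fin mulr_ge0 ?expR_ge0 ?(ltW n_gt0).
have G := gauss_half_shift cc h; rewrite /= sE in G; rewrite G muleA -EFinM.
have -> : n * expR (Re (c * z ^+ 2 + b * z) - normc z ^+ 2 / 2) * expR (Re (s * h) / 2) =
   n * expR (Re (b * ((b^* + 2 * c * b) / D)) / 2).
  rewrite -mulrA -expRD; congr (_ * expR _).
  suff X : Re (c * z ^+ 2 + b * z) *+ 2 - normc z ^+ 2 + Re (s * h) =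
      Re (b * ((b^* + 2 * c * b) / D)).
    by rewrite -X mulr2n; field.
  have zz : normc z ^+ 2 = Re (z * z^*) by rewrite mulcJ.
  have ReJ2 (x y : R[i]) : x + x^* = y + y^* -> Re x = Re y.
    by move=> /(congr1 (@complex.Re R)); rewrite !cReD !cReJ; lra.
  have -> : Re (c * z ^+ 2 + b * z) *+ 2 - normc z ^+ 2 + Re (s * h) =
      Re (c * z ^+ 2 + b * z + (c * z ^+ 2 + b * z) - z * z^* + s * h).
    by rewrite !(cReD, cReN) -zz mulr2n.
  apply: ReJ2; apply: (mulIf D_neq0).
  have hD : s * h * D = s * (s^* + 2 * c * s) by rewrite /h -(mulrA s) divfK.
  have hD' : (s * h)^* * D = s^* * (s + 2 * c * s^*).
    by have := congr1 (@conjc R) hD; rewrite (cJM (s * h) D) DJ => ->; rewrite !cJE.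
  pose t := b * ((b^* + 2 * c * b) / D).
  have tD : t * D = b * (b^* + 2 * c * b) by rewrite /t -(mulrA b) divfK.
  have tD' : t^* * D = b^* * (b + 2 * c * b^*).
    by have := congr1 (@conjc R) tD; rewrite (cJM t D) DJ => ->; rewrite !cJE.
  rewrite -/t [RHS]mulrDl tD tD' !cJD !cJN.
  have aux (x y e e' : R[i]) : (x + e + (y + e')) * D = (x + y) * D + (e * D + e' * D) by ring.
  rewrite aux hD hD' /s !cJE.
  move: rhoLJ rho2J; move: (b^*) (rho^*) (z^*) rhoN rhoL => b' r' z' h1 h2 h3 h4.
  apply/eqP; rewrite -subr_eq0; apply/eqP.
  have -> : (c * z ^+ 2 + b * z + (c * z ^+ 2 + b * z) - z * z' +
      (c * z' ^+ 2 + b' * z' + (c * z' ^+ 2 + b' * z') - z' * z)) * D +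
     ((b + rho * z) * (b' + r' * z' + 2 * c * (b + rho * z)) +
      (b' + r' * z') * (b + rho * z + 2 * c * (b' + r' * z'))) -
     (b * (b' + 2 * c * b) + b' * (b + 2 * c * b')) =
     2 * z ^+ 2 * (c * D + c * rho ^+ 2) + 2 * z' ^+ 2 * (c * D + c * r' ^+ 2) +
     2 * z * (b * D + rho * (b' + 2 * c * b)) + 2 * z' * (b' * D + r' * (b + 2 * c * b')) +
     2 * z * z' * (rho * r' - D) by ring.
  by rewrite h1 h2 h3 h4 rho2; ring.
rewrite -[X in (_ * X)%E]fineK ?ge0_fin_numE// -EFinM lee_fin /schur_const.
by rewrite lerDl.
Qed.

End GaussianConjugation.

(** * Symmetry of [W] with respect to [J] *)

Section WeightedCompositionSymmetry.
Context {R : realType}.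
Local Notation T2 := (measurableTypeR R * measurableTypeR R)%type.
Local Notation area := (@Defs.area R).

Lemma fip_antilinear (k : R[i]) h f g : l2 h -> l2 f -> l2 g ->
  fip h (fun w => k * f w + g w) = k^* * fip h f + fip h g.
Proof.
move=> lh lf lg; rewrite /fip (mulrCA k^*) -mulrDr; congr (_ * _).
rewrite -cintZ; last exact: cintegrable_l2.
rewrite -cintD; last 2 first.
- by apply: cintegrableZ; exact: cintegrable_l2.
- exact: cintegrable_l2.
apply: eq_cint => p; rewrite cJD cJM.
have aux (m x a b w : R[i]) : m * (x * a + b) * w = x * (m * a * w) + m * b * w by ring.
exact: aux.
Qed.

Variables (cc : R) (b rho : R[i]).
Hypothesis cc12 : `|cc| < 2^-1.
Local Notation c := (cc%:C : R[i]).
Local Notation D := (1 - 4 * c ^+ 2).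
Local Notation Q := (qkern cc b).
Hypothesis rhoN : rho * rho^* = D.
Hypothesis rhoL : rho * (b^* + 2 * c * b) = - b * D.
Hypothesis rho2 : c * rho ^+ 2 = - c * D.

Let Qsym r z w : Q r z w = Q r w z. Proof. exact: qkern_sym. Qed.
Let Ql2 r z : l2 (Q r z). Proof. exact: l2_qkern. Qed.
Let Qm r := cmeas_qkern cc b r.
Let M_gt0 := schur_const_gt0 b cc12.
Let schur := schur_qkern cc12 rhoN rhoL rho2.

Lemma in_fock_qkern f : l2 f -> in_fock (hop (Q rho) f).
Proof.
move=> lf; have eH : entire (hop (Q rho) f) by exact: (entire_hop_qkern cc12 lf).
apply/in_fockP; split; first exact: eH.
exact: (l2_hop (Qsym rho) (Ql2 rho) (Qm rho) M_gt0 schur lf (cmeas_entire eH)).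
Qed.

Lemma ex_qkern : exists J : fock R -> fock R, forall f z, J f z = hop (Q rho) f z.
Proof.
have H (f : fock R) : exists F : fock R, forall z, F z = hop (Q rho) f z.
  by apply: fock_of; apply: in_fock_qkern; exact: fock_l2.
by have [J JE] := boolp.choice H; exists J.
Qed.

Variable J : fock R -> fock R.
Hypothesis JE : forall f z, J f z = hop (Q rho) f z.

Let JEf f : (J f : R[i] -> R[i]) = hop (Q rho) f.
Proof. by apply/funext => z; exact: JE. Qed.

Let Jsym := hop_sym (Qsym rho) (Ql2 rho) (Qm rho) M_gt0 schur.

(** [J (J f) z] is the conjugate of [<J f, Q_z>], which equals [<J Q_z, f> = <K_z, f>] by symmetry
    of [J] and [hop_qkern]; the reproducing property concludes. *)
Lemma qkern_involutive f : J (J f) = f.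
Proof.
apply: fock_ext => z; rewrite JE /hop (fipJ (fock_l2 _) (Ql2 rho z)) JEf.
rewrite (Jsym (fock_l2 f) (Ql2 rho z)).
have -> : hop (Q rho) (Q rho z) = kern z by apply/funext => w; exact: hop_qkern.
rewrite (fipJ (fock_l2 f) (l2_kern z)) cJK fip_kern//; exact: fock_in_fock.
Qed.

Lemma conjugation_qkern : conjugation (@fock_ip R) J.
Proof.
split=> [k f g|f|f g]; last 2 first.
- exact: qkern_involutive.
- rewrite !fock_ipE {1}JEf (Jsym (fock_l2 f) (fock_l2 (J g))) -JEf.
  by rewrite qkern_involutive.
apply: fock_ext => z; rewrite JE.
have -> : (k^* *: J f + J g) z = k^* * J f z + J g z by [].
rewrite !JE; exact: (fip_antilinear k (Ql2 rho z) (fock_l2 f) (fock_l2 g)).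
Qed.

Variables (a u v : R[i]) (W : fock R -> fock R).
Hypothesis ub : b * (1 - a) = v.
Hypothesis uc : c * (1 - a ^+ 2) = u.
Local Notation psi := (fun z => cexp (u * z ^+ 2 + v * z)).
Hypothesis WE : weighted_composition psi (fun z => a * z) W.
Hypothesis Wb : fock_bounded W.

(** [W] is tested on the kernel at [a * z]: at [z] its image takes the value
    [psi z * expR (normc (a * z) ^+ 2)], which [fock_pointwise] bounds by the norm of that
    kernel. *)
Lemma bounded_symbol : exists2 B : R, 0 < B &
  forall z, normc (psi z) * expR (- (normc z ^+ 2 / 2)) <= B * expR (- (normc (a * z) ^+ 2 / 2)).
Proof.
have [M WM] := Wb; pose M' := Num.max M 1.
have M1 : 0 < M' by rewrite lt_max ltr01 orbT.
exists (2 * M'); first by rewrite mulr_gt0.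
move=> z; have [K KE] := fock_of (in_fock_kern (a * z)).
have KE' : (K : R[i] -> R[i]) = kern (a * z) by apply/funext.
pose e := expR (normc (a * z) ^+ 2 / 2).
have ee : expR (normc (a * z) ^+ 2) = e ^+ 2 by rewrite [e ^+ 2]expr2 /e -expRD -splitr.
have e0 : 0 < e by exact: expR_gt0.
have nW : nrm2 (W K) <= (M' * e) ^+ 2.
  have := WM K; rewrite !fock_normE; try exact: fock_l2.
  rewrite KE' nrm2_kern ee sqrtr_sqr (gtr0_norm e0) => H.
  rewrite -(sqr_sqrtr (nrm2_ge0 (W K))) ler_pXn2r ?nnegrE ?sqrtr_ge0//; last first.
    by rewrite mulr_ge0// ltW.
  by apply: le_trans H _; rewrite ler_wpM2r ?(ltW e0)// le_max lexx.
have := fock_pointwise z (fock_in_fock (W K)) (mulr_gt0 M1 e0) nW.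
rewrite WE KE' normcM.
have -> : normc (kern (a * z) (a * z)) = e ^+ 2.
  by rewrite /kern mulrC mulcJ cexpR normcR ger0_norm ?expR_ge0.
move: (normc (psi z)) => x H.
rewrite !expRN -/e ler_pdivrMr ?expR_gt0// mulrAC ler_pdivlMr//.
move: (expR _) H => y H; rewrite -(ler_pM2r e0); apply: le_trans (le_trans H _).
  by rewrite -mulrA -expr2.
by rewrite (_ : _ * y = 2 * M' * y * e)//; ring.
Qed.

(** Since [psi z * q (a * z) = q z], applying [W] in the first variable only multiplies the
    parameter by [a]. *)
Let Qa z w : psi z * Q rho (a * z) w = Q (rho * a) z w.
Proof.
have aux (n e1 e2 e3 e4 : R[i]) : e1 * e2 = e4 -> e1 * (n * e2 * e3) = n * e4 * e3.
  by move=> <-; ring.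
rewrite /qkern -(mulrA rho); apply: aux; rewrite /gquad -cexpD; congr cexp.
by rewrite -ub -uc; ring.
Qed.

(** By [Qa] a row at [z] is [psi z] times the row of the kernel of [J] at [a * z]; [bounded_symbol]
    compensates the change of the weight from [z] to [a * z]. *)
Lemma schur_qkern_a : exists2 M : R, 0 < M &
  forall p : T2, (\int[area]_p' (nkern (Q (rho * a)) p p')%:E <= M%:E)%E.
Proof.
have [B B0 psiB] := bounded_symbol.
exists (B * schur_const cc b); first by rewrite mulr_gt0.
move=> p; pose z := cpx p.
pose p0 : T2 := (Re (a * z), Im (a * z)).
have zp0 : cpx p0 = a * z by rewrite /p0 /cpx; case: (a * z).
have m r (p1 : T2) : measurable_fun setT (fun p' : T2 => nkern (Q r) p1 p').
  apply: measurable_funM; last exact: measurable_hw.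
  apply: measurable_funM => //; apply: measurable_cmeas_normc.
  by case: (Ql2 r (cpx p1)).
apply: (@le_trans _ _ (\int[area]_p' (B%:E * (nkern (Q rho) p0 p')%:E))%E).
  apply: ge0_le_integral => //.
  - by move=> p' _; rewrite lee_fin /nkern !mulr_ge0 ?normc_ge0 ?hw_ge0.
  - by apply/measurable_EFinP; exact: m.
  - by apply: measurable_funeM; apply/measurable_EFinP; exact: m.
  - move=> p' _; rewrite -EFinM lee_fin /nkern -Qa zp0 (normcM (psi z)).
    have aux (x y h k l : R) : 0 <= y -> 0 <= l -> x * h <= B * k ->
        x * y * h * l <= B * (y * k * l).
      move=> y0 l0 H; have -> : x * y * h * l = x * h * (y * l) by ring.
      have -> : B * (y * k * l) = B * k * (y * l) by ring.
      by rewrite ler_wpM2r// mulr_ge0.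
    apply: aux; [exact: normc_ge0|exact: hw_ge0|].
    by rewrite /hw zp0; exact: psiB.
rewrite ge0_integralZl//.
- rewrite EFinM; apply: lee_pmul => //; first by rewrite lee_fin ltW.
  by apply: integral_ge0 => p' _; rewrite lee_fin /nkern !mulr_ge0 ?normc_ge0 ?hw_ge0.
- by apply/measurable_EFinP; exact: m.
- by move=> p' _; rewrite lee_fin /nkern !mulr_ge0 ?normc_ge0 ?hw_ge0.
- by rewrite lee_fin ltW.
Qed.

Lemma symmetric_qkern : complex_symmetric_wrt (@fock_ip R) J W.
Proof.
split; first exact: conjugation_qkern.
have [_ JJ Jiso] := conjugation_qkern.
have [M M0 schura] := schur_qkern_a.
have WJ f : (W (J f) : R[i] -> R[i]) = hop (Q (rho * a)) f.
  apply/funext => z; rewrite WE JE /hop.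
  have e : (fun w => psi z * Q rho (a * z) w) = Q (rho * a) z.
    by apply/funext => w; exact: Qa.
  apply: (etrans (esym (fipZl (psi z) (Ql2 rho (a * z)) (fock_l2 f)))).
  exact: (congr1 (fun h => fip h f) e).
have WJsym := hop_sym (Qsym (rho * a)) (Ql2 (rho * a)) (Qm (rho * a)) M0 schura.
exists (fun f => J (W (J f))) => [f g|f]; last by rewrite !JJ.
rewrite -{1 2}(JJ f) Jiso !fock_ipE !WJ.
exact: WJsym (fock_l2 (J f)) (fock_l2 g).
Qed.

End WeightedCompositionSymmetry.

(** * The integral formula for [J] and the choice of [rho] *)

Section ConjugationFactor.
Context {R : realType}.
Local Notation area := (@Defs.area R).
Variables (cc : R) (b : R[i]).
Hypothesis cc12 : `|cc| < 2^-1.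
Local Notation c := (cc%:C : R[i]).
Local Notation D := (1 - 4 * c ^+ 2).
Local Notation q := (gquad cc b).

Lemma qkern_formula rho f z : l2 f -> hop (qkern cc b rho) f z =
  q z / (pi * fock_norm q)%:C *
  cintegral (fun w => q w * cexp (rho * z * w) * (f w)^* * cexp (- `|w| ^+ 2)).
Proof.
move=> lf.
have lq s := l2_quad cc12 s.
rewrite fock_normE; last exact: lq.
set n := Num.sqrt _.
have -> : cintegral (fun w => q w * cexp (rho * z * w) * (f w)^* * cexp (- `|w| ^+ 2)) =
    cint area (fun p => gquad cc (b + rho * z) (cpx p) * (f (cpx p))^* * (wt p)%:C).
  apply: eq_cint => p; rewrite gquadD -cexp_wt.
  have aux (x y s t : R[i]) : x * y * s * t = y * x * s * t by ring.
  exact: aux.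
apply: (etrans (fipZl (n^-1%:C * q z) (lq (b + rho * z)) lf)).
have aux (p m x y s : R[i]) : s = p * m -> m * x * (p * y) = x * s * y by move=> ->; ring.
by apply: aux; rewrite -fmorphV invfM; exact: rmorphM.
Qed.

Let D_gt0 : 0 < D.
Proof.
have -> : D = (1 - 4 * cc ^+ 2)%:C by rewrite rmorphB rmorphM rmorphXn rmorph_nat.
rewrite ltcR.
by move: cc12; rewrite ltr_norml => /andP[h1 h2]; nra.
Qed.

Let D_neq0 : D != 0. Proof. by rewrite gt_eqF. Qed.

(** With its conjugate this is a homogeneous linear system in [b] and [b^*] whose determinant is [D]
    up to sign. *)
Lemma L_neq0 : b != 0 -> b^* + 2 * c * b != 0.
Proof.
apply: contra_neq => h.
have h' : b + 2 * c * b^* = 0 by have := congr1 (@conjc R) h; rewrite !cJE.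
apply: (mulIf D_neq0); rewrite mul0r.
have -> : b * D = (b + 2 * c * b^*) - 2 * c * (b^* + 2 * c * b) by move: (b^*) => b'; ring.
by rewrite h h' mulr0 subr0.
Qed.

Lemma rho_spec (rho := if b != 0 then - b / ((b^* + 2 * c * b) / D)
             else if c == 0 then 1 else 'i * sqrtC D) :
  c * (b ^+ 2 + b^* ^+ 2 + 4 * c * (b * b^*)) = 0 ->
  [/\ rho * rho^* = D, rho * (b^* + 2 * c * b) = - b * D & c * rho ^+ 2 = - c * D].
Proof.
rewrite /rho; have [-> _|b0 h] := eqVneq b 0; lazy beta iota delta [negb].
  have [->|c0] := eqVneq c 0; lazy iota.
    by rewrite [0 ^+ 2]expr2 !mulr0 subr0 cJ1 cJ0 oppr0 !mul0r !addr0 mulr1 mulr0.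
  have sJ : (sqrtC D)^* = sqrtC D.
    by apply: CrealP; apply: ger0_real; rewrite sqrtC_ge0 ltW.
  have iJ : ('i : R[i])^* = - 'i := conjCi _.
  rewrite cJM sJ iJ cJ0 mulr0 addr0 mulr0 oppr0 mul0r; split=> //.
    by rewrite mulrACA mulrN -!expr2 sqrCi sqrtCK opprK mul1r.
  by rewrite exprMn sqrCi sqrtCK mulN1r mulrN mulNr.
have l0 := L_neq0 b0.
have l0' : b + 2 * c * b^* != 0.
  by rewrite -(inj_eq (can_inj (@conjcK R))) !cJE.
have DJ : D^* = D by rewrite !cJE.
have rJ : (- b / ((b^* + 2 * c * b) / D))^* = - b^* / ((b + 2 * c * b^*) / D).
  by rewrite cJM cJV (cJM _ D^-1) cJV DJ !cJE.
rewrite rJ; move: (b^*) h l0 l0' => b' h l0 l0'; split.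
- have -> : - b / ((b' + 2 * c * b) / D) * (- b' / ((b + 2 * c * b') / D)) =
    (b * b' * D ^+ 2) / ((b' + 2 * c * b) * (b + 2 * c * b')) by field; rewrite ?l0 ?l0' ?D_neq0.
  apply: (mulIf (mulf_neq0 l0 l0')); rewrite divfK ?mulf_neq0//.
  apply/eqP; rewrite -subr_eq0; apply/eqP.
  rewrite (_ : _ - _ = - 2 * D * (c * (b ^+ 2 + b' ^+ 2 + 4 * c * (b * b')))); last by ring.
  by rewrite h mulr0.
- by field; rewrite ?l0 ?D_neq0.
- apply: (mulIf (expf_neq0 2 l0)); apply/eqP; rewrite -subr_eq0; apply/eqP.
  have -> : c * (- b / ((b' + 2 * c * b) / D)) ^+ 2 * (b' + 2 * c * b) ^+ 2 = c * b ^+ 2 * D ^+ 2.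
    by field; rewrite ?l0 ?D_neq0.
  rewrite (_ : _ - _ = D * (c * (b ^+ 2 + b' ^+ 2 + 4 * c * (b * b')))); last by ring.
  by rewrite h mulr0.
Qed.

End ConjugationFactor.

(** * Eigenfunctions and moments *)

Section Eigenfunctions.
Context {R : realType}.
Implicit Types (f g : R[i] -> R[i]) (a d z : R[i]).

(** [g z] is [g (a ^+ n * z) / a ^+ n], and [a ^+ n * z] tends to 0, so the first-order behaviour at
    0 determines [g] everywhere. *)
Lemma cderiv_homogeneous a d g : 0 < normc a < 1 -> cderiv g 0 d ->
  (forall z, g (a * z) = a * g z) -> forall z, g z = d * z.
Proof.
move=> /andP[a0 a1] gd ga z.
have an0 : a != 0 by apply: contraTneq a0 => ->; rewrite normc0 ltxx.
have g0 : g 0 = 0.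
  have := ga 0; rewrite mulr0 => /eqP; rewrite -subr_eq0 -{1}(mul1r (g 0)) -mulrBl mulf_eq0.
  case/orP=> /eqP // /subr0_eq a1'.
  by move: a1; rewrite -a1' normcR normr1 ltxx.
have gn n : g (a ^+ n * z) = a ^+ n * g z.
  elim: n => [|n IH]; first by rewrite expr0 !mul1r.
  by rewrite exprS -!mulrA ga IH.
have normX n : normc (a ^+ n) = normc a ^+ n.
  by elim: n => [|n IH]; rewrite ?expr0 ?normcR ?normr1// !exprS normcM IH.
apply/eqP; rewrite -subr_eq0; apply/eqP; apply: eq0_normc.
apply/eqP; rewrite eq_le normc_ge0 andbT; apply/ler_addgt0Pl => e e0; rewrite addr0.
pose K := normc z + 1; have K0 : 0 < K by rewrite ltr_wpDl ?normc_ge0.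
have [r r0 H] := gd (e / K) (divr_gt0 e0 K0).
have [n nr] : exists n, normc a ^+ n * K < r.
  have a1' : `|normc a| < 1 by rewrite ger0_norm ?normc_ge0.
  have /cvgrPdist_lt/(_ _ (divr_gt0 r0 K0))[n _ /(_ n (leqnn n))] := cvg_expr a1'.
  rewrite /= sub0r normrN ger0_norm ?exprn_ge0 ?normc_ge0// ltr_pdivlMr// => h.
  by exists n.
have an : 0 < normc a ^+ n by rewrite exprn_gt0.
have zK : normc z <= K by rewrite lerDl.
have := H (a ^+ n * z); rewrite add0r g0 subr0 gn mulrCA -mulrBr !normcM normX.
rewrite mulrCA ler_pM2l// => H'; apply: (@le_trans _ _ (e / K * normc z)).
  by apply: H'; apply: le_lt_trans nr; rewrite ler_pM2l.
by rewrite mulrAC ler_pdivrMr// ler_pM2l.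
Qed.

(** The function [z * g z] falls under [cderiv_homogeneous], with derivative [g 0] at 0. *)
Lemma cderiv_invariant a d g : 0 < normc a < 1 -> cderiv g 0 d ->
  (forall z, g (a * z) = g z) -> forall z, g z = g 0.
Proof.
move=> ha gd ga z.
have G := cderivM (cderiv_id 0) gd; rewrite mul1r mul0r addr0 in G.
have [->//|z0] := eqVneq z 0.
have := cderiv_homogeneous ha G _ z.
rewrite /= (mulrC (g 0)) => H; apply: (mulfI z0); apply: H => w.
by rewrite ga mulrA.
Qed.

End Eigenfunctions.

(** * Moments of the Gaussian functions *)

Section GaussianMoments.
Context {R : realType}.

Lemma in_fock_affine (d : R[i]) : in_fock (fun w => w + d).
Proof.
have ef : entire (fun w : R[i] => w + d) by exact: (entireD (@entire_id R) (@entire_cst R d)).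
apply/in_fockP; split; first exact: ef.
apply: (@l2_growth _ _ (1 + normc d) 0 1) => [||w]; first exact: cmeas_entire ef.
  by rewrite invr_gt0.
rewrite mul0r add0r mul1r (le_trans (ler_normcD _ _))//.
have := expR_ge1Dx (normc w); have := normc_ge0 w; have := normc_ge0 d.
by move: (normc d) (normc w) (expR _) => x y E; nra.
Qed.

Variable cc : R.
Hypothesis cc12 : `|cc| < 2^-1.
Local Notation c := (cc%:C : R[i]).
Local Notation D := (1 - 4 * c ^+ 2).
Local Notation quad := (gquad cc).
Implicit Types s t : R[i].

Lemma in_fock_mul_quad s : in_fock (fun w => w * quad s w).
Proof.
have ef : entire (fun w : R[i] => w * quad s w).
  exact: (entireM (@entire_id R) (@entire_quad_fun R cc s)).
apply/in_fockP; split; first exact: ef.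
apply: (@l2_growth _ _ 1 `|cc| (normc s + 1)) => [||w]; [exact: cmeas_entire ef|exact: cc12|].
rewrite (normcM w) mul1r mulrDl mul1r addrA expRD mulrC.
apply: ler_pM; rewrite ?normc_ge0//; last first.
  by apply: le_trans (expR_ge1Dx _); rewrite lerDr.
apply: le_trans (normc_cexp_le _) _; rewrite ler_expR.
apply: le_trans (ler_normcD _ _) _.
have E : normc (c * w ^+ 2) = `|cc| * normc w ^+ 2.
  by rewrite normcM normcR expr2 normcM -expr2.
by rewrite E (normcM s).
Qed.

Let l2q s := l2_quad cc12 s.
Let l2zq s : l2 (fun w => w * quad s w).
Proof. by have /in_fockP[] := in_fock_mul_quad s. Qed.

Let cderiv_fip g s : l2 g ->
  cderiv (fun s => fip (quad s) g) s (fip (fun w => w * quad s w) g).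
Proof. by move=> lg; apply: cderivZ; exact: cderiv_ip. Qed.

Let fip_quad s t : fip (quad s) (quad t) =
  (pi^-1)%:C * quad_ip cc 0 0 * cexp (quad_exponent cc s t).
Proof. by rewrite -mulrA -gaussian_ip. Qed.

Let cderiv_fip_quad s t :
  cderiv (fun s => fip (quad s) (quad t)) s
    (fip (quad s) (quad t) * ((t^* + 2 * c * s) / D)).
Proof.
have dE : cderiv (fun s => quad_exponent cc s t) s ((t^* + 2 * c * s) / D).
  apply: (@cderiv_quad _ _ _ _ (normc (c / D))) => h _.
  rewrite [X in normc X](_ : _ = c / D * (h * h)).
    by rewrite !normcM -expr2.
  rewrite /quad_exponent; move: (t^*) (D^-1) => t' D'; ring.
have H := cderivZ ((pi^-1)%:C * quad_ip cc 0 0) 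
  (cderiv_comp (g := fun s => quad_exponent cc s t) (cderiv_cexp (quad_exponent cc s t)) dE).
rewrite fip_quad -mulrA.
by apply: cderiv_ext H => s'; rewrite fip_quad.
Qed.

(** Two derivatives in [s] of the same inner product: one taken under the integral, the other from
    the closed form. *)
Lemma fip_mul_quad s t : fip (fun w => w * quad s w) (quad t) =
  fip (quad s) (quad t) * ((t^* + 2 * c * s) / D).
Proof. exact: cderiv_unique (cderiv_fip s (l2q t)) (cderiv_fip_quad s t). Qed.

Let DJ : (D^-1)^* = D^-1.
Proof. by rewrite cJV; congr (_^-1); rewrite !cJE. Qed.

Lemma fip_quad_mul s t : fip (quad s) (fun w => w * quad t w) =
  fip (quad s) (quad t) * ((s + 2 * c * t^*) / D).
Proof.
rewrite (fipJ (l2zq t) (l2q s)) fip_mul_quad (fipJ (l2q s) (l2q t)) cJM cJK.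
by rewrite (cJM _ D^-1) DJ !cJE.
Qed.

(** [fip_quad_mul] is differentiated once more in [s]; the summand [D^-1] is the derivative of its
    linear factor. *)
Lemma fip_mul_quad_mul s t : fip (fun w => w * quad s w) (fun w => w * quad t w) =
  fip (quad s) (quad t) * ((t^* + 2 * c * s) / D * ((s + 2 * c * t^*) / D) + D^-1).
Proof.
have d : cderiv (fun s => (s + 2 * c * t^*) / D) s D^-1.
  apply: (@cderiv_quad _ _ _ _ 0) => h _.
  rewrite (_ : _ - _ = 0); first by rewrite normc0 mul0r.
  by move: (t^*) (D^-1) => t' D'; ring.
have H := cderivM (cderiv_fip_quad s t) d.
have -> : fip (quad s) (quad t) * ((t^* + 2 * c * s) / D * ((s + 2 * c * t^*) / D) + D^-1) =
  fip (quad s) (quad t) * ((t^* + 2 * c * s) / D) * ((s + 2 * c * t^*) / D) +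
  fip (quad s) (quad t) * D^-1 by rewrite mulrDr mulrA.
apply: cderiv_unique (cderiv_fip s (l2zq t)) _.
by apply: cderiv_ext H => s'; rewrite fip_quad_mul.
Qed.

End GaussianMoments.

(** * Necessity of the condition *)

Section Necessity.
Context {R : realType}.
Variables (cc : R) (b a u v : R[i]) (W C S : fock R -> fock R).
Hypothesis cc12 : `|cc| < 2^-1.
Hypothesis a01 : 0 < normc a < 1.
Local Notation c := (cc%:C : R[i]).
Local Notation D := (1 - 4 * c ^+ 2).
Local Notation q := (gquad cc b).
Hypothesis ub : b * (1 - a) = v.
Hypothesis uc : c * (1 - a ^+ 2) = u.
Local Notation psi := (fun z => cexp (u * z ^+ 2 + v * z)).
Hypothesis WE : weighted_composition psi (fun z => a * z) W.
Hypothesis Cconj : conjugation (@fock_ip R) C.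
Hypothesis Sadj : adjoint (@fock_ip R) W S.
Hypothesis WCSC : forall x, W x = C (S (C x)).

Lemma fipZr k (f g : R[i] -> R[i]) : l2 f -> l2 g -> fip f (fun w => k * g w) = k^* * fip f g.
Proof. by move=> lf lg; rewrite (fipJ (l2Z k lg) lf) fipZl// cJM -fipJ. Qed.

Lemma fip_affine (x : R[i] -> R[i]) d e : in_fock x -> cderiv x 0 d ->
  fip x (fun w => w + e) = d + e^* * x 0.
Proof.
move=> fx dx; have [ex lx] := (in_fockP x).1 fx.
have lid : l2 (fun w : R[i] => w + 0) by have /in_fockP[] := @in_fock_affine R 0.
have -> : (fun w => w + e) = (fun w => e * kern 0 w + (w + 0)).
  by apply/funext => w; rewrite /kern cJ0 mul0r cexp0 mulr1 addr0 addrC.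
rewrite fip_antilinear//; last exact: l2_kern.
rewrite fip_kern// addrC; congr (_ + _).
apply: cderiv_unique dx; have := cderiv_reproducing 0 fx.
rewrite (_ : (pi^-1)%:C * _ = fip x (fun w => w + 0))//.
congr (_ * _); apply: eq_cint => p; rewrite mul0r cexp0 addr0.
have aux (r y s : R[i]) : r * 1 * (y * s) = y * r * s by ring.
exact: aux.
Qed.

(** The eigenvalue equation of [W] divided by [q z = psi z * q (a * z)]: the quotient of [h] by [q]
    is an eigenfunction of the dilation alone. *)
Let quotient k (h : fock R) : (forall z, psi z * h (a * z) = k * h z) ->
  forall z, h (a * z) * cexp (- (c * (a * z) ^+ 2 + b * (a * z))) =
    k * (h z * cexp (- (c * z ^+ 2 + b * z))).
Proof.
move=> H z.
have aux (x y p e e' : R[i]) : p * x = k * y -> e = p * e' -> x * e = k * (y * e').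
  by move=> E1 ->; rewrite (mulrA k) -E1; ring.
apply: aux (H z) _; by rewrite -cexpD -ub -uc; congr cexp; ring.
Qed.

Let quotient_deriv (h : fock R) : exists d,
  cderiv (fun z => h z * cexp (- (c * z ^+ 2 + b * z))) 0 d.
Proof.
have e : (fun z : R[i] => cexp (- c * z ^+ 2 + - b * z)) = fun z => cexp (- (c * z ^+ 2 + b * z)).
  by apply/funext => z; rewrite opprD !mulNr.
have eq := @entire_quad R (- c) (- b); rewrite e in eq.
exact: ((entireP _).1 (entireM (@fock_entire R h) eq) 0).
Qed.

Let unquotient (h : fock R) z : h z = h z * cexp (- (c * z ^+ 2 + b * z)) * q z.
Proof. by rewrite -mulrA (mulrC (cexp _)) cexpNK mulr1. Qed.

Lemma symmetric_necessary : c * (b ^+ 2 + b^* ^+ 2 + 4 * c * (b * b^*)) = 0.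
Proof.
have [e0 e0E] := fock_of (@in_fock_kern R 0).
have [e1 e1E] := fock_of (@in_fock_affine R (- b^*)).
have {}e0E : (e0 : R[i] -> R[i]) = kern 0 by apply/funext.
have {}e1E : (e1 : R[i] -> R[i]) = fun w => w - b^* by apply/funext.
have fe0 (x : fock R) : fock_ip x e0 = x 0.
  by rewrite fock_ipE e0E fip_kern//; exact: fock_in_fock.
have fe1 (x : fock R) d : cderiv x 0 d -> fock_ip x e1 = d - b * x 0.
  move=> dx; rewrite fock_ipE e1E (fip_affine _ (fock_in_fock x) dx).
  by rewrite cJN cJK mulNr.
have [Canti0 CC Ciso] := Cconj.
have Canti (k : R[i]) x y : C (k *: x + y) = k^* *: C x + C y by exact: Canti0.
have C0 : C 0 = 0.
  have := Canti 1 0 0; rewrite scaler0 addr0 cJ1 scale1r => h.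
  by apply: (addIr (C 0)); rewrite add0r -h.
have CZ k x : C (k *: x) = k^* *: C x.
  by have := Canti k x 0; rewrite addr0 C0 addr0.
have S0 : S e0 = e0.
  apply: fip_ext => x; rewrite -Sadj !fe0 WE.
  by rewrite expr2 !mulr0 addr0 cexp0 mul1r.
(* Pairing with [e1] is [x'(0) - b * x 0]. On [W x] it gives [v * x 0 + a * x'(0) - b * x 0], and
   [v - b = - a * b] makes this [a] times the same functional; hence the shift by [b^*] in [e1]. *)
have S1 : S e1 = a^* *: e1.
  apply: fip_ext => x; rewrite -Sadj.
  have [d dx] := (entireP x).1 (@fock_entire R x) 0.
  have dp : cderiv psi 0 v.
    have dq : cderiv (fun z : R[i] => u * z ^+ 2 + v * z) 0 v.
      apply: (@cderiv_quad _ _ _ _ (normc u)) => h _.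
      rewrite [X in normc X](_ : _ = u * (h * h)); first by rewrite !normcM -expr2.
      ring.
    have := cderiv_comp (g := fun z : R[i] => u * z ^+ 2 + v * z) (cderiv_cexp _) dq.
    by rewrite expr2 !mulr0 addr0 cexp0 mul1r.
  have da : cderiv (fun z : R[i] => x (a * z)) 0 (d * a).
    have H := cderivZ a (cderiv_id 0); rewrite mulr1 in H.
    by apply: (cderiv_comp (g := fun z => a * z) _ H); rewrite mulr0.
  have dW : cderiv (W x) 0 (v * x 0 + d * a).
    have := cderivM dp da; rewrite expr2 !mulr0 addr0 cexp0 mul1r.
    by apply: cderiv_ext => z; rewrite WE.
  rewrite (fe1 _ _ dW) WE expr2 !mulr0 addr0 cexp0 mul1r.
  have -> : fock_ip x (a^* *: e1) = a * fock_ip x e1.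
    rewrite !fock_ipE.
    have -> : (a^* *: e1 : fock R) = (fun w => a^* * e1 w) :> (R[i] -> R[i]) by [].
    by rewrite (fipZr a^* (fock_l2 x) (fock_l2 e1)) cJK.
  rewrite (fe1 _ _ dx) -ub; ring.
have W0 : W (C e0) = C e0 by rewrite WCSC CC S0.
have W1 : W (C e1) = a *: C e1 by rewrite WCSC CC S1 CZ cJK.
have [d0 D0] := quotient_deriv (C e0).
have [d1 D1] := quotient_deriv (C e1).
have q0 : forall z, psi z * C e0 (a * z) = 1 * C e0 z by move=> z; rewrite -WE W0 mul1r.
have q1 : forall z, psi z * C e1 (a * z) = a * C e1 z by move=> z; rewrite -WE W1.
have [l Cl] : exists l, (C e0 : R[i] -> R[i]) = fun w => l * q w.
  eexists; apply/funext => z; rewrite (unquotient (C e0)); congr (_ * _).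
  by apply: (cderiv_invariant a01 D0) => w; rewrite (quotient q0) mul1r.
have [m Cm] : exists m, (C e1 : R[i] -> R[i]) = fun w => m * (w * q w).
  exists d1; apply/funext => z; rewrite (unquotient (C e1)) mulrA; congr (_ * _).
  by apply: (cderiv_homogeneous a01 D1) => w; rewrite (quotient q1).
have lq := l2_quad cc12 b.
have lzq : l2 (fun w => w * q w) by have /in_fockP[] := in_fock_mul_quad cc12 b.
have de1 : cderiv e1 0 1.
  rewrite e1E -[X in cderiv _ _ X]addr0.
  exact: (cderivD (cderiv_id 0) (cderiv_cst (- b^*) 0)).
(* [H0], [H1] and [H2] evaluate [<C x, C y> = <y, x>] on the pairs from [e0] and [e1]; [H2'] is the
   conjugate of [H2]. *)
have H0 : l * l^* * fip q q = 1.
  have := Ciso e0 e0; rewrite (fe0 e0) fock_ipE Cl.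
  rewrite (fipZl _ lq (l2Z l lq)) (fipZr _ lq lq) mulrA => ->.
  by rewrite e0E /kern mulr0 cexp0.
have H1 : m * m^* * fip (fun w => w * q w) (fun w => w * q w) = 1 + b * b^*.
  have := Ciso e1 e1; rewrite (fe1 _ _ de1) fock_ipE Cm.
  rewrite (fipZl _ lzq (l2Z m lzq)) (fipZr _ lzq lzq) mulrA => ->.
  by rewrite e1E add0r mulrN opprK.
have H2 : l * m^* * fip q (fun w => w * q w) = - b^*.
  have := Ciso e0 e1; rewrite (fe0 e1) fock_ipE Cl Cm.
  rewrite (fipZl _ lq (l2Z m lzq)) (fipZr _ lq lzq) mulrA => ->.
  by rewrite e1E add0r.
have H2' : l^* * m * fip (fun w => w * q w) q = - b.
  by rewrite (fipJ lq lzq); have := congr1 (@conjc R) H2; rewrite !cJM cJN !cJK.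
move: H1 H2 H2'; rewrite fip_mul_quad_mul// fip_quad_mul// fip_mul_quad//.
have D0' : D != 0.
  have -> : D = (1 - 4 * cc ^+ 2)%:C by rewrite rmorphB rmorphM rmorphXn rmorph_nat.
  rewrite (inj_eq (@complexI R)) gt_eqF//.
  by move: cc12; rewrite ltr_norml => /andP[h1 h2]; nra.
(* The rest is algebra in independent indeterminates. The product of [H2] and [H3], freed of [l] by
   [H0], gives [E1]; subtracting it from [H1] leaves [s = D], and inserting this in [E1] gives [E4],
   whose expansion is the condition. *)
move: (fip q q) (l^*) (m^*) (b^*) H0 => Q l' m' b' H0 H1 H2 H3.
pose s := m * m' * Q.
have E1 : s * ((b' + 2 * c * b) / D * ((b + 2 * c * b') / D)) = b * b'.
  have -> : b * b' = (- b') * (- b) by ring.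
  rewrite -H2 -H3 -[LHS]mul1r -H0 /s; move: (D^-1) => D'; ring.
have E2 : s * D^-1 = 1.
  apply: (addrI (b * b')); rewrite -{1}E1 -mulrDr [RHS]addrC -H1.
  exact: esym (mulrA _ _ _).
have E3 : s = D by rewrite -[s](divfK D0') E2 mul1r.
have E4 : (b' + 2 * c * b) * (b + 2 * c * b') = D * (b * b').
  by rewrite -E1 E3; field.
have two : (2 : R[i]) != 0 by rewrite pnatr_eq0.
apply: (mulfI two); rewrite mulr0.
have -> : 2 * (c * (b ^+ 2 + b' ^+ 2 + 4 * c * (b * b'))) =
  (b' + 2 * c * b) * (b + 2 * c * b') - D * (b * b') by ring.
by rewrite E4 subrr.
Qed.

End Necessity.

(** In the coordinates of [b] the second factor is [2 (x^2 (1 + 2 c) - y^2 (1 - 2 c))], and both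
    denominators are nonzero in the given range of [cc]. *)
Lemma cond_iff (R : realType) (cc : R) (b : R[i]) : 0 <= cc < 2^-1 ->
  let c := (cc%:C : R[i]) in
  c * (b ^+ 2 + (conjc b) ^+ 2 + 4 * c * (b * conjc b)) = 0 <->
  (c = 0 \/ (0 < c < 2^-1 /\
     ('Re b) ^+ 2 / (1 - 2 * c) = ('Im b) ^+ 2 / (1 + 2 * c))).
Proof.
move=> /andP[c0 c1] c.
have c12 : c < 2^-1.
  by rewrite (_ : 2^-1 = (2^-1 : R)%:C) ?ltcR// fmorphV rmorph_nat.
have n1 : 1 - 2 * c != 0.
  have -> : 1 - 2 * c = (1 - 2 * cc)%:C by rewrite rmorphB rmorphM rmorph_nat.
  by rewrite (inj_eq (@complexI R)) gt_eqF//; lra.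
have n2 : 1 + 2 * c != 0.
  have -> : 1 + 2 * c = (1 + 2 * cc)%:C by rewrite rmorphD rmorphM rmorph_nat.
  by rewrite (inj_eq (@complexI R)) gt_eqF//; lra.
have two : (2 : R[i]) != 0 by rewrite pnatr_eq0.
have E : b ^+ 2 + (conjc b) ^+ 2 + 4 * c * (b * conjc b) =
    2 * (('Re b) ^+ 2 * (1 + 2 * c) - ('Im b) ^+ 2 * (1 - 2 * c)).
  have bE := Crect b.
  have bJ : conjc b = 'Re b - 'i * 'Im b.
    rewrite {1}bE; exact: (conjC_rect (Creal_Re b) (Creal_Im b)).
  have aux (B B' i x y : R[i]) : i ^+ 2 = -1 -> B = x + i * y -> B' = x - i * y ->
      B ^+ 2 + B' ^+ 2 + 4 * c * (B * B') = 2 * (x ^+ 2 * (1 + 2 * c) - y ^+ 2 * (1 - 2 * c)).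
    move=> ii -> ->.
    have -> : (x + i * y) ^+ 2 + (x - i * y) ^+ 2 + 4 * c * ((x + i * y) * (x - i * y)) =
      2 * x ^+ 2 + 4 * c * x ^+ 2 + i ^+ 2 * (2 * y ^+ 2 - 4 * c * y ^+ 2) by ring.
    by rewrite ii; ring.
  exact: (aux _ _ _ _ _ (sqrCi R[i]) bE bJ).
split.
  have [->|cn0] := eqVneq c 0; first by left.
  move=> /eqP; rewrite mulf_eq0 (negbTE cn0) /= E mulf_eq0 (negbTE two) /= subr_eq0 => /eqP H.
  right; split; first by rewrite c12 andbT lt_neqAle eq_sym cn0 (ler0c cc).
  by apply/eqP; rewrite eqr_div//; apply/eqP.
case=> [->|[_ /eqP]]; first by rewrite mul0r.
by rewrite eqr_div// => /eqP H; rewrite E H subrr !mulr0.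
Qed.

End Fock.

Import Order.TTheory GRing.Theory Num.Theory numFieldNormedType.Exports.
Local Open Scope ring_scope.
Local Open Scope complex_scope.

Theorem theoremB (R : realType) (a u v : R[i]) (W : fock R -> fock R) :
  0 < `|a| < 1 -> `|u| < 2^-1 ->
  let phi := fun z : R[i] => a * z in
  let psi := fun z : R[i] => cexp (u * z ^+ 2 + v * z) in
  let b := v / (1 - a) in
  let c := u / (1 - a ^+ 2) in
  c \is Num.real -> 0 <= c < 2^-1 ->
  weighted_composition psi phi W -> fock_bounded W ->
  let q := fun z : R[i] => cexp (c * z ^+ 2 + b * z) in
  let D := 1 - 4 * c ^+ 2 in
  let L := (b^* + 2 * c * b) / D in
  let rho := if b != 0 then - b / L
             else if c == 0 then 1 else 'i * sqrtC D in
  let cond := c = 0 \/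
    (0 < c < 2^-1 /\
     ('Re b) ^+ 2 / (1 - 2 * c) = ('Im b) ^+ 2 / (1 + 2 * c)) in
  (complex_symmetric (@fock_ip R) W <-> cond) /\
  (cond -> exists J : fock R -> fock R,
     (forall f z, J f z = q z / (pi * fock_norm q)%:C *
        cintegral (fun w => q w * cexp (rho * z * w) * (f w)^*
                            * cexp (- `|w| ^+ 2))) /\
     complex_symmetric_wrt (@fock_ip R) J W).
Proof.
move=> a01 _ phi psi b c cR c01 WE Wb.
have a01' : 0 < ComplexField.Normc.normc a < 1 by move: a01; rewrite Defs.normcE !ltcR.
have cE : c = (complex.Re c)%:C.
  by move: c01 => /andP[+ _]; rewrite lecE => /andP[/eqP + _]; case: (c) => x y /= ->.
have ub : b * (1 - a) = v.
  rewrite divfK// subr_eq0; apply: contraTneq a01 => <-.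
  by rewrite normr1 ltxx andbF.
have uc : c * (1 - a ^+ 2) = u.
  rewrite divfK// subr_eq0; apply: contraTneq a01 => h.
  have /eqP : `|a| ^+ 2 = 1 by rewrite -normrX -h normr1.
  by rewrite sqrp_eq1// => /eqP ->; rewrite ltxx andbF.
(* From here [b] and [c] are tied to [u] and [v] by [ub] and [uc], and [c] is the image of a real
   number [cc]. *)
clearbody b c; move: cE; move: (complex.Re c) => cc cE; subst c.
have c01' : 0 <= cc < 2^-1.
  by move: c01; rewrite lecR (_ : 2^-1 = (2^-1 : R)%:C) ?ltcR// fmorphV rmorph_nat.
have cc12 : `|cc| < 2^-1 by case/andP: c01' => c0 c1; rewrite ger0_norm.
move=> q D L rho cond.
have iff := cond_iff b c01'.
have suff_cond : cond -> exists J : fock R -> fock R,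
     (forall f z, J f z = q z / (pi * fock_norm q)%:C *
        cintegral (fun w => q w * cexp (rho * z * w) * (f w)^*
                            * cexp (- `|w| ^+ 2))) /\
     complex_symmetric_wrt (@fock_ip R) J W.
  move=> /iff h; have [r1 r2 r3] := rho_spec cc12 h.
  have [J JE] := ex_qkern cc12 r1 r2 r3.
  exists J; split.
    by move=> f z; apply: etrans (JE f z) _; exact: (@qkern_formula R cc b cc12 _ f z (fock_l2 f)).
  exact: (symmetric_qkern cc12 r1 r2 r3 JE ub uc WE Wb).
split=> //; split=> [[C [Cc [S Sadj WC]]]|/suff_cond[J [_ JW]]]; last by exists J.
apply/iff; exact: (symmetric_necessary cc12 a01' ub uc WE Cc Sadj WC).
Qed.
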